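(* There exist a connected simply connected solvable (hence contractible) Lie group $S$, a closed $C^\infty$ manifold $M$ and a $C^\infty$ locally free right action $\rho_0$ of $S$ on $M$ which is locally parameter rigid but not parameter rigid.
   Context: Locally free means every isotropy subgroup is discrete in $S$; the orbit foliation $\mathcal{F}$ of $\rho_0$ is the foliation of $M$ by its orbits. Let $A(\mathcal{F},S)$ be the set of all $C^\infty$ locally free right actions of $S$ on $M$ with orbit foliation $\mathcal{F}$, with the topology induced from the $C^\infty$ compact-open topology of $C^\infty(M\times S,M)$. An action $\rho\in A(\mathcal{F},S)$ is parameter equivalent to $\rho_0$ if there are an automorphism $\Phi$ of $S$ and a diffeomorphism $F$ of $M$ such that $F(\rho_0(x,s))=\rho(F(x),\Phi(s))$ for all $x\in M$, $s\in S$, and $F$ preserves each leaf of $\mathcal{F}$ and is $C^0$ homotopic to the identity via $C^\infty$ maps preserving each leaf. $\rho_0$ is parameter rigid if every $\rho\in A(\mathcal{F},S)$ is parameter equivalent to $\rho_0$; it is locally parameter rigid if every $\rho$ in some neighborhood of $\rho_0$ in $A(\mathcal{F},S)$ is parameter equivalent to $\rho_0$. *)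

(* Defs.v *)
From HB Require Import structures.
From mathcomp Require Import all_boot all_order all_algebra.
From mathcomp Require Import all_classical all_reals all_analysis.

Set Implicit Arguments.
Unset Strict Implicit.
Unset Printing Implicit Defensive.

Import Order.TTheory GRing.Theory Num.Theory.
Import numFieldNormedType.Exports.

Local Open Scope classical_set_scope.
Local Open Scope ring_scope.

Section Calculus.
Variable R : realType.

(* For s = [:: i1; ...; ik], the partial derivative d_{i1} ... d_{ik} f.  At a
   point of an open set U its value depends only on the restriction of f to U. *)
Fixpoint iter_partial m n (s : seq 'I_m) (f : 'rV[R]_m -> 'rV[R]_n) :
    'rV[R]_m -> 'rV[R]_n :=
  if s is i :: s' then fun x => 'D_(delta_mx 0 i) (iter_partial s' f) x else f.

(* C^oo on U (meant for open U): all partial derivatives of all orders exist and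
   are continuous at every point of U. *)
Definition Cinfty_on m n (U : set 'rV[R]_m) (f : 'rV[R]_m -> 'rV[R]_n) :=
  forall s : seq 'I_m, forall x, U x ->
    {for x, continuous (iter_partial s f)} /\
    forall i, derivable (iter_partial s f) x (delta_mx 0 i).

End Calculus.

(* A homeomorphism between open sets of T and R^n.  Both directions are total
   functions whose values outside the domain and the codomain are irrelevant. *)
Record chart (R : realType) (n : nat) (T : topologicalType) := Chart {
  chart_fun :> T -> 'rV[R]_n;
  chart_inv : 'rV[R]_n -> T;
  chart_dom : set T;
  chart_cod : set 'rV[R]_n;
  chart_dom_open : open chart_dom;
  chart_cod_open : open chart_cod;
  chart_funS : forall x, chart_dom x -> chart_cod (chart_fun x);
  chart_invS : forall y, chart_cod y -> chart_dom (chart_inv y);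
  chart_funK : forall x, chart_dom x -> chart_inv (chart_fun x) = x;
  chart_invK : forall y, chart_cod y -> chart_fun (chart_inv y) = y;
  chart_fun_cont : forall x, chart_dom x -> {for x, continuous chart_fun};
  chart_inv_cont : forall y, chart_cod y -> {for y, continuous chart_inv}
}.

Definition local_rep (R : realType) m n (X Y : topologicalType)
    (c : chart R m X) (d : chart R n Y) (f : X -> Y) :
    'rV[R]_m -> 'rV[R]_n :=
  fun y => d (f (chart_inv c y)).

Definition local_rep_dom (R : realType) m n (X Y : topologicalType)
    (c : chart R m X) (d : chart R n Y) (f : X -> Y) : set 'rV[R]_m :=
  [set y | chart_cod c y /\ chart_dom d (f (chart_inv c y))].

Definition smooth_transition (R : realType) n (T : topologicalType)
    (c d : chart R n T) :=
  Cinfty_on (local_rep_dom c d idfun) (local_rep c d idfun).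

(* A topological space with an arbitrary set of charts; no axiom yet. *)
HB.mixin Record hasAtlas (R : realType) (n : nat) T of Topological T := {
  atlas : set (chart R n T)
}.

#[short(type="chartedType")]
HB.structure Definition Charted (R : realType) (n : nat) :=
  {T of hasAtlas R n T & Topological T}.

(* Boundaryless manifold of pure dimension n. The atlas need not be maximal. *)
HB.mixin Record Charted_isSmoothManifold (R : realType) (n : nat) T
    of Charted R n T := {
  manifold_hausdorff : hausdorff_space T;
  manifold_second_countable : @second_countable T;
  atlas_cover : forall x : T, exists2 c, atlas c & chart_dom c x;
  atlas_compatible : forall c d : chart R n T,
    atlas c -> atlas d -> smooth_transition c d
}.

#[short(type="smoothManifoldType")]
HB.structure Definition SmoothManifold (R : realType) (n : nat) :=
  {T of Charted_isSmoothManifold R n T & Charted R n T}.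

Section ProductCharts.
Context (R : realType) (m n : nat) (X Y : topologicalType).
Variables (c : chart R m X) (d : chart R n Y).

Definition prod_chart_fun (p : X * Y) : 'rV[R]_(m + n) :=
  row_mx (c p.1) (d p.2).
Definition prod_chart_inv (y : 'rV[R]_(m + n)) : X * Y :=
  (chart_inv c (lsubmx y), chart_inv d (rsubmx y)).
Definition prod_chart_dom : set (X * Y) := chart_dom c `*` chart_dom d.
Definition prod_chart_cod : set 'rV[R]_(m + n) :=
  [set y | chart_cod c (lsubmx y) /\ chart_cod d (rsubmx y)].

Let dom_open : open prod_chart_dom.
Proof.
rewrite openE => -[x y] [/= cx dy]; exists (chart_dom c, chart_dom d) => //=.
by split; apply: open_nbhs_nbhs; split=> //; exact: chart_dom_open.
Qed.

Let cod_open : open prod_chart_cod.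
Proof.
apply: (@openI _ (lsubmx @^-1` chart_cod c) (rsubmx @^-1` chart_cod d)).
- by move/continuousP: (@continuous_lsubmx R 1 m n); apply; exact: chart_cod_open.
- by move/continuousP: (@continuous_rsubmx R 1 m n); apply; exact: chart_cod_open.
Qed.

Let funS p : prod_chart_dom p -> prod_chart_cod (prod_chart_fun p).
Proof.
move=> [cp dp]; rewrite /prod_chart_cod/= row_mxKl row_mxKr.
by split; apply: chart_funS.
Qed.

Let invS y : prod_chart_cod y -> prod_chart_dom (prod_chart_inv y).
Proof. by move=> [cy dy]; split; apply: chart_invS. Qed.

Let funK p : prod_chart_dom p -> prod_chart_inv (prod_chart_fun p) = p.
Proof.
move: p => [x y] [cx dy]; rewrite /prod_chart_inv row_mxKl row_mxKr/=.
by rewrite !chart_funK.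
Qed.

Let invK y : prod_chart_cod y -> prod_chart_fun (prod_chart_inv y) = y.
Proof.
by move=> [cy dy]; rewrite /prod_chart_fun/= !chart_invK// hsubmxK.
Qed.

Let fun_cont p : prod_chart_dom p -> {for p, continuous prod_chart_fun}.
Proof.
move=> [cp dp] A /= [B Bn BA].
pose P1 : set X := [set x | forall i j, B i (lshift n j) (c x i j)].
pose P2 : set Y := [set y | forall i j, B i (rshift m j) (d y i j)].
have P1p : nbhs p.1 P1.
  have /(_ [set z | forall i j, B i (lshift n j) (z i j)]) := chart_fun_cont cp.
  apply; exists (fun i j => B i (lshift n j)) => // i j.
  by have := Bn i (lshift n j); rewrite row_mxEl.
have P2p : nbhs p.2 P2.
  have /(_ [set z | forall i j, B i (rshift m j) (z i j)]) := chart_fun_cont dp.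
  apply; exists (fun i j => B i (rshift m j)) => // i j.
  by have := Bn i (rshift m j); rewrite row_mxEr.
exists (P1, P2) => // q [/= q1 q2]; apply: BA => /= i j.
rewrite /prod_chart_fun.
by case: (split_ordP j) => l ->; rewrite ?row_mxEl ?row_mxEr.
Qed.

Let inv_cont y : prod_chart_cod y -> {for y, continuous prod_chart_inv}.
Proof.
move=> [cy dy].
have lc : chart_inv c (lsubmx z) @[z --> y] --> chart_inv c (lsubmx y).
  exact: (cvg_comp lsubmx _ (@continuous_lsubmx R 1 m n y) (chart_inv_cont cy)).
have rc : chart_inv d (rsubmx z) @[z --> y] --> chart_inv d (rsubmx y).
  exact: (cvg_comp rsubmx _ (@continuous_rsubmx R 1 m n y) (chart_inv_cont dy)).
exact: (cvg_pair lc rc).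
Qed.

Definition prod_chart : chart R (m + n) (X * Y)%type :=
  Chart dom_open cod_open funS invS funK invK fun_cont inv_cont.

End ProductCharts.

HB.instance Definition _ (R : realType) m n
    (X : chartedType R m) (Y : chartedType R n) :=
  hasAtlas.Build R (m + n)%N (X * Y)%type
    [set prod_chart c d | c in atlas & d in atlas].

Section SmoothMaps.
Context (R : realType) (m n : nat).

Definition smooth (X : chartedType R m) (Y : chartedType R n) (f : X -> Y) :=
  continuous f /\
  forall (c : chart R m X) (d : chart R n Y), atlas c -> atlas d ->
    Cinfty_on (local_rep_dom c d f) (local_rep c d f).

(* Membership in the maximal atlas. *)
Definition smooth_chart (X : chartedType R m) (c : chart R m X) :=
  forall d : chart R m X, atlas d ->
    smooth_transition c d /\ smooth_transition d c.

End SmoothMaps.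

Definition diffeomorphism (R : realType) n (M : chartedType R n) (f : M -> M) :=
  smooth f /\ exists g : M -> M, [/\ smooth g, cancel f g & cancel g f].

Section SmoothMapSpace.
Context (R : realType) (m n : nat) (X : chartedType R m) (Y : chartedType R n).

Record smoothMap := SmoothMap {
  smoothMap_fun :> X -> Y;
  smoothMapP : smooth smoothMap_fun
}.

HB.instance Definition _ := gen_eqMixin smoothMap.
HB.instance Definition _ := gen_choiceMixin smoothMap.

(* The maps g with g(K) in dom d whose local representative is e-close to that
   of f on c(K), together with all its partial derivatives of order <= r. *)
Definition Cr_neighborhood (f : smoothMap) (c : chart R m X) (d : chart R n Y)
    (K : set X) (r : nat) (e : R) : set smoothMap :=
  [set g : smoothMap | g @` K `<=` chart_dom d /\
    forall s : seq 'I_m, (size s <= r)%N -> forall x, K x ->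
      `| iter_partial s (local_rep c d f) (c x) -
         iter_partial s (local_rep c d g) (c x) | < e].

Definition Cinfty_subbase : set (set smoothMap) :=
  [set B | exists (f : smoothMap) (c : chart R m X) (d : chart R n Y)
      (K : set X) (r : nat) (e : R),
    [/\ [/\ smooth_chart c, compact K & K `<=` chart_dom c],
        smooth_chart d /\ f @` K `<=` chart_dom d,
        0 < e & B = Cr_neighborhood f c d K r e]].

(* The C^oo compact-open (weak Whitney) topology. *)
HB.instance Definition _ :=
  isSubBaseTopological.Build smoothMap Cinfty_subbase idfun.

End SmoothMapSpace.

Section Groups.
Local Open Scope group_scope.
Variable G : groupType.

Definition is_subgroup (H : set G) :=
  [/\ H 1, forall x y, H x -> H y -> H (x * y) & forall x, H x -> H x^-1].

Fixpoint derived_series (k : nat) : set G :=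
  if k is k'.+1 then
    smallest is_subgroup
      [set [~ x, y] | x in derived_series k' & y in derived_series k']
  else setT.

Definition solvable_group := exists k, derived_series k = [set 1].

End Groups.

HB.mixin Record isLieGroup (R : realType) (n : nat) G
    of SmoothManifold R n G & Group G := {
  smooth_mulg : smooth (fun p : G * G => (p.1 * p.2)%g);
  smooth_invg : smooth (fun x : G => x^-1%g)
}.

#[short(type="lieGroupType")]
HB.structure Definition LieGroup (R : realType) (n : nat) :=
  {G of isLieGroup R n G & SmoothManifold R n G & Group G}.

Definition lie_automorphism (R : realType) n (G : lieGroupType R n)
    (Phi : G -> G) :=
  diffeomorphism Phi /\ {morph Phi : x y / (x * y)%g}.

Section Topology.
Variable R : realType.

Definition path_connected (T : topologicalType) :=
  forall x y : T, exists p : R -> T,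
    [/\ {within `[0, 1], continuous p}, p 0 = x & p 1 = y].

(* Every loop is homotopic to a constant loop, relative to its base point. *)
Definition simply_connected (T : topologicalType) :=
  path_connected T /\
  forall p : R -> T, {within `[0, 1], continuous p} -> p 0 = p 1 ->
    exists H : R * R -> T,
      [/\ {within `[0, 1] `*` `[0, 1], continuous H},
          forall t, t \in `[0, 1] -> H (0, t) = p t,
          forall t, t \in `[0, 1] -> H (1, t) = p 0 &
          forall s, s \in `[0, 1] -> H (s, 0) = p 0 /\ H (s, 1) = p 0].

Definition contractible (T : topologicalType) :=
  exists (x0 : T) (H : R * T -> T),
    [/\ {within `[0, 1] `*` setT, continuous H},
        forall x, H (0, x) = x & forall x, H (1, x) = x0].

End Topology.

Section Actions.
Context (R : realType) (k n : nat).
Context (S : lieGroupType R k) (M : smoothManifoldType R n).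
Implicit Types (rho : smoothMap (M * S)%type M) (F : set (set M)).

Definition right_action rho :=
  (forall x, rho (x, 1%g) = x) /\
  (forall x s t, rho (rho (x, s), t) = rho (x, (s * t)%g)).

Definition isotropy rho (x : M) : set S := [set s | rho (x, s) = x].

Definition action_orbit rho (x : M) : set M := [set rho (x, s) | s in setT].

Definition locally_free rho :=
  forall x, isotropy rho x `<=` isolated (isotropy rho x).

(* A foliation is represented by its set of leaves. *)
Definition orbit_foliation rho : set (set M) := [set action_orbit rho x | x in setT].

(* The set A(F, S) of the smooth locally free actions with orbit foliation F. *)
Definition foliation_actions F : set (smoothMap (M * S)%type M) :=
  [set rho | [/\ right_action rho, locally_free rho & orbit_foliation rho = F]].

Definition leaf_preserving F (f : M -> M) :=
  forall L, F L -> f @` L `<=` L.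

Definition leafwise_homotopic_to_id F (f : M -> M) :=
  exists H : R * M -> M,
    [/\ {within `[0, 1] `*` setT, continuous H},
        forall x, H (0, x) = x, forall x, H (1, x) = f x &
        forall t, t \in `[0, 1] ->
          smooth (fun x => H (t, x)) /\ leaf_preserving F (fun x => H (t, x))].

Definition parameter_equivalent rho rho0 :=
  exists (Phi : S -> S) (f : M -> M),
    [/\ lie_automorphism Phi, diffeomorphism f,
        forall x s, f (rho0 (x, s)) = rho (f x, Phi s),
        leaf_preserving (orbit_foliation rho0) f &
        leafwise_homotopic_to_id (orbit_foliation rho0) f].

Definition parameter_rigid rho0 :=
  forall rho, foliation_actions (orbit_foliation rho0) rho ->
    parameter_equivalent rho rho0.

Definition locally_parameter_rigid rho0 :=
  \forall rho \near within (foliation_actions (orbit_foliation rho0))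
                           (nbhs rho0),
    parameter_equivalent rho rho0.

End Actions.

(* Main.v *)
Require Import Defs.
From HB Require Import structures.
From mathcomp Require Import all_boot all_order all_algebra generic_quotient.
From mathcomp Require Import all_classical all_reals all_analysis.
From mathcomp Require Import ring lra.

(** An action with a single orbit is a lattice in the group, so rigidity of lattices decides the matter.
    Let [S] be the universal cover of the orientation-preserving isometry group of the plane, that is
    [C x R] with [(z, t) (w, r) = (z + E(t) w, t + r)] and [E(t) = exp (i pi t / 2)]. The points with
    integer coordinates form a lattice [Gamma], and [M = Gamma \ S] is a flat 3-manifold. For [m = 1]
    and [m = 5] the formula [(z, t) . (w, r) = (z + E(m t) w, t + r / m)] defines a transitive right
    action of [S] on [M], because [E(5 n) = E(n)] for integers [n].

    The two actions are not parameter equivalent. The central element [(0, 4)] acts trivially for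
    [m = 1]; an automorphism of [S] preserves the center [4 Z], so it would send [(0, 4)] to
    [(0, 4)] or [(0, -4)], neither of which fixes a point for [m = 5].

    Let an action be close to the one with [m = 1]. By C^1-closeness its orbit map is a local
    diffeomorphism at the base point with a uniform injectivity radius, so there are elements [a], [b]
    of its isotropy group near [(1, 0)] and [(0, 1)]. The relation [b^2 a b^-2 a = 1] holds up to a
    small isotropy element, hence exactly. It forces [a = (v, 0)] and [b = (w, 1)]: the angle of [b]
    cannot move. Hence [a] and [b] are the images of the generators of [Gamma] under an automorphism
    close to the identity, and this automorphism conjugates the two actions by a diffeomorphism
    close to the identity. *)

Set Implicit Arguments.
Unset Strict Implicit.
Unset Printing Implicit Defensive.

Import Order.TTheory GRing.Theory Num.Theory.
Import numFieldNormedType.Exports.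

Local Open Scope classical_set_scope.
Local Open Scope ring_scope.

(** * Functions of class C^k *)

Section Ck.
Context {R : realType} {m : nat}.
Implicit Types (U : set 'rV[R]_m) (k : nat).

(** The sup norm on R^3 shapes the estimates: [E(n)] is a power of [i] for an integer [n], so left
    translation by a lattice element permutes the planar coordinates up to sign and is an isometry.
    Transitivity of a nearby action does not come from closeness: the action has the same orbit
    foliation, whose only leaf is [M]. Closeness serves to control the isotropy group at the base
    point. The angle of [relator a b] is twice that of [a], which must vanish; the planar part is
    then [(E(2T) + 1) v], with [T] the angle of [b], and since [v] is near 1, [E(2T) = -1] pins [T]
    to 1. Isotropy elements other than the images of [Gamma] must also be excluded: modulo the
    lattice such an element comes from the unit cube, close to a lattice point, and the quotient of
    the two gives a small isotropy element, hence a trivial one. The inverse of the conjugacy is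
    controlled only near the base point; equivariance carries its smoothness elsewhere. The homotopy
    to the identity slides along segments in the cover, which descend because left translations by
    the lattice are affine. *)

Definition pd (W : normedModType R) (i : 'I_m) (f : 'rV[R]_m -> W) :
    'rV[R]_m -> W := fun x => 'D_(delta_mx 0 i) f x.

(** Whereas [iter_partial] adds derivatives on the outside, this recursion strips the innermost one,
    so a product or chain rule for [pd i f] feeds directly into an induction on [k]. A general
    normed target lets coordinates be treated as scalar functions. *)
Fixpoint Ck (W : normedModType R) k U (f : 'rV[R]_m -> W) : Prop :=
  (forall x, U x -> {for x, continuous f}) /\
  if k is k'.+1 then
    (forall x, U x -> forall i, derivable f x (delta_mx 0 i)) /\
    (forall i, Ck k' U (pd i f))
  else True.

Lemma Ck_cont (W : normedModType R) k U (f : 'rV[R]_m -> W) x :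
  Ck k U f -> U x -> {for x, continuous f}.
Proof. by case: k => [|k] [h _]; exact: h. Qed.

Lemma CkW (W : normedModType R) k U (f : 'rV[R]_m -> W) :
  Ck k.+1 U f -> Ck k U f.
Proof.
elim: k f => [|k IH] f [fc [fd fp]]; split => //.
by split=> // i; apply: IH; exact: fp.
Qed.

Lemma Ck_eq (W : normedModType R) k U (f g : 'rV[R]_m -> W) :
  open U -> {in U, f =1 g} -> Ck k U f -> Ck k U g.
Proof.
move=> oU.
have near_fg (f1 g1 : 'rV[R]_m -> W) x : {in U, f1 =1 g1} -> U x ->
    \near x, f1 x = g1 x.
  by move=> fg Ux; near=> y; apply: fg; rewrite inE; near: y; exact: open_nbhs_nbhs.
have cont_fg (f1 g1 : 'rV[R]_m -> W) x : {in U, f1 =1 g1} -> U x ->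
    {for x, continuous f1} -> {for x, continuous g1}.
  move=> fg Ux fc; have fgx := near_fg _ _ _ fg Ux.
  rewrite /prop_for /continuous_at -(nbhs_singleton fgx).
  by apply: cvg_trans fc; exact: (near_eq_cvg fgx).
elim: k f g => [|k IH] f g fg [fc fd].
  by split=> // x Ux; apply: (cont_fg f) => //; exact: fc.
case: fd => fd fp; split.
  by move=> x Ux; apply: (cont_fg f) => //; exact: fc.
split=> [x Ux i|i].
  by apply: near_eq_derivable (near_fg _ _ _ fg Ux) (fd x Ux i).
apply: IH (fp i) => x; rewrite inE => Ux.
exact: near_eq_derive (near_fg _ _ _ fg Ux).
Unshelve. all: by end_near. Qed.

Lemma CkS (W : normedModType R) k U (f : 'rV[R]_m -> W) :
  Ck k.+1 U f <-> [/\ forall x, U x -> {for x, continuous f},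
   forall x, U x -> forall i, derivable f x (delta_mx 0 i) &
   forall i, Ck k U (pd i f)].
Proof. by split=> [[? []]|[]]. Qed.

End Ck.

Section CkCinfty.
Context {R : realType} {m n : nat}.
Implicit Types (U : set 'rV[R]_m) (k : nat) (f : 'rV[R]_m -> 'rV[R]_n).

Lemma iter_partial_rcons (s : seq 'I_m) i f :
  iter_partial (rcons s i) f = iter_partial s (pd i f).
Proof. by elim: s => //= j s ->. Qed.

Lemma Cinfty_onP U f : Cinfty_on U f <-> forall k, Ck k U f.
Proof.
split=> [h k|h s].
  elim: k f h => [|k IH] f h; first by split=> // x /(h [::])[].
  split; first by move=> x /(h [::])[].
  split=> [x|i]; first by move=> /(h [::])[].
  by apply: IH => s; rewrite -iter_partial_rcons; exact: h.
(* [rcons] exposes the derivative that is applied first, the one that [Ck] strips. *)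
elim/last_ind: s f h => [|s i IH] f h x Ux /=.
  have [fc [fd _]] := h 1%N.
  by split; [exact: fc|exact: fd].
rewrite iter_partial_rcons; apply: IH => // k.
by have [_ [_ /(_ i)]] := h k.+1.
Qed.

Lemma rV_continuous_coord (T : topologicalType) (g : T -> 'rV[R]_n) x :
  {for x, continuous g} <-> forall j, {for x, continuous (fun y => g y 0 j)}.
Proof.
split=> [gc j|gc].
  exact: (cvg_comp _ _ gc (@coord_continuous _ _ _ 0 j (g x))).
move=> A /= [B Bn BA]; apply: (filterS (P := fun y => forall i j, B i j (g y i j))).
  by move=> y By; exact: BA.
apply: filter_forall => i; apply: filter_forall => j.
by have := gc j (B i j); rewrite ord1; apply; rewrite -(ord1 i); exact: Bn.
Qed.

Lemma Ck_coord k U f : open U ->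
  Ck k U f <-> forall j, Ck k U (fun x => f x 0 j).
Proof.
move=> oU; have pdE i j g x : derivable g x (delta_mx 0 i) ->
    (pd i g x : 'rV[R]_n) 0 j = pd i (fun y => g y 0 j) x.
  by move=> d; rewrite /pd derive_mx// mxE.
elim: k f => [|k IH] f.
  split=> [[h _] j|h]; first by split=> // x /h /rV_continuous_coord; exact.
  by split=> // x Ux; apply/rV_continuous_coord => j; have [+ _] := h j; exact.
split.
  case/CkS => fc fd fp j; apply/CkS; split.
  - by move=> x Ux; have := fc x Ux => /rV_continuous_coord; exact.
  - by move=> x Ux i; have := fd x Ux i => /derivable_mxP; exact.
  - move=> i; have /IH/(_ j) := fp i; apply: Ck_eq => // x; rewrite inE => Ux.
    by apply: pdE; exact: fd.
move=> h; have fd x i : U x -> derivable f x (delta_mx 0 i).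
  move=> Ux; apply/derivable_mxP => i' j; rewrite ord1.
  by have [_ [+ _]] := h j; apply.
apply/CkS; split.
- by move=> x Ux; apply/rV_continuous_coord => j; have [+ _] := h j; exact.
- by move=> x Ux i; exact: fd.
- move=> i; apply/IH => j; have [_ [_ /(_ i)]] := h j.
  by apply: Ck_eq => // x; rewrite inE => Ux; rewrite pdE//; exact: fd.
Qed.

End CkCinfty.

Section CkScalar.
Context {R : realType} {m : nat}.
Implicit Types (U : set 'rV[R]_m) (k : nat) (f g : 'rV[R]_m -> R).

Lemma Ck_cst (W : normedModType R) k U (c : W) : Ck k U (fun=> c).
Proof.
elim: k c => [|k IH] c; first by split=> // x _; exact: cst_continuous.
split; first by move=> x _; exact: cst_continuous.
split=> [x _ i|i]; first exact: derivable_cst.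
rewrite (_ : pd i _ = fun=> 0); first exact: IH.
by apply/funext => x; rewrite /pd derive_cst.
Qed.

Lemma CkD k U f g : open U -> Ck k U f -> Ck k U g ->
  Ck k U (fun x => f x + g x).
Proof.
move=> oU; elim: k f g => [|k IH] f g [fc fp] [gc gp].
  by split=> // x Ux; exact: (cvgD (fc _ Ux) (gc _ Ux)).
split; first by move=> x Ux; exact: (cvgD (fc _ Ux) (gc _ Ux)).
case: fp => fd fp; case: gp => gd gp; split=> [x Ux i|i].
  exact: (derivableD (fd x Ux i) (gd x Ux i)).
apply: (Ck_eq oU _ (IH _ _ (fp i) (gp i))) => x; rewrite inE => Ux.
by rewrite /pd -deriveD//; [exact: fd|exact: gd].
Qed.

Lemma CkM k U f g : open U -> Ck k U f -> Ck k U g ->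
  Ck k U (fun x => f x * g x).
Proof.
move=> oU; elim: k f g => [|k IH] f g fk gk.
  by split=> // x Ux; exact: (continuousM (Ck_cont fk Ux) (Ck_cont gk Ux)).
have /CkS[fc fd fp] := fk; have /CkS[gc gd gp] := gk.
apply/CkS; split=> [x Ux|x Ux i|i].
- exact: (continuousM (fc _ Ux) (gc _ Ux)).
- exact: (derivableM (fd x Ux i) (gd x Ux i)).
have h := CkD oU (IH _ _ (CkW fk) (gp i)) (IH _ _ (CkW gk) (fp i)).
apply: (Ck_eq oU _ h) => x; rewrite inE => Ux.
by rewrite /pd -[RHS]/('D_(delta_mx 0 i) (f * g) x) deriveM//; [exact: fd|exact: gd].
Qed.

Lemma Ck_sum k U (I : Type) (r : seq I) (F : I -> 'rV[R]_m -> R) : open U ->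
  (forall i, Ck k U (F i)) -> Ck k U (fun x => \sum_(i <- r) F i x).
Proof.
move=> oU FC; elim: r => [|i r IH].
  by apply: (Ck_eq oU _ (Ck_cst k U (0:R))) => x _; rewrite big_nil.
by apply: (Ck_eq oU _ (CkD oU (FC i) IH)) => x _; rewrite big_cons.
Qed.

Lemma Ck_prod k U (I : Type) (r : seq I) (F : I -> 'rV[R]_m -> R) : open U ->
  (forall i, Ck k U (F i)) -> Ck k U (fun x => \prod_(i <- r) F i x).
Proof.
move=> oU FC; elim: r => [|i r IH].
  by apply: (Ck_eq oU _ (Ck_cst k U (1:R))) => x _; rewrite big_nil.
by apply: (Ck_eq oU _ (CkM oU (FC i) IH)) => x _; rewrite big_cons.
Qed.

Lemma CkN k U f : open U -> Ck k U f -> Ck k U (fun x => - f x).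
Proof.
move=> oU fk; apply: (Ck_eq oU _ (CkM oU (Ck_cst k U (-1 : R)) fk)) => x _.
by rewrite mulN1r.
Qed.

Lemma CkB k U f g : open U -> Ck k U f -> Ck k U g ->
  Ck k U (fun x => f x - g x).
Proof. by move=> oU fk gk; apply: CkD => //; exact: CkN. Qed.

Lemma Ck_proj k U (j : 'I_m) : Ck k U (fun x => x 0 j).
Proof.
have dE x i : is_derive x (delta_mx 0 i) (fun x : 'rV[R]_m => x 0 j) ((i == j)%:R).
  have dc : differentiable (fun x : 'rV[R]_m => x 0 j) x by exact: differentiable_coord.
  apply: DeriveDef; first exact: diff_derivable.
  have /(@derive_mx R) : derivable (@idfun 'rV[R]_m) x (delta_mx 0 i) by exact: derivable_id.
  by rewrite derive_id => /matrixP/(_ 0 j); rewrite !mxE eqxx/= eq_sym.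
have cc x : {for x, continuous (fun x : 'rV[R]_m => x 0 j)} by exact: coord_continuous.
case: k => [|k]; first by split.
split=> //; split=> [x Ux i|i]; first by have [] := dE x i.
rewrite (_ : pd i _ = fun=> ((i == j)%:R : R)); first exact: Ck_cst.
by apply/funext => x; rewrite /pd; exact: derive_val.
Qed.

Lemma CkV k U f : open U -> (forall x, U x -> f x != 0) -> Ck k U f ->
  Ck k U (fun x => (f x)^-1).
Proof.
move=> oU f0; elim: k => [|k IH] fk.
  by split=> // x Ux; apply: continuousV; [exact: f0|exact: (Ck_cont fk)].
have /CkS[fc fd fp] := fk; have {}IH := IH (CkW fk).
apply/CkS; split=> [x Ux|x Ux i|i].
- by apply: continuousV; [exact: f0|exact: fc].
- by apply: derivableV; [exact: f0|exact: fd].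
apply: (Ck_eq oU _ (CkN oU (CkM oU (CkM oU IH IH) (fp i)))) => x; rewrite inE => Ux.
rewrite /pd deriveV//; [|exact: f0|exact: fd].
by rewrite /GRing.scale/= mulNr -exprVn expr2.
Qed.

Lemma derive_lineE (V W : normedModType R) (f : V -> W) x v :
  'D_v f x = 'D_1 (fun h : R => f (h *: v + x)) (0 : R).
Proof.
have E : (fun h : R => h^-1 *: ((f \o shift x) (h *: v) - f x)) =
    (fun h : R => h^-1 *: (((fun h : R => f (h *: v + x)) \o shift 0)
      (h *: (1 : R)) - f ((0 : R) *: v + x))).
  by apply/funext => h /=; rewrite !scale0r !addr0 add0r /GRing.scale/= mulr1.
by rewrite /derive E.
Qed.

Lemma is_derive_comp1 (phi dphi : R -> R) f x v : 
  (forall y : R, is_derive y (1 : R) phi (dphi y)) -> derivable f x v ->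
  is_derive x v (phi \o f) (dphi (f x) * 'D_v f x).
Proof.
move=> phiD fd.
have /derivable1P fd' := fd.
have E := derive_lineE f x v.
have P : is_derive (0 : R) 1 (phi \o (fun h : R => f (h *: v + x))) (dphi (f x) * 'D_v f x).
  have := @is_derive1_comp R phi (fun h : R => f (h *: v + x)) 0 (dphi (f x)) ('D_v f x).
  have -> : f (0 *: v + x) = f x by rewrite scale0r add0r.
  move=> /(_ (phiD (f x))); apply.
  by apply: DeriveDef => //; rewrite E.
apply: DeriveDef; first by have [P1 _] := P; apply/derivable1P.
by have [_ <-] := P; exact: derive_lineE.
Qed.

(** Both claims share one induction, since differentiating either function brings in the other. *)
Lemma Ck_sin_cos k U f : open U -> Ck k U f ->
  Ck k U (fun x => sin (f x)) /\ Ck k U (fun x => cos (f x)).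
Proof.
move=> oU; elim: k => [|k IH] fk.
  have [fc _] := fk; split; split=> // x Ux; apply: continuous_comp; try exact: fc.
    exact: continuous_sin.
  exact: continuous_cos.
have /CkS[fc fd fp] := fk; have {IH}[sk ck] := IH (CkW fk).
have ds x i (Ux : U x) := is_derive_comp1 (@is_derive_sin R) (fd x Ux i).
have dc x i (Ux : U x) := is_derive_comp1 (@is_derive_cos R) (fd x Ux i).
split; apply/CkS; split=> [x Ux|x Ux i|i].
- by apply: continuous_comp; [exact: fc|exact: continuous_sin].
- by have [] := ds x i Ux.
- apply: (Ck_eq oU _ (CkM oU ck (fp i))) => x; rewrite inE => Ux.
  by have [_ <-] := ds x i Ux.
- by apply: continuous_comp; [exact: fc|exact: continuous_cos].
- by have [] := dc x i Ux.
- apply: (Ck_eq oU _ (CkM oU (CkN oU sk) (fp i))) => x; rewrite inE => Ux.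
  by have [_ <-] := dc x i Ux.
Qed.

End CkScalar.

Section RowNorm.
Context {R : realType} {n : nat}.
Implicit Types (x : 'rV[R]_n).

Lemma rV_norm_coord x j : `|x 0 j| <= `|x|.
Proof.
rewrite {2}/Num.Def.normr/= mx_normrE.
exact: (le_bigmax _ (fun ij : 'I_1 * 'I_n => `|x ij.1 ij.2|) (0, j)).
Qed.

Lemma rV_norm_le x (c : R) : 0 <= c -> (forall j, `|x 0 j| <= c) -> `|x| <= c.
Proof.
move=> c0 h; rewrite /Num.Def.normr/= mx_normrE.
by apply: bigmax_le => // -[i j] _ /=; rewrite ord1.
Qed.

Lemma rV_norm_lt x (c : R) : 0 < c -> (forall j, `|x 0 j| < c) -> `|x| < c.
Proof.
move=> c0 h; rewrite /Num.Def.normr/= mx_normrE.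
by apply: bigmax_lt => // -[i j] _ /=; rewrite ord1.
Qed.

Lemma sum_coord_le x (c : 'I_n -> R) (C : R) : (forall j, `|c j| <= C) ->
  `|\sum_j x 0 j * c j| <= n%:R * C * `|x|.
Proof.
move=> h; apply: le_trans (ler_norm_sum _ _ _) _.
have -> : n%:R * C * `|x| = \sum_(j < n) C * `|x|.
  by rewrite sumr_const card_ord -[RHS]mulr_natl mulrA.
apply: ler_sum => j _; rewrite normrM mulrC.
by apply: ler_pM => //; exact: rV_norm_coord.
Qed.

End RowNorm.

Section linform.
Context {R : realType} {m : nat}.
Variable c : 'I_m -> R.
Definition linform (v : 'rV[R]_m) : R := \sum_j v 0 j * c j.
Fact linform_is_linear : linear_for *%R linform.
Proof.
move=> a u v; rewrite /linform mulr_sumr -big_split/=; apply: eq_bigr => j _.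
by rewrite !mxE mulrDl mulrA.
Qed.
HB.instance Definition _ := GRing.isLinear.Build R 'rV[R]_m R *%R linform linform_is_linear.
End linform.

(** * Differentiability from continuous partial derivatives; the mean value theorem *)

Section C1.
Context {R : realType} {m : nat}.
Implicit Types (U : set 'rV[R]_m) (f : 'rV[R]_m -> R).

Lemma is_derive_line (W : normedModType R) (f : 'rV[R]_m -> W) x v (t : R) :
  derivable f (x + t *: v) v ->
  is_derive t (1 : R) (fun s : R => f (x + s *: v)) ('D_v f (x + t *: v)).
Proof.
have E : (fun h : R => h^-1 *: ((f \o shift (x + t *: v)) (h *: v) - f (x + t *: v))) =
    (fun h : R => h^-1 *: (((fun s : R => f (x + s *: v)) \o shift t)
      (h *: (1 : R)) - f (x + t *: v))).
  apply/funext => h /=.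
  have -> : h%:A + t = h + t by rewrite /GRing.scale/= mulr1.
  by rewrite scalerDl addrCA.
by move=> fd; apply: DeriveDef; rewrite /derivable /derive -E.
Qed.

(** The increment is cut into edges parallel to the axes. The one-variable mean value theorem on
    each edge gives a slope at an intermediate point, which continuity of the partial derivatives
    compares with the slope at [x]. *)
Lemma differentiable_cont_pd U f x : open U ->
  (forall y, U y -> forall i, derivable f y (delta_mx 0 i)) ->
  (forall i, {for x, continuous (pd i f)}) -> U x ->
  differentiable f x.
Proof.
move=> oU fd fc Ux.
pose df := linform (fun j => pd j f x).
have dfc : continuous df.
  have [h _] : Ck 0 setT (fun v : 'rV[R]_m => \sum_j v 0 j * pd j f x).
    by apply: Ck_sum; [exact: openT|move=> j; apply: CkM; [exact: openT|exact: Ck_proj|exact: Ck_cst]].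
  by move=> v; exact: h.
have E : f \o shift x = cst (f x) + df +o_ (0 : 'rV[R]_m) id.
  apply/eqaddoP => e e0.
  (* There are [m] edges, each with error at most [e' |h|]; dividing by [m + 1] also covers
     [m = 0]. *)
  pose e' : R := e / m.+1%:R.
  have e'0 : 0 < e' by rewrite divr_gt0.
  have [d d0 hd] : exists2 d : R, 0 < d & forall y, `|y - x| < d ->
      U y /\ forall j, `|pd j f y - pd j f x| <= e'.
    have : \forall y \near x, U y /\ forall j, `|pd j f y - pd j f x| <= e'.
      near=> y; split; first by near: y; exact: open_nbhs_nbhs.
      near: y; apply: filter_forall => j.
      by have /cvgr_distC_le := fc j; apply.
    case/nbhs_normP => d /= d0 hd; exists d => // y yx; apply: hd.
    by rewrite /= distrC.
  have hn : \forall h \near (0 : 'rV[R]_m), `|h| < d.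
    by apply/nbhs_normP; exists d => // h /=; rewrite sub0r normrN.
  near=> h.
  have hlt : `|h| < d by near: h; exact: hn.
  (* The vertices of the path: [P k] keeps the first [k] coordinates of [h]. *)
  pose P (k : nat) : 'rV[R]_m := \row_i (if (i < k)%N then h 0 i else 0).
  have PS (k : 'I_m) : P k.+1 = P k + h 0 k *: delta_mx 0 k.
    apply/rowP => i; rewrite !mxE eqxx/= ltnS leq_eqVlt.
    have [ik|ik] := eqVneq i k; first by rewrite ik eqxx ltnn add0r mulr1.
    by rewrite -val_eqE/= in ik; rewrite (negbTE ik)/= mulr0 addr0.
  have step (k : 'I_m) : `|f (x + P k.+1) - f (x + P k) - h 0 k * pd k f x| <= e' * `|h|.
    have inb (t : R) : `|t| <= `|h 0 k| -> `|(x + P k + t *: delta_mx 0 k) - x| < d.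
      move=> th; rewrite !(addrAC _ _ (- x)) subrr add0r; apply: rV_norm_lt => // i.
      apply: le_lt_trans hlt; rewrite !mxE eqxx/=.
      have [->|ik] := eqVneq i k.
        by rewrite ltnn add0r mulr1 (le_trans th)// rV_norm_coord.
      rewrite mulr0 addr0; case: ifP => _; first exact: rV_norm_coord.
      by rewrite normr0.
    pose phi := fun t : R => f (x + P k + t *: delta_mx 0 k).
    have phid (t : R) : `|t| <= `|h 0 k| -> is_derive t (1 : R) phi (pd k f (x + P k + t *: delta_mx 0 k)).
      by move=> /inb/hd[Uy _]; apply: is_derive_line; exact: fd.
    have [c ch Ec] : exists2 c : R, `|c| <= `|h 0 k| &
        phi (h 0 k) - phi 0 = pd k f (x + P k + c *: delta_mx 0 k) * h 0 k.
      have [h0|/ltW h0] := leP 0 (h 0 k).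
        have sub (t : R) : 0 <= t <= h 0 k -> `|t| <= `|h 0 k|.
          by move=> /andP[t0 th]; rewrite !ger0_norm.
        have [||c] := @MVT_segment R phi (fun t => pd k f (x + P k + t *: delta_mx 0 k)) _ _ h0.
        - by move=> t; rewrite in_itv/= => /andP[t0 th]; apply: phid; apply: sub; rewrite !ltW.
        - apply: derivable_within_continuous => t; rewrite in_itv/= => /sub t01.
          by have [] := phid t t01.
        - by rewrite in_itv/= subr0 => /sub ch Ec; exists c.
      have sub (t : R) : h 0 k <= t <= 0 -> `|t| <= `|h 0 k|.
        by move=> /andP[t0 th]; rewrite !ler0_norm// lerN2.
      have [||c] := @MVT_segment R phi (fun t => pd k f (x + P k + t *: delta_mx 0 k)) _ _ h0.
      - by move=> t; rewrite in_itv/= => /andP[t0 th]; apply: phid; apply: sub; rewrite !ltW.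
      - apply: derivable_within_continuous => t; rewrite in_itv/= => /sub t01.
        by have [] := phid t t01.
      - rewrite in_itv/= sub0r => /sub ch Ec; exists c => //.
        by rewrite -opprB Ec mulrN opprK.
    have -> : f (x + P k.+1) = phi (h 0 k) by rewrite /phi PS addrA.
    have -> : f (x + P k) = phi 0 by rewrite /phi scale0r addr0.
    rewrite Ec mulrC -mulrBr normrM mulrC; apply: ler_pM => //.
      by have [_] := hd _ (inb _ ch); apply.
    exact: rV_norm_coord.
  have -> : (f \o shift x - (cst (f x) + df)) h =
      \sum_(k < m) (f (x + P k.+1) - f (x + P k) - h 0 k * pd k f x).
    rewrite sumrB -(big_mkord xpredT (fun k => f (x + P k.+1) - f (x + P k))).
    rewrite (telescope_sumr (fun k => f (x + P k)))//.
    have -> : P m = h by apply/rowP => i; rewrite mxE ltn_ord.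
    have -> : P 0%N = 0 by apply/rowP => i; rewrite !mxE.
    by rewrite addr0 (addrC x h) -[LHS]/(f (h + x) - (f x + df h)) opprD addrA.
  apply: le_trans (ler_norm_sum _ _ _) _.
  apply: le_trans (ler_sum _ (fun k _ => step k)) _.
  rewrite sumr_const card_ord -mulr_natl mulrA; apply: ler_wpM2r => //.
  rewrite /e' mulrCA -[leRHS]mulr1 ler_pM2l// ler_pdivrMr// mul1r ler_nat.
  exact: leqnSn.
have dE := diff_unique dfc E.
apply/diff_locallyP; split; first by move=> v; rewrite dE; exact: dfc.
by rewrite dE.
Unshelve. all: by end_near. Qed.

Lemma Ck_differentiable k U f x : open U -> Ck k.+1 U f -> U x -> differentiable f x.
Proof.
move=> oU /CkS[_ fd fp] Ux; apply: (differentiable_cont_pd oU) => // i.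
exact: Ck_cont (fp i) Ux.
Qed.

Lemma diff_pdE f x v : differentiable f x ->
  'd f x v = \sum_j v 0 j * pd j f x.
Proof.
move=> fd; rewrite {1}(row_sum_delta v) linear_sum; apply: eq_bigr => j _.
by rewrite linearZ/= /pd deriveE.
Qed.

Lemma derive_pdE f x v : differentiable f x ->
  'D_v f x = \sum_j v 0 j * pd j f x.
Proof. by move=> fd; rewrite deriveE// diff_pdE. Qed.

Lemma mean_value_segment U f x y : open U -> Ck 1 U f ->
  (forall t : R, 0 <= t <= 1 -> U (x + t *: (y - x))) ->
  exists2 t : R, 0 <= t <= 1 &
    f y - f x = \sum_j (y - x) 0 j * pd j f (x + t *: (y - x)).
Proof.
move=> oU fC hU.
have fdif (t : R) : 0 <= t <= 1 -> differentiable f (x + t *: (y - x)).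
  by move=> /hU; exact: Ck_differentiable fC.
have fder (t : R) : 0 <= t <= 1 -> is_derive t (1 : R) (fun s : R => f (x + s *: (y - x)))
    ('D_(y - x) f (x + t *: (y - x))).
  by move=> /fdif d; apply: is_derive_line; exact: diff_derivable.
have [|||t t01 E] := @MVT_segment R (fun s : R => f (x + s *: (y - x)))
  (fun t => 'D_(y - x) f (x + t *: (y - x))) 0 1.
- exact: ler01.
- move=> t; rewrite in_itv/= => /andP[t0 t1]; apply: fder.
  by rewrite !ltW.
- apply: derivable_within_continuous => t; rewrite in_itv/= => t01.
  by have [] := fder t t01.
exists t; first by rewrite in_itv/= in t01.
have y1 : x + (1 : R) *: (y - x) = y by rewrite scale1r addrC subrK.
move: E; rewrite y1 scale0r addr0 subr0 mulr1 => ->.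
by rewrite derive_pdE//; apply: fdif; rewrite in_itv/= in t01.
Qed.

End C1.

(** * The chain rule *)

Section Composition.
Context {R : realType} {m n : nat}.

Lemma is_derive_comp (f : 'rV[R]_m -> 'rV[R]_n) (g : 'rV[R]_n -> R) x v :
  derivable f x v -> differentiable g (f x) ->
  is_derive x v (g \o f) (\sum_j ('D_v f x) 0 j * pd j g (f x)).
Proof.
move=> fd gd.
pose c := fun h : R => f (h *: v + x).
have c0 : c 0 = f x by rewrite /c scale0r add0r.
have /derivable1P fd1 := fd.
have cd : differentiable c (0 : R) by apply/derivable1_diffP.
have gd' : differentiable g (c 0) by rewrite c0.
have gcd : differentiable (g \o c) (0 : R) by exact: differentiable_comp.
have /derivable1_diffP gcd1 := gcd.
apply: DeriveDef; first by apply/derivable1P.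
have -> : 'D_v (g \o f) x = 'D_1 (g \o c) (0 : R) by exact: derive_lineE.
rewrite deriveE// diff_comp//=.
rewrite -(deriveE (1 : R) cd) diff_pdE// c0; apply: eq_bigr => j _.
by rewrite -derive_lineE.
Qed.

Lemma Ck_comp k U V (f : 'rV[R]_m -> 'rV[R]_n) (g : 'rV[R]_n -> R) :
  open U -> open V -> Ck k U f -> Ck k V g -> (forall x, U x -> V (f x)) ->
  Ck k U (fun x => g (f x)).
Proof.
move=> oU oV; elim: k g => [|k IH] g fk gk UV.
  split=> // x Ux; apply: continuous_comp; first exact: (Ck_cont fk).
  by apply: (Ck_cont gk); exact: UV.
have /CkS[fc fd fp] := fk; have /CkS[gc gd gp] := gk.
have gdif x : U x -> differentiable g (f x).
  by move=> /UV; exact: Ck_differentiable gk.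
apply/CkS; split=> [x Ux|x Ux i|i].
- by apply: continuous_comp; [exact: fc|apply: gc; exact: UV].
- by have [] := is_derive_comp (fd x Ux i) (gdif x Ux).
have h : Ck k U (fun x => \sum_j pd i f x 0 j * pd j g (f x)).
  apply: Ck_sum => // j; apply: CkM => //.
    by have /(Ck_coord _ _ oU)/(_ j) := fp i.
  by apply: IH => //; exact: CkW.
apply: (Ck_eq oU _ h) => x; rewrite inE => Ux.
by have [_ <-] := is_derive_comp (fd x Ux i) (gdif x Ux).
Qed.

End Composition.

Lemma Ck_comp_rV (R : realType) m n p k U V (f : 'rV[R]_m -> 'rV[R]_n)
    (g : 'rV[R]_n -> 'rV[R]_p) :
  open U -> open V -> Ck k U f -> Ck k V g -> (forall x, U x -> V (f x)) ->
  Ck k U (fun x => g (f x)).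
Proof.
move=> oU oV fk gk UV; apply/Ck_coord => // j.
apply: (Ck_comp (g := fun y => g y 0 j) oU oV fk) => //.
by have /(Ck_coord _ _ oV) := gk.
Qed.

Lemma Cinfty_comp (R : realType) m n p U V (f : 'rV[R]_m -> 'rV[R]_n)
    (g : 'rV[R]_n -> 'rV[R]_p) :
  open U -> open V -> Cinfty_on U f -> Cinfty_on V g -> (forall x, U x -> V (f x)) ->
  Cinfty_on U (fun x => g (f x)).
Proof.
move=> oU oV /Cinfty_onP fk /Cinfty_onP gk UV; apply/Cinfty_onP => k.
exact: (Ck_comp_rV oU oV (fk k) (gk k)).
Qed.

(** * Inverses of maps close to the identity *)

Section NormForms.
Context {R : realType}.

Lemma nbhs_distP (V : normedModType R) (x : V) (A : set V) :
  nbhs x A <-> exists2 d : R, 0 < d & forall y, `|y - x| < d -> A y.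
Proof.
split=> [/nbhs_normP[d d0 h]|[d d0 h]].
  by exists d => // y yx; apply: h; rewrite /= distrC.
by apply/nbhs_normP; exists d => // y /= yx; apply: h; rewrite distrC.
Qed.

Context {V W : normedModType R}.

Lemma continuous_distP (f : V -> W) (x : V) : {for x, continuous f} <->
  forall e : R, 0 < e -> exists2 d : R, 0 < d & forall y, `|y - x| < d -> `|f y - f x| < e.
Proof.
split=> [fc e e0|h].
  have /fc/nbhs_distP : nbhs (f x) (fun z => `|z - f x| < e) by apply/nbhs_distP; exists e.
  exact.
move=> A /nbhs_distP[e e0 hA]; have [d d0 hd] := h e e0.
by apply/nbhs_distP; exists d => // y /hd; exact: hA.
Qed.

Lemma differentiable_distP (f : V -> W) (x : V) (e : R) : differentiable f x -> 0 < e ->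
  exists2 d : R, 0 < d & forall h, `|h| < d -> `|f (x + h) - f x - 'd f x h| <= e * `|h|.
Proof.
move=> /diff_locallyP[_ /eqaddoP/(_ e)] h /h/nbhs_distP[d d0 hd].
exists d => // v vd; have := hd v; rewrite subr0 => /(_ vd).
rewrite -[X in `|X| <= _ -> _]/(f (v + x) - (f x + 'd f x v)).
by rewrite opprD addrA (addrC v x).
Qed.

Lemma dist_forall n (P : 'I_n -> V -> Prop) (x : V) :
  (forall l, exists2 d : R, 0 < d & forall y, `|y - x| < d -> P l y) ->
  exists2 d : R, 0 < d & forall y, `|y - x| < d -> forall l, P l y.
Proof.
move=> h; apply/(nbhs_distP x (fun y => forall l, P l y)).
by apply: filter_forall => l; apply/nbhs_distP.
Qed.

End NormForms.

Section CkMatrix.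
Context {R : realType} {m : nat}.

Lemma Ck_det n k (U : set 'rV[R]_m) (A : 'rV[R]_m -> 'M[R]_n) : open U ->
  (forall i j, Ck k U (fun x => A x i j)) -> Ck k U (fun x => \det (A x)).
Proof.
move=> oU hA; apply: Ck_sum => // s; apply: CkM => //; first exact: Ck_cst.
by apply: Ck_prod => // i; exact: hA.
Qed.

(** Cramer's rule: each entry is a cofactor divided by a determinant that does not vanish on [U]. *)
Lemma Ck_invmx n k (U : set 'rV[R]_m) (A : 'rV[R]_m -> 'M[R]_n) : open U ->
  (forall x, U x -> A x \in unitmx) ->
  (forall i j, Ck k U (fun x => A x i j)) ->
  forall i j, Ck k U (fun x => invmx (A x) i j).
Proof.
move=> oU uA hA i j.
have h : Ck k U (fun x => (\det (A x))^-1 *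
    ((-1) ^+ (j + i) * \det (row' j (col' i (A x))))).
  apply: CkM => //.
    apply: CkV => //; last exact: Ck_det.
    by move=> x /uA; rewrite unitmxE unitfE.
  apply: CkM => //; first exact: Ck_cst.
  apply: Ck_det => // k1 k2.
  by apply: (Ck_eq oU _ (hA (lift j k1) (lift i k2))) => x _; rewrite !mxE.
apply: (Ck_eq oU _ h) => x; rewrite inE => /uA ux.
by rewrite /invmx ux !mxE.
Qed.

End CkMatrix.

Section LocalInverse.
Context {R : realType} {n : nat}.
Variables (f : 'rV[R]_n -> 'rV[R]_n) (r : R).
Hypothesis r0 : 0 < r.
Hypothesis fC : Cinfty_on (ball (0 : 'rV[R]_n) r) f.
Hypothesis f_near_id : forall x, ball (0 : 'rV[R]_n) r x -> forall i,
  `|pd i f x - delta_mx 0 i| <= (2 * n.+1%:R)^-1.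

Let B := ball (0 : 'rV[R]_n) r.
Let oB : open B. Proof. exact: ball_open. Qed.
Let BE x : B x <-> `|x| < r.
Proof. by rewrite /B -ball_normE/= sub0r normrN. Qed.

Let fCk k : Ck k B f. Proof. by have /Cinfty_onP := fC; apply. Qed.

Let pd_coord i l x : B x -> pd i f x 0 l = pd i (fun y => f y 0 l) x.
Proof.
move=> Bx; have /CkS[_ fd _] := fCk 1.
by rewrite /pd derive_mx ?mxE//; exact: fd.
Qed.

(** [f - id] is 1/2-Lipschitz: each of its [n] partial derivatives is at most [1/(2(n+1))] on the
    convex ball, and the mean value theorem sums them. For [n = 3] the bound on the derivatives is
    the 1/8 that appears throughout the rigidity argument. *)
Lemma near_id_estimate x y : `|x| < r -> `|y| < r ->
  `|(f y - f x) - (y - x)| <= 2^-1 * `|y - x|.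
Proof.
move=> xr yr; apply: rV_norm_le => [|l]; first by rewrite mulr_ge0.
have seg (t : R) : 0 <= t <= 1 -> B (x + t *: (y - x)).
  move=> /andP[t0 t1]; apply/BE.
  have -> : x + t *: (y - x) = (1 - t) *: x + t *: y.
    by rewrite scalerBr scalerBl scale1r addrA addrAC.
  apply: le_lt_trans (ler_normD _ _) _; rewrite !normrZ.
  rewrite (ger0_norm t0) ger0_norm ?subr_ge0//.
  have [->|tn0] := eqVneq t 0; first by rewrite subr0 mul1r mul0r addr0.
  have {}t0 : 0 < t by rewrite lt0r tn0.
  apply: (@le_lt_trans _ _ ((1 - t) * r + t * `|y|)).
    by rewrite lerD2r ler_wpM2l ?subr_ge0// ltW.
  have : t * `|y| < t * r by rewrite ltr_pM2l.
  lra.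
have /(Ck_coord _ _ oB)/(_ l) fl := fCk 1.
have [t t01 E] := mean_value_segment oB fl seg.
have -> : (f y - f x - (y - x)) 0 l =
    \sum_j (y - x) 0 j * ((pd j f (x + t *: (y - x)) - delta_mx 0 j) 0 l).
  transitivity ((f y 0 l - f x 0 l) - (y - x) 0 l); first by rewrite !mxE.
  have -> : (y - x) 0 l = \sum_j (y - x) 0 j * (delta_mx 0 j : 'rV[R]_n) 0 l.
    by rewrite {1}(row_sum_delta (y - x)) summxE; apply: eq_bigr => j _; rewrite !mxE.
  rewrite E -sumrB; apply: eq_bigr => j _.
  rewrite -pd_coord; last exact: seg.
  by rewrite -mulrBr; congr (_ * _); rewrite !mxE.
apply: le_trans (sum_coord_le _ (C := (2 * n.+1%:R)^-1) _) _.
  move=> j; apply: le_trans (rV_norm_coord _ _) _.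
  by apply: f_near_id; exact: seg.
apply: ler_wpM2r => //; rewrite invfM mulrCA -[leRHS]mulr1 ler_pM2l ?invr_gt0//.
by rewrite ler_pdivrMr// mul1r ler_nat.
Qed.

Lemma near_id_expand x y : `|x| < r -> `|y| < r -> `|y - x| <= 2 * `|f y - f x|.
Proof.
move=> xr yr; have := near_id_estimate xr yr.
rewrite distrC => h; have := ler_distD 0 (y - x) (f y - f x).
have := lerB_normD (y - x) (- (f y - f x)) => //.
rewrite normrN => h1 _.
have := lerD2l `|y - x| (- `|f y - f x|) 0.
have h2 : `|y - x| - `|f y - f x| <= `|(y - x) - (f y - f x)| by exact: lerB_dist.
lra.
Qed.

Lemma near_id_inj x y : `|x| < r -> `|y| < r -> f x = f y -> x = y.
Proof.
move=> xr yr fxy; have := near_id_expand xr yr.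
rewrite fxy subrr normr0 mulr0 normr_le0 subr_eq0 => /eqP.
by move->.
Qed.

(** A minimum replaces the usual fixed-point iteration. The step [x - (f x - z)] maps the ball of
    radius [rho] into itself and at least halves the residual [|f x - z|], so a point of the compact
    ball with least residual has residual zero. *)
Lemma near_id_surj z : 2 * `|z - f 0| < r ->
  exists2 x, `|x| <= 2 * `|z - f 0| & f x = z.
Proof.
set rho := 2 * `|z - f 0| => rhor.
have rho0 : 0 <= rho by rewrite mulr_ge0.
pose A := [set x : 'rV[R]_n | `|x| <= rho].
have AB x : A x -> `|x| < r by move=> Ax; exact: le_lt_trans Ax rhor.
have cA : compact A.
  apply: bounded_closed_compact.
    by exists rho; split; [exact: num_real|move=> M rM x Ax; apply: le_trans Ax _; exact: ltW].
  by apply: (closed_comp (f := fun x : 'rV[R]_n => `|x|) (D := [set t | t <= rho])) => [x _|]; [exact: norm_continuous|exact: closed_le].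
have A0 : A !=set0 by exists 0; rewrite /A/= normr0.
have cf : {within A, continuous (fun x => `|f x - z|)}.
  apply: continuous_in_subspaceT => x; rewrite inE => /AB/BE Bx.
  apply/continuous_distP => e e0.
  have [/(_ x Bx)/continuous_distP/(_ e e0)[d d0 hd] _] := fCk 0.
  exists d => // y /hd; apply: le_lt_trans.
  by apply: le_trans (ler_dist_dist _ _) _; rewrite opprB addrA subrK.
have [x Ax xmin] := EVT_min_rV A0 cA cf.
rewrite inE in Ax.
have Ar := AB _ Ax.
have T0 : `|x - (f x - z)| <= rho.
  have z0r : `|0 : 'rV[R]_n| < r by rewrite normr0.
  have h := near_id_estimate z0r Ar.
  have -> : x - (f x - z) = (z - f 0) - ((f x - f 0) - (x - 0)).
    by apply/rowP => j; rewrite !mxE; ring.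
  apply: le_trans (ler_normB _ _) _; rewrite subr0 in h.
  rewrite subr0; move: h Ax; rewrite /A/= /rho; lra.
have := xmin (x - (f x - z)); rewrite inE => /(_ T0) h1.
have h2 := near_id_estimate Ar (AB _ T0).
have E : f (x - (f x - z)) - f x - (x - (f x - z) - x) = f (x - (f x - z)) - z.
  by apply/rowP => j; rewrite !mxE; ring.
have E2 : `|x - (f x - z) - x| = `|f x - z|.
  by rewrite addrAC subrr add0r normrN.
rewrite E E2 in h2.
have : `|f x - z| <= 0 by have := normr_ge0 (f x - z); lra.
by rewrite normr_le0 subr_eq0 => /eqP fxz; exists x.
Qed.

Let J x : 'M[R]_n := \matrix_(i, j) pd i f x 0 j.

(** A row vector killed by [J x] satisfies [|v| <= |v| / 2], because [J x] is close to the
    identity. *)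
Let J_unit x : `|x| < r -> J x \in unitmx.
Proof.
move=> xr; rewrite -row_free_unit; apply: inj_row_free => v vJ.
have : `|v| <= 2^-1 * `|v|.
  apply: rV_norm_le => [|l]; first by rewrite mulr_ge0.
  have -> : v 0 l = - \sum_j v 0 j * ((pd j f x - delta_mx 0 j) 0 l).
    have /rowP/(_ l) := vJ; rewrite mxE [RHS]mxE => vJl.
    have -> : \sum_j v 0 j * ((pd j f x - delta_mx 0 j) 0 l) =
        \sum_j v 0 j * J x j l - \sum_j v 0 j * (delta_mx 0 j : 'rV[R]_n) 0 l.
      by rewrite -sumrB; apply: eq_bigr => j _; rewrite !mxE; ring.
    rewrite vJl sub0r opprK {1}(row_sum_delta v) summxE.
    by apply: eq_bigr => j _; rewrite !mxE.
  rewrite normrN; apply: le_trans (sum_coord_le _ (C := (2 * n.+1%:R)^-1) _) _.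
    move=> j; apply: le_trans (rV_norm_coord _ _) _.
    by apply: f_near_id; apply/BE.
  apply: ler_wpM2r => //; rewrite invfM mulrCA -[leRHS]mulr1 ler_pM2l ?invr_gt0//.
  by rewrite ler_pdivrMr// mul1r ler_nat.
move=> h; have : `|v| <= 0 by have := normr_ge0 v; lra.
by rewrite normr_le0 => /eqP.
Qed.

Let J_diff x (e : R) : `|x| < r -> 0 < e ->
  exists2 d : R, 0 < d & forall h, `|h| < d -> `|f (x + h) - f x - h *m J x| <= e * `|h|.
Proof.
move=> xr e0.
have [|d d0 hd] := @dist_forall R 'rV[R]_n n (fun l h =>
    `|f (x + h) 0 l - f x 0 l - \sum_j h 0 j * pd j f x 0 l| <= e * `|h|) 0.
  move=> l; have Bx : B x by apply/BE.
  have /(Ck_coord _ _ oB)/(_ l) fl := fCk 1.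
  have dl := Ck_differentiable oB fl Bx.
  have [d d0 hd] := differentiable_distP dl e0.
  exists d => // h; rewrite subr0 => /hd; rewrite diff_pdE//.
  by under [in X in `|X| <= _ -> _]eq_bigr do rewrite -pd_coord//.
exists d => // h hh.
apply: rV_norm_le => [|l]; first by rewrite mulr_ge0// ltW.
have := hd h; rewrite subr0 => /(_ hh l); rewrite !mxE.
by under [in X in _ -> X]eq_bigr do rewrite mxE.
Qed.

(** Any right inverse with values in the ball is 2-Lipschitz by [near_id_expand]. Multiplying the
    first-order expansion of [f] at [g z] by the inverse Jacobian yields the derivative of [g]. *)
Lemma near_id_inverse_Cinfty (V : set 'rV[R]_n) (g : 'rV[R]_n -> 'rV[R]_n) :
  open V -> (forall z, V z -> `|g z| < r) -> (forall z, V z -> f (g z) = z) ->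
  Cinfty_on V g.
Proof.
move=> oV gr fg.
have glip z w : V z -> V w -> `|g w - g z| <= 2 * `|w - z|.
  move=> Vz Vw; have := near_id_expand (gr _ Vz) (gr _ Vw).
  by rewrite !fg.
have gc z : V z -> {for z, continuous g}.
  move=> Vz; apply/continuous_distP => e e0.
  have /nbhs_distP[d d0 hd] : nbhs z V by exact: open_nbhs_nbhs.
  exists (Num.min d (e / 2)) => [|w]; first by rewrite lt_min d0 divr_gt0.
  rewrite lt_min => /andP[/hd Vw we]; apply: le_lt_trans (glip _ _ Vz Vw) _.
  by move: we; lra.
have gd z i : V z -> is_derive z (delta_mx 0 i : 'rV[R]_n) g (delta_mx 0 i *m invmx (J (g z))).
  move=> Vz; set Ji := invmx _.
  have cv : (fun h : R => h^-1 *: ((g \o shift z) (h *: delta_mx 0 i) - g z)) @ 0^' -->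
      (delta_mx 0 i *m Ji : 'rV[R]_n).
    apply/cvgrPdist_le => e e0.
    pose C : R := 1 + \sum_k \sum_l `|Ji k l|.
    have C0 : 0 < C.
      by apply: ltr_pwDl => //; apply: sumr_ge0 => k _; apply: sumr_ge0.
    have mulC (v : 'rV[R]_n) : `|v *m Ji| <= C * `|v|.
      apply: rV_norm_le => [|l]; first by rewrite mulr_ge0// ltW.
      rewrite mxE; apply: le_trans (ler_norm_sum _ _ _) _.
      apply: (@le_trans _ _ (\sum_k `|v| * `|Ji k l|)).
        apply: ler_sum => k _; rewrite normrM; apply: ler_wpM2r => //.
        exact: rV_norm_coord.
      rewrite -mulr_sumr mulrC; apply: ler_wpM2r => //.
      rewrite /C -[leLHS]add0r; apply: lerD => //.
      apply: ler_sum => k _; rewrite (bigD1 l)//= lerDl; exact: sumr_ge0.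
    (* [C] bounds the effect of the inverse Jacobian on norms, and 2 is the Lipschitz constant of
       [g]; the summand 1 in [C] keeps it positive. *)
    pose e' := e / (2 * C).
    have e'0 : 0 < e' by rewrite divr_gt0// mulr_gt0.
    have [d d0 hd] := J_diff (gr _ Vz) e'0.
    have n1 : \forall h \near (0 : R)^', V (z + h *: delta_mx 0 i).
      have : z + h *: delta_mx 0 i @[h --> (0:R)] --> z + (0 : R) *: delta_mx 0 i.
        apply: cvgD; first exact: cvg_cst.
        by apply: cvgZr_tmp; exact: cvg_id.
      rewrite scale0r addr0 => /(_ V) h; apply: nbhs_dnbhs; apply: h.
      exact: open_nbhs_nbhs.
    have n2 : \forall h \near (0 : R)^', `|h| < d / 2.
      by apply: dnbhs0_lt; rewrite divr_gt0.
    have n3 : \forall h \near (0 : R)^', h != 0 by exact: nbhs_dnbhs_neq.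
    near=> h.
    have Vh : V (z + h *: delta_mx 0 i) by near: h; exact: n1.
    have hd2 : `|h| < d / 2 by near: h; exact: n2.
    have h0 : h != 0 by near: h; exact: n3.
    pose del := g (z + h *: delta_mx 0 i) - g z.
    have de : `|delta_mx 0 i : 'rV[R]_n| <= 1.
      apply: rV_norm_le => // j; rewrite mxE eqxx/=; case: eqP => _ /=.
        by rewrite normr1.
      by rewrite normr0.
    have deln : `|del| <= 2 * `|h|.
      apply: le_trans (glip _ _ Vz Vh) _; rewrite addrAC subrr add0r normrZ.
      by rewrite ler_pM2l// -[leRHS]mulr1 ler_wpM2l.
    have deld : `|del| < d by apply: le_lt_trans deln _; lra.
    have := hd _ deld; have -> : g z + del = g (z + h *: delta_mx 0 i).
      by rewrite /del addrC subrK.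
    rewrite fg// fg// (addrAC z) subrr add0r => hh.
    have -> : (g \o shift z) (h *: delta_mx 0 i) - g z = del.
      by rewrite /del/= (addrC z).
    have -> : delta_mx 0 i *m Ji - h^-1 *: del =
        h^-1 *: ((h *: delta_mx 0 i - del *m J (g z)) *m Ji).
      rewrite mulmxBl -mulmxA mulmxV ?J_unit//; last exact: gr.
      have -> : (h *: delta_mx 0 i : 'rV[R]_n) *m Ji = h *: (delta_mx 0 i *m Ji) by rewrite scalemxAl.
      have aux (a b : 'rV[R]_n) : a - h^-1 *: b = h^-1 *: (h *: a - b).
        by rewrite scalerBr scalerA mulVf// scale1r.
      by rewrite mulmx1 -aux.
    rewrite normrZ normfV ler_pdivrMl ?normr_gt0//.
    apply: le_trans (mulC _) _; rewrite -ler_pdivlMl//.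
    apply: le_trans hh _; apply: le_trans (ler_wpM2l (ltW e'0) deln) _.
    by rewrite /e' le_eqVlt; apply/orP; left; apply/eqP; field; rewrite gt_eqF.
  by apply: DeriveDef; [apply/cvg_ex; eexists; exact: cv|exact: cvg_lim cv].
(* Bootstrap: the partial derivatives of [g] are entries of the inverse of [J (g z)], so [g] of
   class [C^k] makes them of class [C^k]. *)
apply/Cinfty_onP; elim=> [|k IH]; first by split.
apply/CkS; split=> // [z Vz i|i]; first by have [] := gd z i Vz.
apply/Ck_coord => // l.
have JC a b : Ck k V (fun z => J (g z) a b).
  have /CkS[_ _ /(_ a)/(Ck_coord _ _ oB)/(_ b) h] := fCk k.+1.
  have hB z : V z -> B (g z) by move=> /gr ?; apply/BE.
  by apply: (Ck_eq oV _ (Ck_comp oV oB IH h hB)) => z _; rewrite mxE.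
have uJ z : V z -> J (g z) \in unitmx by move=> /gr; exact: J_unit.
apply: (Ck_eq oV _ (Ck_invmx oV uJ JC i l)) => z; rewrite inE => Vz.
by have [_ E] := gd z i Vz; rewrite /pd E -rowE mxE.
Unshelve. all: by end_near. Qed.

End LocalInverse.

(** * Smooth maps between manifolds *)

Section CinftyRows.
Context {R : realType}.

Lemma Cinfty_on_local m n (U : set 'rV[R]_m) (f : 'rV[R]_m -> 'rV[R]_n) :
  (forall x, U x -> exists V, [/\ open V, V x & Cinfty_on V f]) -> Cinfty_on U f.
Proof. by move=> h s x Ux; have [V [_ Vx]] := h x Ux; apply. Qed.

Lemma Cinfty_on_eq m n (U : set 'rV[R]_m) (f g : 'rV[R]_m -> 'rV[R]_n) : open U ->
  {in U, f =1 g} -> Cinfty_on U f -> Cinfty_on U g.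
Proof. by move=> oU fg /Cinfty_onP h; apply/Cinfty_onP => k; exact: Ck_eq fg (h k). Qed.

Lemma Cinfty_on_sub m n (U V : set 'rV[R]_m) (f : 'rV[R]_m -> 'rV[R]_n) :
  V `<=` U -> Cinfty_on U f -> Cinfty_on V f.
Proof. by move=> VU h s x /VU; exact: h. Qed.

Lemma Cinfty_coords m n (U : set 'rV[R]_m) (f : 'rV[R]_m -> 'rV[R]_n) : open U ->
  (forall j k, Ck k U (fun x => f x 0 j)) -> Cinfty_on U f.
Proof. by move=> oU h; apply/Cinfty_onP => k; apply/Ck_coord. Qed.

Lemma Cinfty_id m (U : set 'rV[R]_m) : open U -> Cinfty_on U idfun.
Proof. by move=> oU; apply: Cinfty_coords => // j k; exact: Ck_proj. Qed.

Lemma Cinfty_row_mx m n p (U : set 'rV[R]_m) (f : 'rV[R]_m -> 'rV[R]_n)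
    (g : 'rV[R]_m -> 'rV[R]_p) : open U ->
  Cinfty_on U f -> Cinfty_on U g -> Cinfty_on U (fun x => row_mx (f x) (g x)).
Proof.
move=> oU /Cinfty_onP hf /Cinfty_onP hg; apply: Cinfty_coords => // j k.
have /(Ck_coord _ _ oU) fk := hf k; have /(Ck_coord _ _ oU) gk := hg k.
case: (split_ordP j) => l ->.
  by apply: (Ck_eq oU _ (fk l)) => x _; rewrite row_mxEl.
by apply: (Ck_eq oU _ (gk l)) => x _; rewrite row_mxEr.
Qed.

Lemma Cinfty_lsubmx m n (U : set 'rV[R]_(m + n)) : open U ->
  Cinfty_on U (fun x => lsubmx x).
Proof.
move=> oU; apply: Cinfty_coords => // j k.
by apply: (Ck_eq oU _ (Ck_proj k U (lshift n j))) => x _; rewrite !mxE.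
Qed.

Lemma Cinfty_rsubmx m n (U : set 'rV[R]_(m + n)) : open U ->
  Cinfty_on U (fun x => rsubmx x).
Proof.
move=> oU; apply: Cinfty_coords => // j k.
by apply: (Ck_eq oU _ (Ck_proj k U (rshift m j))) => x _; rewrite !mxE.
Qed.

End CinftyRows.

Section SmoothMaps.
Context {R : realType}.

(** The two manifold axioms on which the smoothness lemmas rest, isolated because a product such as
    [M * S] carries an atlas but no manifold instance. *)
Definition compat_atlas n (X : chartedType R n) :=
  (forall x : X, exists2 c : chart R n X, atlas c & chart_dom c x) /\
  (forall c d : chart R n X, atlas c -> atlas d -> smooth_transition c d).

Lemma manifold_compat n (X : smoothManifoldType R n) : compat_atlas X.
Proof. by split; [exact: atlas_cover|exact: atlas_compatible]. Qed.

Lemma atlas_smooth_chart n (X : chartedType R n) (c : chart R n X) :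
  compat_atlas X -> atlas c -> smooth_chart c.
Proof. by move=> [_ h] ac d ad; split; exact: h. Qed.

Lemma local_rep_dom_open m n (X Y : topologicalType) (c : chart R m X)
    (d : chart R n Y) (f : X -> Y) : continuous f -> open (local_rep_dom c d f).
Proof.
move=> fc; rewrite openE => y [cy dy].
have n1 : nbhs y (chart_cod c) by apply: open_nbhs_nbhs; split=> //; exact: chart_cod_open.
have n2 : nbhs y (fun y => chart_dom d (f (chart_inv c y))).
  apply: (continuous_comp (chart_inv_cont cy) (fc _)).
  by apply: open_nbhs_nbhs; split=> //; exact: chart_dom_open.
by near do split.
Unshelve. all: by end_near. Qed.

Definition smooth_at m n (X : chartedType R m) (Y : chartedType R n) (f : X -> Y) x :=
  exists (c : chart R m X) (d : chart R n Y) (V : set 'rV[R]_m),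
    [/\ [/\ atlas c, atlas d, chart_dom c x & chart_dom d (f x)],
        open V, V (c x) & Cinfty_on V (local_rep c d f)].

(** One pair of charts at each point suffices: the representative in any other pair differs by
    smooth transitions on both sides. *)
Lemma smooth_of_at m n (X : chartedType R m) (Y : chartedType R n) (f : X -> Y) :
  compat_atlas X -> compat_atlas Y -> continuous f -> (forall x, smooth_at f x) -> smooth f.
Proof.
move=> [_ tX] [_ tY] fc fs; split=> // c' d' ac' ad'.
apply: Cinfty_on_local => y [cy dy].
have [c [d [V [[ac ad cx dx] oV Vx CV]]]] := fs (chart_inv c' y).
pose tc := local_rep c' c idfun; pose td := local_rep d d' idfun.
pose W0 := local_rep_dom c' d' f `&` local_rep_dom c' c idfun.
have ctc : continuous (@idfun X) by move=> z; exact: cvg_id.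
have ctd : continuous (@idfun Y) by move=> z; exact: cvg_id.
have oW0 : open W0 by apply: openI; exact: local_rep_dom_open.
pose A := local_rep_dom c d f `&` V.
have oA : open A by apply: openI => //; exact: local_rep_dom_open.
pose B := local_rep_dom d d' idfun.
have oB : open B by exact: local_rep_dom_open.
have tcC : Cinfty_on (local_rep_dom c' c idfun) tc by exact: tX.
have tdC : Cinfty_on B td by exact: tY.
pose W := W0 `&` [set z | A (tc z)].
have oW : open W.
  rewrite openE => z [[z1 z2] Az].
  have n1 : nbhs z W0 by apply: open_nbhs_nbhs.
  have n2 : nbhs z (fun z => A (tc z)).
    have [tcc _] := tcC [::] z z2.
    by apply: tcc; apply: open_nbhs_nbhs.
  by near do split.
have tcE z : W0 z -> chart_inv c (tc z) = chart_inv c' z.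
  by move=> [_ [_ h]]; rewrite /tc /local_rep chart_funK.
have Wy : W y.
  split; first by split; split.
  split; last exact: Vx.
  split; first by exact: chart_funS.
  by rewrite tcE//; split; split.
exists W; split => //.
have step1 : Cinfty_on W (fun z => local_rep c d f (tc z)).
  apply: (Cinfty_comp (V := A) oW oA).
  - by apply: Cinfty_on_sub tcC => z [[_ ?] _].
  - by apply: Cinfty_on_sub CV => z [].
  - by move=> z [].
have step2 : Cinfty_on W (fun z => td (local_rep c d f (tc z))).
  apply: (Cinfty_comp (V := B) oW oB) => // z [Wz [Az Vz]].
  have [_ dz] := Az; rewrite tcE// in dz.
  split; rewrite /local_rep tcE//; first exact: chart_funS.
  by rewrite chart_funK//; case: Wz => -[_ ].
apply: Cinfty_on_eq step2 => // z; rewrite inE => -[Wz [[_ dz] Vz]].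
by rewrite tcE// in dz; rewrite /td /local_rep tcE// chart_funK.
Unshelve. all: by end_near. Qed.

Lemma smooth_comp m n p (X : chartedType R m) (Y : chartedType R n) (Z : chartedType R p)
    (f : X -> Y) (g : Y -> Z) : compat_atlas X -> compat_atlas Y -> compat_atlas Z ->
  smooth f -> smooth g -> smooth (g \o f).
Proof.
move=> cX cY cZ [fc fs] [gc gs]; apply: smooth_of_at => // [x|x].
  by apply: continuous_comp; [exact: fc|exact: gc].
have [c ac cx] := cX.1 x; have [d ad dx] := cY.1 (f x); have [e ae ex] := cZ.1 (g (f x)).
pose V := local_rep_dom c d f `&` [set y | local_rep_dom d e g (local_rep c d f y)].
have oV : open V.
  rewrite openE => y [y1 y2].
  have n1 : nbhs y (local_rep_dom c d f) by apply: open_nbhs_nbhs; split => //; exact: local_rep_dom_open.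
  have n2 : nbhs y (fun y => local_rep_dom d e g (local_rep c d f y)).
    have [h _] := fs c d ac ad [::] y y1; apply: h.
    by apply: open_nbhs_nbhs; split => //; exact: local_rep_dom_open.
  by near do split.
exists c, e, V; split => //.
  split; first by split; [exact: chart_funS|rewrite chart_funK].
  by rewrite /local_rep /=; split; rewrite !chart_funK//; exact: chart_funS.
have h : Cinfty_on V (fun y => local_rep d e g (local_rep c d f y)).
  apply: (Cinfty_comp (V := local_rep_dom d e g) oV).
  - exact: local_rep_dom_open.
  - by apply: Cinfty_on_sub (fs c d ac ad) => y [].
  - exact: gs.
  - by move=> y [].
apply: Cinfty_on_eq h => // y; rewrite inE => -[[_ y1] _].
by rewrite /local_rep/= chart_funK.
Unshelve. all: by end_near. Qed.

Lemma smooth_id n (X : chartedType R n) : compat_atlas X -> smooth (@idfun X).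
Proof. by move=> [_ h]; split=> [x|c d ac ad]; [exact: cvg_id|exact: h]. Qed.

Lemma compat_prod m n (X : chartedType R m) (Y : chartedType R n) :
  compat_atlas X -> compat_atlas Y -> compat_atlas (X * Y)%type.
Proof.
move=> [cX tX] [cY tY]; split.
  move=> [x y]; have [c ac cx] := cX x; have [d ad dy] := cY y.
  by exists (prod_chart c d) => //; exists c => //; exists d.
move=> _ _ [c ac [d ad <-]] [c' ac' [d' ad' <-]].
have ci (T : topologicalType) : continuous (@idfun T) by move=> z; exact: cvg_id.
rewrite /smooth_transition; set D := local_rep_dom _ _ _.
have oD : open D by exact: local_rep_dom_open.
have h1 : Cinfty_on D (fun y => local_rep c c' idfun (lsubmx y)).
  apply: (Cinfty_comp (V := local_rep_dom c c' idfun) oD).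
  - exact: local_rep_dom_open.
  - exact: Cinfty_lsubmx.
  - exact: tX.
  - by move=> y [[? ?] [? ?]]; split.
have h2 : Cinfty_on D (fun y => local_rep d d' idfun (rsubmx y)).
  apply: (Cinfty_comp (V := local_rep_dom d d' idfun) oD).
  - exact: local_rep_dom_open.
  - exact: Cinfty_rsubmx.
  - exact: tY.
  - by move=> y [[? ?] [? ?]]; split.
exact: Cinfty_row_mx h1 h2.
Qed.

Lemma smooth_pair m n p (X : chartedType R m) (Y : chartedType R n) (Z : chartedType R p)
    (f : X -> Y) (g : X -> Z) : compat_atlas X -> compat_atlas Y -> compat_atlas Z ->
  smooth f -> smooth g -> smooth (fun x => (f x, g x)).
Proof.
move=> cX cY cZ [fc fs] [gc gs]; apply: smooth_of_at => //; first exact: compat_prod.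
  by move=> x; apply: cvg_pair; [exact: fc|exact: gc].
move=> x; have [c ac cx] := cX.1 x; have [d ad dx] := cY.1 (f x); have [e ae ex] := cZ.1 (g x).
have oV : open (local_rep_dom c d f `&` local_rep_dom c e g).
  by apply: openI; exact: local_rep_dom_open.
exists c, (prod_chart d e), (local_rep_dom c d f `&` local_rep_dom c e g); split => //.
- by split => //; exists d => //; exists e.
- by split; split; rewrite ?chart_funK//; exact: chart_funS.
- apply: Cinfty_row_mx => //.
  + by apply: Cinfty_on_sub (fs c d ac ad) => y [].
  + by apply: Cinfty_on_sub (gs c e ac ae) => y [].
Qed.

Lemma smooth_cst m n (X : chartedType R m) (Y : chartedType R n) (y : Y) :
  compat_atlas X -> compat_atlas Y -> smooth (fun _ : X => y).
Proof.
move=> cX cY; apply: smooth_of_at => //.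
  by move=> x; exact: cvg_cst.
move=> x; have [c ac cx] := cX.1 x; have [d ad dx] := cY.1 y.
exists c, d, setT; split => //; first exact: openT.
by apply: Cinfty_coords; [exact: openT|move=> j k; exact: Ck_cst].
Qed.

End SmoothMaps.

(** * The group *)

Section SmoothLocal.
Context {R : realType}.

(** In contrast to [smooth_at], the whole of [V] must be mapped into the target chart, so that
    continuity at [x] becomes a consequence instead of an assumption. *)
Definition smooth_near m n (X : chartedType R m) (Y : chartedType R n) (f : X -> Y) x :=
  exists (c : chart R m X) (d : chart R n Y) (V : set 'rV[R]_m),
    [/\ [/\ atlas c, atlas d & chart_dom c x], open V, V (c x),
     V `<=` local_rep_dom c d f & Cinfty_on V (local_rep c d f)].

Lemma smooth_local m n (X : chartedType R m) (Y : chartedType R n) (f : X -> Y) :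
  compat_atlas X -> compat_atlas Y ->
  (forall x, smooth_near f x) -> smooth f.
Proof.
move=> cX cY h; apply: smooth_of_at => // x; last first.
  have [c [d [V [[ac ad cx] oV Vx Vdom CV]]]] := h x; exists c, d, V.
  by split=> //; split=> //; have [_] := Vdom _ Vx; rewrite chart_funK.
have [c [d [V [[ac ad cx] oV Vx Vdom CV]]]] := h x.
have nV : \forall z \near x, V (c z) /\ chart_dom c z.
  near=> z; split; near: z; last first.
    by apply: open_nbhs_nbhs; split => //; exact: chart_dom_open.
  by apply: (chart_fun_cont cx); exact: open_nbhs_nbhs.
have E : {near x, (fun z => chart_inv d (local_rep c d f (c z))) =1 f}.
  apply: filterS nV => z [Vz cz]; have [_] := Vdom _ Vz.
  by rewrite /local_rep chart_funK// => dz; rewrite chart_funK.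
have dfx : chart_dom d (f x) by have [_] := Vdom _ Vx; rewrite chart_funK.
have cc : {for x, continuous (fun z => chart_inv d (local_rep c d f (c z)))}.
  have [rc _] := CV [::] _ Vx.
  apply: (continuous_comp (f := fun z => local_rep c d f (c z)) (g := chart_inv d)).
    exact: continuous_comp (chart_fun_cont cx) rc.
  rewrite /local_rep chart_funK//; apply: chart_inv_cont; exact: chart_funS.
rewrite /continuous_at -(nbhs_singleton E); apply: cvg_trans cc.
exact: near_eq_cvg E.
Unshelve. all: by end_near. Qed.

End SmoothLocal.

Lemma rV_second_countable (R : realType) n : @second_countable 'rV[R]_n.
Proof.
pose U (q : 'rV[rat]_n * nat) : set 'rV[R]_n := ball (map_mx ratr q.1 : 'rV[R]_n) q.2.+1%:R^-1.
exists (range U).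
  by apply: (sub_countable (card_image_le _ _)); exact: countableP.
split=> [_ [q _ <-]|x A /nbhs_distP[d d0 hd]]; first exact: ball_open.
have [k _ kd] : exists2 k : nat, True & 2 * k.+1%:R^-1 < d.
  exists (Num.truncn (2 / d)) => //; rewrite ltr_pdivrMr// mulrC -ltr_pdivrMr//.
  exact: truncnS_gt.
have /choice[q hq] : forall j : 'I_n, exists q : rat, `|x 0 j - ratr q| < k.+1%:R^-1.
  move=> j.
  have [|q] := @rat_in_itvoo R (x 0 j - k.+1%:R^-1) (x 0 j + k.+1%:R^-1).
    by rewrite ltrBlDr -addrA ltrDl addr_gt0.
  by rewrite in_itv/= => xq; exists q; rewrite ltr_distlC.
have xq : `|x - map_mx ratr (\row_j q j)| < k.+1%:R^-1.
  by apply: rV_norm_lt => // j; rewrite !mxE.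
exists (U (\row_j q j, k)).
  by split; [exists (\row_j q j, k)|rewrite /U -ball_normE/= distrC].
move=> y; rewrite /U -ball_normE/= => qy; apply: hd.
rewrite -(subrKA (map_mx ratr (\row_j q j))).
apply: le_lt_trans (ler_normD _ _) _; rewrite distrC.
apply: lt_trans kd; rewrite mulr_natl mulr2n.
by apply: ltrD; [exact: qy|rewrite distrC; exact: xq].
Qed.

(** * The group law in coordinates *)

Section Vec3.
Context {R : realType}.
Implicit Types p q w : 'rV[R]_3.

Definition i0 : 'I_3 := @Ordinal 3 0 isT.
Definition i1 : 'I_3 := @Ordinal 3 1 isT.
Definition i2 : 'I_3 := @Ordinal 3 2 isT.

Lemma ord3P (P : 'I_3 -> Prop) : P i0 -> P i1 -> P i2 -> forall i, P i.
Proof.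
move=> h0 h1 h2 [[|[|[|//]]] hk].
- by rewrite (_ : Ordinal hk = i0)//; exact: val_inj.
- by rewrite (_ : Ordinal hk = i1)//; exact: val_inj.
- by rewrite (_ : Ordinal hk = i2)//; exact: val_inj.
Qed.

Definition vec3 (a b c : R) : 'rV[R]_3 :=
  \row_(i < 3) (if i == 0%N :> nat then a else if i == 1%N :> nat then b else c).

Lemma vec3_0 a b c : vec3 a b c 0 i0 = a. Proof. by rewrite mxE. Qed.
Lemma vec3_1 a b c : vec3 a b c 0 i1 = b. Proof. by rewrite mxE. Qed.
Lemma vec3_2 a b c : vec3 a b c 0 i2 = c. Proof. by rewrite mxE. Qed.
Definition vec3E := (vec3_0, vec3_1, vec3_2).

Lemma rV3P p q : p 0 i0 = q 0 i0 -> p 0 i1 = q 0 i1 -> p 0 i2 = q 0 i2 -> p = q.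
Proof. by move=> h0 h1 h2; apply/rowP; exact: ord3P. Qed.

Lemma rV3_norm_lt p (c : R) : 0 < c ->
  `|p| < c <-> [/\ `|p 0 i0| < c, `|p 0 i1| < c & `|p 0 i2| < c].
Proof.
move=> c0; split=> [h|[h0 h1 h2]]; last by apply: rV_norm_lt => //; exact: ord3P.
by split; apply: le_lt_trans h; exact: rV_norm_coord.
Qed.

(* E(t) = cosq t + i sinq t = exp(i pi t / 2) *)
Definition cosq (t : R) : R := cos (pi / 2 * t).
Definition sinq (t : R) : R := sin (pi / 2 * t).

Lemma cosqD s t : cosq (s + t) = cosq s * cosq t - sinq s * sinq t.
Proof. by rewrite /cosq mulrDr cosD. Qed.
Lemma sinqD s t : sinq (s + t) = sinq s * cosq t + cosq s * sinq t.
Proof. by rewrite /sinq mulrDr sinD. Qed.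
Lemma cosqN t : cosq (- t) = cosq t. Proof. by rewrite /cosq mulrN cosN. Qed.
Lemma sinqN t : sinq (- t) = - sinq t. Proof. by rewrite /sinq mulrN sinN. Qed.
Lemma cosq0 : cosq 0 = 1. Proof. by rewrite /cosq mulr0 cos0. Qed.
Lemma sinq0 : sinq 0 = 0. Proof. by rewrite /sinq mulr0 sin0. Qed.
Lemma cosq1 : cosq 1 = 0. Proof. by rewrite /cosq mulr1 cos_pihalf. Qed.
Lemma sinq1 : sinq 1 = 1. Proof. by rewrite /sinq mulr1 sin_pihalf. Qed.
Lemma cosq2Dsinq2 t : cosq t ^+ 2 + sinq t ^+ 2 = 1.
Proof. exact: cos2Dsin2. Qed.

Definition e2mul p q := vec3
  (p 0 i0 + (cosq (p 0 i2) * q 0 i0 - sinq (p 0 i2) * q 0 i1))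
  (p 0 i1 + (sinq (p 0 i2) * q 0 i0 + cosq (p 0 i2) * q 0 i1))
  (p 0 i2 + q 0 i2).
Definition e2inv p := vec3
  (- (cosq (p 0 i2) * p 0 i0 + sinq (p 0 i2) * p 0 i1))
  (- (- sinq (p 0 i2) * p 0 i0 + cosq (p 0 i2) * p 0 i1))
  (- p 0 i2).

Lemma e2mulA : associative e2mul.
Proof. by move=> p q w; apply: rV3P; rewrite !vec3E ?cosqD ?sinqD; ring. Qed.
Lemma e2mul1 : right_id (0 : 'rV[R]_3) e2mul.
Proof. by move=> p; apply: rV3P; rewrite !vec3E !mxE; ring. Qed.
Lemma e2mul1l : left_id (0 : 'rV[R]_3) e2mul.
Proof. by move=> p; apply: rV3P; rewrite !vec3E !mxE ?cosq0 ?sinq0; ring. Qed.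
Lemma e2mulV : right_inverse (0 : 'rV[R]_3) e2inv e2mul.
Proof.
(* The Pythagorean identity is handed to [ring] as a rewriting rule, oriented to eliminate the
   square of the cosine. *)
have h t : cosq t ^+ 2 = 1 - sinq t ^+ 2 by rewrite -(cosq2Dsinq2 t) addrK.
by move=> p; apply: rV3P; rewrite !vec3E !mxE; ring: (h (p 0 i2)).
Qed.
Lemma e2mulVl : left_inverse (0 : 'rV[R]_3) e2inv e2mul.
Proof. by move=> p; apply: rV3P; rewrite !vec3E !mxE ?cosqN ?sinqN; ring. Qed.

End Vec3.

(* The universal cover of the group of orientation-preserving isometries of the plane. *)
Definition e2cover (R : realType) : Type := 'rV[R]_3.

Section E2Instances.
Variable R : realType.
Local Notation E := (e2cover R).

HB.instance Definition _ := Topological.copy E 'rV[R]_3.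
HB.instance Definition _ := isGroup.Build E (@e2mulA R) (@e2mul1l R) (@e2mul1 R)
  (@e2mulVl R) (@e2mulV R).

Let idS (x : E) : setT x -> [set: 'rV[R]_3] (x : 'rV[R]_3). Proof. by []. Qed.
Let idK (x : E) : setT x -> (x : 'rV[R]_3) = x. Proof. by []. Qed.
Let idC (x : E) : setT x -> {for x, continuous (fun x : E => (x : 'rV[R]_3))}.
Proof. by move=> _; exact: cvg_id. Qed.
Let oT : open [set: E]. Proof. exact: openT. Qed.
Let oT' : open [set: 'rV[R]_3]. Proof. exact: openT. Qed.

Definition e2chart : chart R 3 E :=
  @Chart R 3 E (fun x => x) (fun x => x) setT setT oT oT' idS idS idK idK idC idC.

HB.instance Definition _ := hasAtlas.Build R 3 E [set e2chart].

Let e2haus : hausdorff_space E.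
Proof. exact: (@norm_hausdorff R 'rV[R]_3). Qed.
Let e2sc : @second_countable E. Proof. exact: rV_second_countable. Qed.
Let e2cov (x : E) : exists2 c : chart R 3 E, atlas c & chart_dom c x.
Proof. by exists e2chart. Qed.
Let e2comp (c d : chart R 3 E) : atlas c -> atlas d -> smooth_transition c d.
Proof.
move=> -> ->; apply: (@Cinfty_on_sub _ _ _ setT) => //.
by apply: Cinfty_id; exact: openT.
Qed.

HB.instance Definition _ := Charted_isSmoothManifold.Build R 3 E e2haus e2sc e2cov e2comp.

Lemma smooth_e2 (f : E -> E) : Cinfty_on setT (f : 'rV[R]_3 -> 'rV[R]_3) -> smooth f.
Proof.
move=> h; apply: smooth_local; [exact: manifold_compat|exact: manifold_compat|].
by move=> x; exists e2chart, e2chart, setT; split => //; exact: openT.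
Qed.

Lemma smooth_e2e2 (f : E * E -> E) :
  Cinfty_on setT (fun y : 'rV[R]_(3 + 3) => f (lsubmx y, rsubmx y) : 'rV[R]_3) -> smooth f.
Proof.
move=> h; apply: smooth_local; [by apply: compat_prod; exact: manifold_compat|exact: manifold_compat|].
move=> x; exists (prod_chart e2chart e2chart), e2chart, setT; split => //.
- by split => //; exists e2chart => //; exists e2chart.
- exact: openT.
Qed.

Lemma Cinfty_vec3 m (U : set 'rV[R]_m) (a b c : 'rV[R]_m -> R) : open U ->
  (forall k, Ck k U a) -> (forall k, Ck k U b) -> (forall k, Ck k U c) ->
  Cinfty_on U (fun x => vec3 (a x) (b x) (c x)).
Proof.
move=> oU ha hb hc; apply: Cinfty_coords => //; apply: ord3P => k.
- by apply: (Ck_eq oU _ (ha k)) => x _; rewrite vec3E.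
- by apply: (Ck_eq oU _ (hb k)) => x _; rewrite vec3E.
- by apply: (Ck_eq oU _ (hc k)) => x _; rewrite vec3E.
Qed.

Lemma Ck_cosq m k (U : set 'rV[R]_m) (a : 'rV[R]_m -> R) : open U ->
  Ck k U a -> Ck k U (fun x => cosq (a x)).
Proof.
move=> oU ha; have [_] := @Ck_sin_cos R m k U (fun x => pi / 2 * a x) oU
  (CkM oU (Ck_cst k U (pi / 2 : R)) ha).
by [].
Qed.

Lemma Ck_sinq m k (U : set 'rV[R]_m) (a : 'rV[R]_m -> R) : open U ->
  Ck k U a -> Ck k U (fun x => sinq (a x)).
Proof.
move=> oU ha; have [+ _] := @Ck_sin_cos R m k U (fun x => pi / 2 * a x) oU
  (CkM oU (Ck_cst k U (pi / 2 : R)) ha).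
by [].
Qed.

Lemma Ck_lsubmx m n k (U : set 'rV[R]_(m + n)) j : open U ->
  Ck k U (fun x => lsubmx x 0 j).
Proof.
by move=> oU; apply: (Ck_eq oU _ (Ck_proj k U (lshift n j))) => x _; rewrite mxE.
Qed.
Lemma Ck_rsubmx m n k (U : set 'rV[R]_(m + n)) j : open U ->
  Ck k U (fun x => rsubmx x 0 j).
Proof.
by move=> oU; apply: (Ck_eq oU _ (Ck_proj k U (rshift m j))) => x _; rewrite mxE.
Qed.

Lemma e2_smooth_mul : smooth (fun p : E * E => (p.1 * p.2)%g : E).
Proof.
apply: smooth_e2e2; have oU := @openT 'rV[R]_(3 + 3).
apply: Cinfty_vec3 => // k.
- apply: CkD => //; first exact: Ck_lsubmx.
  apply: CkB => //; apply: CkM => //; try exact: Ck_rsubmx.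
    by apply: Ck_cosq => //; exact: Ck_lsubmx.
  by apply: Ck_sinq => //; exact: Ck_lsubmx.
- apply: CkD => //; first exact: Ck_lsubmx.
  apply: CkD => //; apply: CkM => //; try exact: Ck_rsubmx.
    by apply: Ck_sinq => //; exact: Ck_lsubmx.
  by apply: Ck_cosq => //; exact: Ck_lsubmx.
- by apply: CkD => //; [exact: Ck_lsubmx|exact: Ck_rsubmx].
Qed.

Lemma e2_smooth_inv : smooth (fun p : E => p^-1%g : E).
Proof.
apply: smooth_e2; have oU := @openT 'rV[R]_3.
have c k : Ck k setT (fun p : 'rV[R]_3 => cosq (p 0 i2)) by apply: Ck_cosq => //; exact: Ck_proj.
have s k : Ck k setT (fun p : 'rV[R]_3 => sinq (p 0 i2)) by apply: Ck_sinq => //; exact: Ck_proj.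
apply: Cinfty_vec3 => // k; apply: CkN => //; last exact: Ck_proj.
  by apply: CkD => //; apply: CkM => //; exact: Ck_proj.
apply: CkD => //; apply: CkM => //; try exact: Ck_proj.
exact: CkN.
Qed.

HB.instance Definition _ := isLieGroup.Build R 3 E e2_smooth_mul e2_smooth_inv.

Lemma e2mulE (p q : E) : (p * q)%g = e2mul p q. Proof. by []. Qed.
Lemma e2invE (p : E) : (p^-1)%g = e2inv p. Proof. by []. Qed.
Lemma e2oneE : (1%g : E) = (0 : 'rV[R]_3). Proof. by []. Qed.

(** The angle is a homomorphism to an abelian group, so commutators lie in the plane of angle zero;
    that plane is abelian, which gives derived length at most 2. *)
Lemma e2_solvable : solvable_group E.
Proof.
have mulT (x y : E) : ((x * y)%g : 'rV[R]_3) 0 i2 = (x : 'rV[R]_3) 0 i2 + (y : 'rV[R]_3) 0 i2.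
  by rewrite e2mulE vec3E.
have invT (x : E) : ((x^-1)%g : 'rV[R]_3) 0 i2 = - (x : 'rV[R]_3) 0 i2.
  by rewrite e2invE vec3E.
have oneT : ((1%g : E) : 'rV[R]_3) 0 i2 = 0 by rewrite e2oneE mxE.
have d1 : @derived_series E 1 `<=` [set x : E | (x : 'rV[R]_3) 0 i2 = 0].
  apply: smallest_sub.
    split => /= [|x y xT yT|x xT]; first exact: oneT.
      by rewrite mulT xT yT addr0.
    by rewrite invT xT oppr0.
  move=> _ [x _ [y _ <-]] /=; rewrite /commg /conjg !mulT !invT; ring.
exists 2%N; apply/seteqP; split.
  apply: smallest_sub.
    split => /= [//|x y -> ->|x ->]; [by rewrite mulg1|by rewrite invg1].
  move=> _ [x /d1 xT [y /d1 yT <-]] /=; apply/eqP/commgP.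
  rewrite /= in xT yT.
  rewrite /commute; apply: rV3P; rewrite !e2mulE !vec3E xT yT ?cosq0 ?sinq0; ring.
by move=> _ ->; move=> A [[A1 _ _] _].
Qed.

End E2Instances.

(** * Contractibility, simple connectedness and connectedness of the group *)

Section E2Topology.
Variable R : realType.
Local Notation E := (e2cover R).

Lemma e2_contractible : contractible R E.
Proof.
exists (0 : 'rV[R]_3), (fun p : R * E => (1 - p.1) *: (p.2 : 'rV[R]_3) : E); split.
- apply: continuous_subspaceT => -[t x].
  apply: cvgZ.
    by apply: cvgB; [exact: cvg_cst|exact: cvg_fst].
  exact: cvg_snd.
- by move=> x; rewrite subr0 scale1r.
- by move=> x; rewrite subrr scale0r.
Qed.

Lemma e2_line_cont (x y : 'rV[R]_3) : continuous (fun t : R => x + t *: (y - x)).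
Proof.
move=> t; apply: cvgD; first exact: cvg_cst.
by apply: cvgZr_tmp; exact: cvg_id.
Qed.

Lemma e2_simply_connected : simply_connected R E.
Proof.
split.
  move=> x y; exists (fun t : R => (x : 'rV[R]_3) + t *: ((y : 'rV[R]_3) - x)); split.
  - by apply: continuous_subspaceT; exact: e2_line_cont.
  - by rewrite scale0r addr0.
  - by rewrite scale1r addrC subrK.
move=> p pc p01.
exists (fun q : R * R => (p 0 : 'rV[R]_3) + (1 - q.1) *: ((p q.2 : 'rV[R]_3) - p 0)); split.
- set A := (_ `*` _).
  (* The loop is continuous only relative to the unit interval, so its pullback has to be treated
     relative to the square. *)
  have psnd : {within A, continuous (fun q : R * R => p q.2)}.
    apply/subspace_continuousP => q [q1 q2].
    have /subspace_continuousP/(_ q.2 q2) h := pc.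
    apply: (cvg_comp snd p _ h) => B.
    rewrite /= /within/= => nB.
    have nB' : \forall z \near q, `[0, 1]%classic z.2 -> B z.2 by exact: (cvg_snd nB).
    by apply: filterS nB' => z zB [_ z2]; exact: zB.
  apply/subspace_continuousP => q Aq.
  have /subspace_continuousP/(_ q Aq) h2 := psnd.
  apply: (@cvgD _ 'rV[R]_3); first exact: cvg_cst.
  apply: (@cvgZ _ 'rV[R]_3).
    apply: cvgB; first exact: cvg_cst.
    by apply: cvg_within_filter; exact: cvg_fst.
  by apply: (@cvgB _ 'rV[R]_3) => //; exact: cvg_cst.
- by move=> t _; rewrite subr0 scale1r addrC subrK.
- by move=> t _; rewrite subrr scale0r addr0.
- by move=> s _; rewrite -p01 !subrr !scaler0 !addr0.
Qed.

Lemma e2_connected : connected [set: E].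
Proof.
have -> : [set: E] = \bigcup_(y in [set: 'rV[R]_3])
    ((fun t : R => (0 : 'rV[R]_3) + t *: (y - 0)) @` `[0, 1]%classic : set E).
  apply/seteqP; split => // y _; exists y => //; exists 1; first by rewrite /= in_itv/= ler01 lexx.
  by rewrite scale1r subr0 add0r.
apply: bigcup_connected.
  by exists 0 => y _; exists 0; rewrite /= ?in_itv/= ?lexx ?ler01// scale0r addr0.
move=> y _; apply: (@connected_continuous_connected R E _
  (fun t : R => (0 : 'rV[R]_3) + t *: ((y : 'rV[R]_3) - 0)));
  first exact: segment_connected.
by apply: continuous_subspaceT; exact: e2_line_cont.
Qed.

End E2Topology.

(** * The flat manifold *)

Section Lattice.
Variable R : realType.
Local Notation E := (e2cover R).
Implicit Types p q g : 'rV[R]_3.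

(** [E(1) = i], so natural numbers run through the powers of [i] by induction, and negative integers
    follow by conjugation. *)
Lemma quarter_turn (n : R) : n \is a Num.int ->
  [\/ cosq n = 1 /\ sinq n = 0, cosq n = 0 /\ sinq n = 1,
      cosq n = -1 /\ sinq n = 0 | cosq n = 0 /\ sinq n = -1].
Proof.
move=> /intrP[m ->].
have nat_case (k : nat) (x := k%:R : R) : [\/ cosq x = 1 /\ sinq x = 0,
    cosq x = 0 /\ sinq x = 1, cosq x = -1 /\ sinq x = 0 | cosq x = 0 /\ sinq x = -1].
  rewrite /x {x}; elim: k => [|k IH]; first by constructor 1; rewrite cosq0 sinq0.
  have -> : (k.+1%:R : R) = k%:R + 1 by rewrite natr1.
  rewrite cosqD sinqD cosq1 sinq1 !mulr0 !mulr1 sub0r add0r.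
  case: IH => -[-> ->]; rewrite ?opprK ?oppr0.
  - by constructor 2.
  - by constructor 3.
  - by constructor 4.
  - by constructor 1.
case: m => k; first exact: nat_case.
rewrite NegzE mulrNz cosqN sinqN.
case: (nat_case k.+1) => -[-> ->]; rewrite ?opprK ?oppr0.
- by constructor 1.
- by constructor 4.
- by constructor 3.
- by constructor 2.
Qed.

Lemma cosq_int (n : R) : n \is a Num.int -> cosq n \is a Num.int.
Proof. by move=> /quarter_turn[] [-> _]; rewrite ?rpredN ?rpred0 ?rpred1. Qed.
Lemma sinq_int (n : R) : n \is a Num.int -> sinq n \is a Num.int.
Proof. by move=> /quarter_turn[] [_ ->]; rewrite ?rpredN ?rpred0 ?rpred1. Qed.

Definition lat p := [&& p 0 i0 \is a Num.int, p 0 i1 \is a Num.int & p 0 i2 \is a Num.int].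

Local Open Scope quotient_scope.

Lemma lat1 : lat 0.
Proof. by rewrite /lat !mxE rpred0. Qed.

Lemma latM p q : lat p -> lat q -> lat (e2mul p q).
Proof.
move=> /and3P[p0 p1 p2] /and3P[q0 q1 q2]; have c := cosq_int p2; have s := sinq_int p2.
rewrite /lat !vec3E; apply/and3P; split; last exact: rpredD.
  exact: (rpredD p0 (rpredB (rpredM c q0) (rpredM s q1))).
exact: (rpredD p1 (rpredD (rpredM s q0) (rpredM c q1))).
Qed.

Lemma latV p : lat p -> lat (e2inv p).
Proof.
move=> /and3P[p0 p1 p2]; have c := cosq_int p2; have s := sinq_int p2.
rewrite /lat !vec3E !rpredN; apply/and3P; split => //.
  exact: (rpredD (rpredM c p0) (rpredM s p1)).
by rewrite mulNr addrC; exact: (rpredB (rpredM c p1) (rpredM s p0)).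
Qed.

(** The planar part of left translation by a lattice element is a power of [i], that is, a signed
    permutation of two coordinates. A general rotation would not preserve the sup norm. *)
Let lat_contract g p q : lat g -> `|e2mul g p - e2mul g q| <= `|p - q|.
Proof.
move=> /and3P[_ _ g2].
have h0 := rV_norm_coord (p - q) i0; have h1 := rV_norm_coord (p - q) i1.
have h2 := rV_norm_coord (p - q) i2; rewrite !mxE in h0 h1 h2.
move: h0 h1 h2; set N := `|p - q| => h0 h1 h2.
apply: rV_norm_le => [|]; first exact: normr_ge0.
apply: ord3P; rewrite !mxE/=.
- by case: (quarter_turn g2) => -[-> ->]; move: h0 h1; rewrite !ler_norml; lra.
- by case: (quarter_turn g2) => -[-> ->]; move: h0 h1; rewrite !ler_norml; lra.
- by move: h2; rewrite !ler_norml; lra.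
Qed.

Lemma lat_isometry g p q : lat g -> `|e2mul g p - e2mul g q| = `|p - q|.
Proof.
move=> lg; apply/eqP; rewrite eq_le lat_contract//=.
have := lat_contract (e2mul g p) (e2mul g q) (latV lg).
by rewrite !e2mulA e2mulVl !e2mul1l.
Qed.

Lemma int_small (x : R) : x \is a Num.int -> `|x| < 1 -> x = 0.
Proof.
move=> xi x1; apply/eqP; apply: contraTT x1 => x0.
by rewrite -leNgt; exact: norm_intr_ge1.
Qed.

(** The angle moves by an integer of absolute value less than 1, hence by 0; then [g] acts as an
    integer translation of the plane, and the same argument applies to its two coordinates. The
    lattice thus acts freely and properly with the uniform constant 1. *)
Lemma lat_displacement g p : lat g -> `|e2mul g p - p| < 1 -> g = 0.
Proof.
move=> /and3P[l0 l1 l2] /rV3_norm_lt[]; first exact: ltr01.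
rewrite !mxE/= addrK => h0 h1 /(int_small l2) g2.
rewrite g2 cosq0 sinq0 !mul1r !mul0r subr0 addrK in h0.
rewrite g2 cosq0 sinq0 !mul1r !mul0r add0r addrK in h1.
by apply: rV3P; rewrite mxE ?g2//; [exact: int_small|exact: int_small].
Qed.

Lemma lat_eq g h p : lat g -> lat h -> `|e2mul g p - e2mul h p| < 1 -> g = h.
Proof.
move=> lg lh; rewrite -(lat_isometry _ _ (latV lh)) !e2mulA e2mulVl e2mul1l.
move=> /lat_displacement; rewrite latM ?latV// => /(_ isT) E0.
by rewrite -(e2mul1l g) -(e2mulV h) -e2mulA E0 e2mul1.
Qed.

(** Equality of the cosets [Gamma p] and [Gamma q]. The quotient is taken on the left so that right
    translations descend. *)
Definition e2rel (p q : E) : bool := lat (q * p^-1)%g.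

Fact e2rel_equiv : equiv_class_of e2rel.
Proof.
split=> [p|p q|q p w].
- by rewrite /e2rel mulgV; exact: lat1.
- by apply/idP/idP => /latV; rewrite -e2invE invgM invgK.
- move=> h1 h2; have := latM h2 h1.
  by rewrite -e2mulE mulgA mulgVK.
Qed.

Canonical e2equiv := EquivRelPack e2rel_equiv.

Definition flat3 := quotient_topology {eq_quot e2equiv}.

Definition fproj (p : E) : flat3 := (\pi_(flat3) p)%qT.

End Lattice.

HB.instance Definition _ (R : realType) := Topological.on (flat3 R).

(** * Charts, separation and compactness of the quotient *)

Section FlatManifold.
Variable R : realType.
Local Notation E := (e2cover R).
Local Notation M := (flat3 R).
Implicit Types p q g : 'rV[R]_3.

Lemma fproj_surj (x : M) : exists p, fproj p = x.
Proof. by exists (repr x); rewrite /fproj reprK. Qed.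

Lemma fprojP p q : fproj p = fproj q <-> exists2 g, lat g & q = e2mul g p.
Proof.
split=> [/eqmodP h|[g lg ->]]; last apply/eqmodP.
  exists (e2mul q (e2inv p)); first exact: h.
  by rewrite -e2mulA e2mulVl e2mul1.
rewrite /= /e2rel; set h := (_ * _)%g; suff -> : h = g by [].
by rewrite /h e2mulE e2invE -e2mulA e2mulV e2mul1.
Qed.

Lemma fproj_lat g p : lat g -> fproj (e2mul g p) = fproj p.
Proof. by move=> lg; apply/esym/fprojP; exists g. Qed.

Lemma fproj_continuous : continuous (@fproj R).
Proof. exact: pi_continuous. Qed.

Lemma e2mul_Cinfty g : Cinfty_on setT (e2mul g).
Proof.
have oU := @openT 'rV[R]_3.
apply: Cinfty_vec3 => // k.
- apply: CkD => //; first exact: Ck_cst.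
  by apply: CkB => //; apply: CkM => //; try exact: Ck_cst; exact: Ck_proj.
- apply: CkD => //; first exact: Ck_cst.
  by apply: CkD => //; apply: CkM => //; try exact: Ck_cst; exact: Ck_proj.
- by apply: CkD => //; [exact: Ck_cst|exact: Ck_proj].
Qed.

Lemma e2mul_continuous g : continuous (e2mul g : 'rV[R]_3 -> 'rV[R]_3).
Proof. by move=> p; have [] := e2mul_Cinfty g [::] (x := p) I. Qed.

(** The saturation of [A] is the union of its lattice translates, each of them open. *)
Lemma fproj_open (A : set E) : open A -> open (@fproj R @` A).
Proof.
move=> oA; have -> : open (@fproj R @` A) = open (@fproj R @^-1` (@fproj R @` A)) by [].
have -> : @fproj R @^-1` (@fproj R @` A) = \bigcup_(g in [set g : 'rV[R]_3 | lat g]) (e2mul g @^-1` A).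
  apply/seteqP; split => [q /= [p Ap /esym /fprojP[g lg E0]]|q [g lg Aq]].
    by exists g => //=; rewrite /preimage/= -E0.
  by exists (e2mul g q) => //; exact: fproj_lat.
apply: bigcup_open => g _; move/continuousP: (@e2mul_continuous g); exact.
Qed.

(** By [lat_displacement], radius 1/2 would already make [fproj] injective on the ball; 1/4 is the
    sum of the two distances below 1/8 that occur in [Cinfty_lift]. *)
Definition qball p : set 'rV[R]_3 := ball p (4^-1 : R).
Lemma qballE p q : qball p q <-> `|q - p| < 4^-1.
Proof. by rewrite /qball -ball_normE/= distrC. Qed.

Lemma qball_open p : open (qball p).
Proof. exact: ball_open. Qed.

Lemma qball_center p : qball p p.
Proof. by apply/qballE; rewrite subrr normr0 invr_gt0. Qed.

Lemma qball_inj p y z : qball p y -> qball p z -> fproj y = fproj z -> y = z.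
Proof.
move=> /qballE yp /qballE zp /fprojP[g lg E0].
have h : `|e2mul g y - y| < 1.
  rewrite -E0 -(subrKA p); apply: le_lt_trans (ler_normD _ _) _.
  by rewrite (distrC p); lra.
by rewrite E0 (lat_displacement lg h) e2mul1l.
Qed.

Section Chart.
Variable p : 'rV[R]_3.
Definition fchart_dom : set M := @fproj R @` qball p.
(** The unique lift of [x] to the ball, with the default [p] off the chart domain. *)
Definition fchart_fun (x : M) : 'rV[R]_3 := xget p [set y | qball p y /\ fproj y = x].

Lemma fchart_funE y : qball p y -> fchart_fun (fproj y) = y.
Proof.
move=> qy; rewrite /fchart_fun; case: xgetP => [z -> [qz E0]|/(_ y)[]//].
exact: (qball_inj qz qy E0).
Qed.

Let dom_open : open fchart_dom. Proof. by apply: fproj_open; exact: qball_open. Qed.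
Let funS x : fchart_dom x -> qball p (fchart_fun x).
Proof. by move=> [y qy <-]; rewrite fchart_funE. Qed.
Let invS y : qball p y -> fchart_dom (fproj y). Proof. by exists y. Qed.
Let funK x : fchart_dom x -> fproj (fchart_fun x) = x.
Proof. by move=> [y qy <-]; rewrite fchart_funE. Qed.
Let fun_cont x : fchart_dom x -> {for x, continuous fchart_fun}.
Proof.
move=> [y qy <-] A; rewrite fchart_funE// => nA.
have nAq : nbhs y (A `&` qball p).
  by apply: filterI => //; apply: open_nbhs_nbhs; split => //; exact: qball_open.
have [B [oB By BA]] : exists B, [/\ open B, B y & B `<=` A `&` qball p].
  by move: nAq; rewrite nbhsE => -[B [oB By] BA]; exists B.
have : nbhs (fproj y) (@fproj R @` B).
  by apply: open_nbhs_nbhs; split; [exact: fproj_open|exists y].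
by apply: filterS => _ [z /BA [Az qz] <-]; rewrite /= fchart_funE.
Qed.
Let inv_cont y : qball p y -> {for y, continuous (@fproj R : 'rV[R]_3 -> M)}.
Proof. by move=> _; exact: fproj_continuous. Qed.

Definition fchart : chart R 3 M :=
  Chart dom_open (@qball_open p) funS invS funK (@fchart_funE) fun_cont inv_cont.
End Chart.

HB.instance Definition _ := hasAtlas.Build R 3 M (range fchart).

Lemma fchart_atlas p : atlas (fchart p). Proof. by exists p. Qed.
Lemma fchart_domE p y : qball p y -> chart_dom (fchart p) (fproj y).
Proof. by exists y. Qed.

Let fcov (x : M) : exists2 c : chart R 3 M, atlas c & chart_dom c x.
Proof.
have [p <-] := fproj_surj x; exists (fchart p); first exact: fchart_atlas.
by apply: fchart_domE; exact: qball_center.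
Qed.

(** Near each point of its domain, a transition map is left translation by one fixed lattice
    element. *)
Let fcomp (c d : chart R 3 M) : atlas c -> atlas d -> smooth_transition c d.
Proof.
move=> [p _ <-] [q _ <-]; apply: Cinfty_on_local => y [/= py [z qz /esym/fprojP[g lg E0]]].
have oV : open (e2mul g @^-1` qball q).
  by move/continuousP: (@e2mul_continuous g); apply; exact: qball_open.
exists (e2mul g @^-1` qball q); split => //; first by rewrite /preimage/= -E0.
apply: (@Cinfty_on_eq _ _ _ _ (e2mul g)) => //.
  move=> w; rewrite inE => qw; rewrite /local_rep/=.
  by rewrite -(fproj_lat _ lg) fchart_funE.
by apply: (Cinfty_on_sub (U := setT)) => //; exact: e2mul_Cinfty.
Qed.

(** The orbit of [p] keeps a positive distance [2 * e] from [q]: by [lat_eq] at most one lattice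
    translate of [p] comes within 1/2 of [q], and that one differs from [q]. Since the lattice acts
    by isometries, the images of the [e]-balls are disjoint. *)
Let fhaus : hausdorff_space M.
Proof.
rewrite open_hausdorff => x y; have [p <-] := fproj_surj x; have [q <-] := fproj_surj y.
move=> /eqP pq.
have [e e0 he] : exists2 e : R, 0 < e & forall g, lat g -> 2 * e <= `|e2mul g p - q|.
  have [[g lg gpq]|nog] := pselect (exists2 g, lat g & `|e2mul g p - q| < 2^-1).
    have gpq0 : 0 < `|e2mul g p - q|.
      rewrite normr_gt0 subr_eq0; apply/eqP => E0; apply: pq.
      by rewrite -E0 fproj_lat.
    exists (Num.min 4^-1 (`|e2mul g p - q| / 2)).
      by rewrite lt_min invr_gt0 ltr0n/= divr_gt0.
    move=> h lh; have [hg|hg] := eqVneq h g.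
      rewrite hg mulrC -ler_pdivlMr// ge_min lexx orbT//.
    rewrite mulrC -ler_pdivlMr// ge_min; apply/orP; left.
    rewrite ler_pdivlMr//; rewrite leNgt; apply: contraNN hg => hh.
    apply/eqP; apply: (lat_eq (p := p)) => //.
    rewrite -(subrKA q); apply: le_lt_trans (ler_normD _ _) _.
    by rewrite (distrC q); move: hh gpq; lra.
  exists 4^-1; first by rewrite invr_gt0.
  move=> g lg; rewrite leNgt; apply/negP => h; apply: nog; exists g => //.
  by move: h; lra.
exists (@fproj R @` ball p e, @fproj R @` ball q e) => /=.
  by split; rewrite inE; [exists p|exists q] => //; exact: ballxx.
split; [by apply: fproj_open; exact: ball_open|by apply: fproj_open; exact: ball_open|].
apply/eqP/seteqP; split => // _ [[y0 py <-] [z qz /esym/fprojP[g lg E0]]].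
have := he g lg; rewrite -ball_normE/= in py; rewrite -ball_normE/= in qz.
rewrite leNgt => /negP; apply.
rewrite -(subrKA (e2mul g y0)); apply: le_lt_trans (ler_normD _ _) _.
by rewrite lat_isometry// -E0 (distrC z); move: py qz; lra.
Qed.

Let fsc : @second_countable M.
Proof.
have [B cB [oB bB]] := rV_second_countable R 3.
exists [set @fproj R @` A | A in B].
  by apply: (sub_countable (card_image_le _ _)).
split=> [_ [A BA <-]|x U]; first by apply: fproj_open; exact: oB.
have [p <-] := fproj_surj x => /fproj_continuous /bB [A [BA Ap] AU].
exists (@fproj R @` A); first by split; [exists A|exists p].
by move=> _ [y Ay <-]; exact: AU.
Qed.

HB.instance Definition _ := Charted_isSmoothManifold.Build R 3 M fhaus fsc fcov fcomp.

Definition cube : set 'rV[R]_3 := [set p | forall j, 0 <= p 0 j <= 1].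

Lemma cube_compact : compact cube.
Proof.
have := @rV_compact R 3 (fun=> `[0, 1]%classic) (fun=> @segment_compact R 0 1).
rewrite (_ : [set v : 'rV_3 | _] = cube)//.
Qed.

Lemma cube_cover p : exists2 g, lat g & cube (e2mul g p).
Proof.
have fl (x : R) : 0 <= - (Num.floor x)%:~R + x <= 1.
  have := floor_le x; have := floorD1_gt x; rewrite intrD; lra.
(* The angle is brought into the unit interval before the plane is translated, since the integer
   turn [n] rotates the planar coordinates to [x] and [y]. *)
pose n : R := - (Num.floor (p 0 i2))%:~R.
pose x := cosq n * p 0 i0 - sinq n * p 0 i1; pose y := sinq n * p 0 i0 + cosq n * p 0 i1.
exists (vec3 (- (Num.floor x)%:~R) (- (Num.floor y)%:~R) n).
  by rewrite /lat !vec3E !rpredN !intr_int.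
by apply: ord3P; rewrite !vec3E; exact: fl.
Qed.

Lemma flat3_compact : compact [set: M].
Proof.
have -> : [set: M] = @fproj R @` cube.
  apply/seteqP; split => // x _; have [p <-] := fproj_surj x.
  have [g lg cg] := cube_cover p.
  by exists (e2mul g p) => //; exact: fproj_lat.
apply: continuous_compact; last exact: cube_compact.
by apply: continuous_subspaceT; exact: fproj_continuous.
Qed.

End FlatManifold.

(** * The two actions *)

Section Descent.
Variable R : realType.
Local Notation E := (e2cover R).
Local Notation M := (flat3 R).

Lemma smooth_fproj : smooth (@fproj R).
Proof.
apply: smooth_local; [exact: manifold_compat|exact: manifold_compat|].
move=> p; exists (e2chart R), (fchart p), (qball p); split => //.
- by split => //; exact: fchart_atlas.
- exact: qball_open.
- exact: qball_center.
- by move=> y qy; split => //; exact: fchart_domE.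
apply: (@Cinfty_on_eq _ _ _ _ idfun); first exact: qball_open.
  by move=> y; rewrite inE => qy; rewrite /local_rep/= fchart_funE.
by apply: Cinfty_id; exact: qball_open.
Qed.

(** The inverse of [fchart p] is [fproj], so on the ball [f] has the same local representative as
    [F] in the global chart of the group. *)
Lemma smooth_descent n (Y : chartedType R n) (f : M -> Y) (F : E -> Y) : compat_atlas Y ->
  (forall p, f (fproj p) = F p) -> smooth F -> smooth f.
Proof.
move=> cY fF [Fc Fs]; apply: smooth_local => //; first exact: manifold_compat.
move=> x; have [p <-] := fproj_surj x; have [d ad dx] := cY.1 (F p).
have oV : open (local_rep_dom (e2chart R) d F `&` qball p).
  by apply: openI; [exact: local_rep_dom_open|exact: qball_open].
exists (fchart p), d, (local_rep_dom (e2chart R) d F `&` qball p); split => //.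
- by split; [exact: fchart_atlas| |apply: fchart_domE; exact: qball_center].
- by rewrite /= fchart_funE//; [split; [split|]|]; try exact: qball_center.
- by move=> y [[_ dy] qy]; split => //=; rewrite fF.
apply: (@Cinfty_on_eq _ _ _ _ (local_rep (e2chart R) d F)) => //.
  by move=> y _; rewrite /local_rep/= fF.
by apply: Cinfty_on_sub (Fs (e2chart R) d _ ad) => // y [].
Qed.

Lemma smooth_descent_prod n (Y : chartedType R n) (f : M * E -> Y) (F : E * E -> Y) :
  compat_atlas Y -> (forall p w, f (fproj p, w) = F (p, w)) -> smooth F -> smooth f.
Proof.
move=> cY fF [Fc Fs]; apply: smooth_local => //.
  by apply: compat_prod; exact: manifold_compat.
move=> [x w]; have [p <-] := fproj_surj x; have [d ad dx] := cY.1 (F (p, w)).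
pose cc := prod_chart (e2chart R) (e2chart R).
have acc : atlas cc by exists (e2chart R) => //; exists (e2chart R).
have oq : open (lsubmx @^-1` qball p : set 'rV[R]_(3 + 3)).
  by move/continuousP: (@continuous_lsubmx R 1 3 3); apply; exact: qball_open.
have oV : open (local_rep_dom cc d F `&` (lsubmx @^-1` qball p)).
  by apply: openI => //; exact: local_rep_dom_open.
exists (prod_chart (fchart p) (e2chart R)), d, (local_rep_dom cc d F `&` (lsubmx @^-1` qball p)).
split => //.
- split => //; first by exists (fchart p); [exact: fchart_atlas|exists (e2chart R)].
  by split => //=; apply: fchart_domE; exact: qball_center.
- rewrite /= /prod_chart_fun/= fchart_funE; last exact: qball_center.
  split; last by rewrite /preimage/= row_mxKl; exact: qball_center.
  by split => //=; rewrite /prod_chart_inv/= row_mxKl row_mxKr.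
- by move=> y [[_ dy] qy]; split => //=; rewrite /prod_chart_inv/= fF.
apply: (@Cinfty_on_eq _ _ _ _ (local_rep cc d F)) => //.
  by move=> y _; rewrite /local_rep/= /prod_chart_inv/= fF.
by apply: Cinfty_on_sub (Fs cc d acc ad) => // y [].
Qed.

End Descent.

Lemma continuous_pairl (X Y : topologicalType) (x : X) : continuous (fun y : Y => (x, y)).
Proof. by move=> y; apply: cvg_pair; [exact: cvg_cst|exact: cvg_id]. Qed.

Section Actions.
Variable R : realType.
Local Notation E := (e2cover R).
Local Notation M := (flat3 R).
Implicit Types (m : R) (p w v g : 'rV[R]_3).

Definition dil m p := vec3 (p 0 i0) (p 0 i1) (m * p 0 i2).
(** Right multiplication conjugated by the rescaling [dil m] of the angle. In this form the action
    laws and transitivity are inherited from the group, and only equivariance under the lattice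
    depends on [m]. *)
Definition ract m p w := dil m^-1 (e2mul (dil m p) w).

Lemma dilK m p : m != 0 -> dil m^-1 (dil m p) = p.
Proof. by move=> m0; apply: rV3P; rewrite !vec3E// mulKf. Qed.
Lemma dilVK m p : m != 0 -> dil m (dil m^-1 p) = p.
Proof. by move=> m0; apply: rV3P; rewrite !vec3E// mulVKf. Qed.

Lemma ract_one m p : m != 0 -> ract m p 0 = p.
Proof. by move=> m0; rewrite /ract e2mul1 dilK. Qed.

Lemma ract_mul m p w v : m != 0 -> ract m (ract m p w) v = ract m p (e2mul w v).
Proof. by move=> m0; rewrite /ract dilVK// e2mulA. Qed.

Lemma ract_inj m p w v : m != 0 -> ract m p w = ract m p v -> w = v.
Proof.
move=> m0 h; rewrite -(e2mul1l w) -(e2mul1l v) -(e2mulVl (dil m p)) -!e2mulA.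
by congr e2mul; rewrite -(dilVK (e2mul _ w) m0) -/(ract m p w) h dilVK.
Qed.

Lemma ract_trans m p q : m != 0 -> exists w, ract m p w = q.
Proof.
move=> m0; exists (e2mul (e2inv (dil m p)) (dil m q)).
by rewrite /ract e2mulA e2mulV e2mul1l dilK.
Qed.

Lemma ract1E p w : ract 1 p w = e2mul p w.
Proof. by apply: rV3P; rewrite !vec3E ?invr1 ?mul1r. Qed.

Definition turn m := m != 0 /\
  forall n, n \is a Num.int -> cosq (m * n) = cosq n /\ sinq (m * n) = sinq n.

Lemma turn1 : turn 1.
Proof. by split; [exact: oner_neq0|move=> n _; rewrite mul1r]. Qed.

Lemma quarter_turn4 (n : R) : n \is a Num.int -> cosq (4 * n) = 1 /\ sinq (4 * n) = 0.
Proof.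
move=> nint; have -> : 4 * n = n + n + (n + n) by ring.
by rewrite !cosqD !sinqD; case: (quarter_turn nint) => -[-> ->]; split; ring.
Qed.

Lemma turn5 : turn 5.
Proof.
split; first by rewrite pnatr_eq0.
move=> n nint; have -> : 5 * n = n + 4 * n by ring.
rewrite cosqD sinqD; have [-> ->] := quarter_turn4 nint.
by split; ring.
Qed.

(** The rotation that occurs is [E(m (g2 + p2)) = E(m g2) E(m p2)], and [turn m] replaces [E(m g2)]
    by [E(g2)]. *)
Lemma ract_lat m g p w : turn m -> lat g -> ract m (e2mul g p) w = e2mul g (ract m p w).
Proof.
move=> [m0 hm] /and3P[_ _ g2]; have [c s] := hm _ g2.
apply: rV3P; rewrite !vec3E ?mulrDr ?cosqD ?sinqD ?c ?s; [ring|ring|].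
by rewrite !mulrA mulVf// !mul1r addrA.
Qed.

Lemma ract_smooth m : smooth (fun p : E * E => ract m p.1 p.2 : E).
Proof.
apply: smooth_e2e2; have oU := @openT 'rV[R]_(3 + 3).
have l j k : Ck k setT (fun x : 'rV[R]_(3 + 3) => lsubmx x 0 j) by exact: Ck_lsubmx.
have r j k : Ck k setT (fun x : 'rV[R]_(3 + 3) => rsubmx x 0 j) by exact: Ck_rsubmx.
have ml k : Ck k setT (fun x : 'rV[R]_(3 + 3) => m * lsubmx x 0 i2).
  by apply: CkM => //; exact: Ck_cst.
have c k : Ck k setT (fun x : 'rV[R]_(3 + 3) => cosq (m * lsubmx x 0 i2)) by exact: Ck_cosq.
have s k : Ck k setT (fun x : 'rV[R]_(3 + 3) => sinq (m * lsubmx x 0 i2)) by exact: Ck_sinq.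
apply: (@Cinfty_on_eq _ _ _ _ (fun y : 'rV[R]_(3 + 3) => vec3
  (lsubmx y 0 i0 + (cosq (m * lsubmx y 0 i2) * rsubmx y 0 i0 - sinq (m * lsubmx y 0 i2) * rsubmx y 0 i1))
  (lsubmx y 0 i1 + (sinq (m * lsubmx y 0 i2) * rsubmx y 0 i0 + cosq (m * lsubmx y 0 i2) * rsubmx y 0 i1))
  (m^-1 * (m * lsubmx y 0 i2 + rsubmx y 0 i2)))) => //.
  by move=> y _; apply: rV3P; rewrite !vec3E.
apply: Cinfty_vec3 => // k.
- by apply: CkD => //; apply: CkB => //; exact: CkM.
- by apply: CkD => //; apply: CkD => //; exact: CkM.
- by apply: CkM => //; [exact: Ck_cst|exact: CkD].
Qed.

Definition rho_fun m (x : M * E) : M := fproj (ract m (repr x.1) x.2).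

Lemma rho_funE m p w : turn m -> rho_fun m (fproj p, w) = fproj (ract m p w).
Proof.
move=> tm; rewrite /rho_fun/=; have : fproj (repr (fproj p)) = fproj p by rewrite /fproj reprK.
move=> /esym/fprojP[g lg ->]; by rewrite ract_lat// fproj_lat.
Qed.

Lemma rho_smooth m : turn m -> smooth (rho_fun m).
Proof.
move=> tm; apply: (smooth_descent_prod (F := fun x : E * E => fproj (ract m x.1 x.2))).
- exact: manifold_compat.
- by move=> p w; rewrite rho_funE.
- apply: (smooth_comp (f := fun x : E * E => ract m x.1 x.2 : E)).
  + by apply: compat_prod; exact: manifold_compat.
  + exact: manifold_compat.
  + exact: manifold_compat.
  + exact: ract_smooth.
  + exact: smooth_fproj.
Qed.

Definition rho m (tm : turn m) : smoothMap (M * E)%type M := SmoothMap (rho_smooth tm).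

Lemma rhoE m (tm : turn m) p w : rho tm (fproj p, w) = fproj (ract m p w).
Proof. exact: rho_funE. Qed.

Lemma rho_right_action m (tm : turn m) : right_action (rho tm).
Proof.
split=> [x|x s t]; have [p <-] := fproj_surj x.
  by rewrite rhoE ract_one; case: tm.
by rewrite (rhoE tm p s) (rhoE tm _ t) (rhoE tm p) ract_mul//; case: tm.
Qed.

Lemma ract_continuous m p : continuous (ract m p : 'rV[R]_3 -> 'rV[R]_3).
Proof.
have [c _] := ract_smooth m; move=> w.
have h : continuous (fun w : E => (p : E, w)) by exact: continuous_pairl.
exact: (@continuous_comp E (E * E)%type E (fun w => (p : E, w))
  (fun q => ract m q.1 q.2) w (h w) (c (p, w))).
Qed.

(** An element fixing [fproj p] moves [p] to a lattice translate of [p]. For two such elements that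
    are close enough, [lat_eq] makes the translates coincide, and the action on the cover is
    free. *)
Lemma rho_locally_free m (tm : turn m) : locally_free (rho tm).
Proof.
move=> x s; have [p <-] := fproj_surj x; have [m0 _] := tm.
move=> hs; have hs1 : rho tm (fproj p, s) = fproj p := hs.
split; first by rewrite inE.
rewrite rhoE in hs1; have /fprojP[g lg gE] := esym hs1.
exists (fun w : E => `|ract m p w - ract m p s| < 1).
  apply: (@ract_continuous m p s (fun q : 'rV[R]_3 => `|q - ract m p s| < 1)).
  by apply/nbhs_distP; exists 1.
apply/seteqP; split => [w [w1 hw]|w ->]; last by split => //=; rewrite subrr normr0.
have hw1 : rho tm (fproj p, w) = fproj p := hw.
rewrite rhoE in hw1; have /fprojP[h lh hE] := esym hw1; apply: (ract_inj (m := m) (p := p)) => //.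
rewrite hE gE; congr e2mul; apply: (lat_eq (p := p)) => //.
by rewrite -hE -gE.
Qed.

Lemma rho_orbit m (tm : turn m) x : action_orbit (rho tm) x = setT.
Proof.
apply/seteqP; split => // y _; have [p <-] := fproj_surj x; have [q <-] := fproj_surj y.
have [m0 _] := tm; have [w <-] := ract_trans p q m0.
by exists w => //; rewrite rhoE.
Qed.

Lemma rho_foliation m (tm : turn m) : orbit_foliation (rho tm) = [set setT].
Proof.
apply/seteqP; split => [_ [x _ <-]|_ ->]; first exact: rho_orbit.
by exists (fproj 0) => //; exact: rho_orbit.
Qed.

(** Modulo 4 the angle becomes some [r] in [[0, 4)]. If [r > 0], then [sinq (r / 2) > 0], whereas
    the double-angle formula with [cosq r = 1] gives [sinq (r / 2) = 0]. *)
Lemma cosq_eq1 (t : R) : cosq t = 1 -> exists2 k, k \is a Num.int & t = 4 * k.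
Proof.
move=> c1; pose k : R := (Num.floor (t / 4))%:~R.
have kint : k \is a Num.int by exact: intr_int.
exists k => //.
have [c4 s4] := quarter_turn4 kint.
have k1 : k <= t / 4 by exact: floor_le.
have k2 : t / 4 < k + 1 by have := floorD1_gt (t / 4); rewrite intrD.
pose r := t - 4 * k.
have r0 : 0 <= r by rewrite /r; lra.
have r4 : r < 4 by rewrite /r; lra.
have cr : cosq r = 1 by rewrite /r cosqD cosqN sinqN c4 s4 c1; ring.
have [rr0|rn0] := eqVneq r 0; first by move: rr0; rewrite /r; lra.
have rgt : 0 < r by rewrite lt0r rn0.
have : 0 < sinq (r / 2).
  apply: sin_gt0_pi; have pi0 := pi_gt0 R.
  rewrite mulr_gt0 ?divr_gt0//=.
  have -> : trigo.pi / 2 * (r / 2) = trigo.pi * (r / 4) by field.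
  by rewrite gtr_pMr// ltr_pdivrMr// mul1r.
have := cosq2Dsinq2 (r / 2); have : cosq (r / 2 + r / 2) = 1 by rewrite -splitr.
rewrite cosqD; set c := cosq _; set s := sinq _ => h1 h2 h3.
have : s * s = 0 by move: h1 h2; rewrite !expr2; lra.
by move/eqP; rewrite mulf_eq0 orbb => /eqP s0; rewrite s0 ltxx in h3.
Qed.

(** Commuting with the quarter turn [(0, 1)] kills the planar part, and commuting with the
    translation [(1, 0)] forces the rotation to be trivial. *)
Lemma e2_central (c : E) : (forall w : E, (c * w = w * c)%g) ->
  exists2 k : R, k \is a Num.int & c = vec3 0 0 (4 * k).
Proof.
move=> h.
have /matrixP h1 := h (vec3 0 0 1); have /matrixP h2 := h (vec3 1 0 0).
have a0 := h1 0 i0; have a1 := h1 0 i1; have b0 := h2 0 i0.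
rewrite !e2mulE !vec3E !cosq1 !sinq1 in a0 a1.
rewrite !e2mulE !vec3E cosq0 sinq0 in b0.
have c1 : cosq ((c : 'rV[R]_3) 0 i2) = 1 by move: b0; lra.
have [k kint kE] := cosq_eq1 c1; exists k => //.
by apply: rV3P; rewrite !vec3E//; lra.
Qed.

(** The contradiction is one of divisibility in the center: fixing a point for [m = 5] makes
    [Phi z4] a fifth power of a central element, and pulling back by the inverse [G] would make the
    generator [z4] a fifth power too. *)
Lemma rho_not_equivalent : ~ parameter_equivalent (rho turn5) (rho turn1).
Proof.
move=> [Phi [f [[[_ [G [_ PK GK]]] PM] _ equiv _ _]]].
pose z4 : E := vec3 0 0 4.
have z4c (w : E) : (z4 * w = w * z4)%g.
  have [c4 s4] : cosq 4 = 1 :> R /\ sinq 4 = 0 :> R.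
    by have := quarter_turn4 (rpred1 _); rewrite mulr1.
  by apply: rV3P; rewrite !e2mulE !vec3E ?c4 ?s4; ring.
have z4l : lat (z4 : 'rV[R]_3).
  by rewrite /lat !vec3E !rpred0 /= natr_int.
have Pc (w : E) : (Phi z4 * w = w * Phi z4)%g.
  by rewrite -(GK w) -!PM z4c.
have [k kint kE] := e2_central Pc.
have := equiv (fproj 0) z4.
rewrite rhoE ract1E -e2mulE -z4c e2mulE fproj_lat//.
have [p <-] := fproj_surj (f (fproj 0)); rewrite rhoE => /fprojP[g /and3P[_ _ lg] gE].
have gk : 4 * k = 5 * g 0 i2.
  have /matrixP/(_ 0 i2) := gE; rewrite kE !vec3E.
  move/(congr1 (fun x => 5 * x)); rewrite mulVKf ?pnatr_eq0//; lra.
(* From [4 k = 5 g2] it follows that [k = 5 (k - g2)]. *)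
pose j := k - g 0 i2.
have jint : j \is a Num.int by exact: rpredB.
have kj : k = 5 * j by rewrite /j; lra.
pose c : E := vec3 0 0 (4 * j).
have cc (w : E) : (c * w = w * c)%g.
  have [c4 s4] := quarter_turn4 jint.
  by apply: rV3P; rewrite !e2mulE !vec3E ?c4 ?s4; ring.
have Gc (w : E) : (G c * w = w * G c)%g.
  by apply: (can_inj PK); rewrite !PM !GK cc.
have [l lint lE] := e2_central Gc.
have addc (a b : R) : e2mul (vec3 0 0 a) (vec3 0 0 b) = vec3 0 0 (a + b).
  by apply: rV3P; rewrite !vec3E; ring.
have : (G c * G c * G c * G c * G c)%g = z4.
  apply: (can_inj PK); rewrite !PM !GK kE kj !e2mulE !addc.
  by congr vec3; ring.
rewrite lE !e2mulE !addc => /matrixP/(_ 0 i2); rewrite !vec3E => l5.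
have l51 : 5 * l = 1 by lra.
have : l = 0 by apply: int_small => //; rewrite ltr_norml; lra.
by move=> l0; move/eqP: l51; rewrite l0 mulr0 eq_sym oner_eq0.
Qed.

Lemma rho_not_rigid : ~ parameter_rigid (rho turn1).
Proof.
move=> h; apply: rho_not_equivalent; apply: h; split.
- exact: rho_right_action.
- exact: rho_locally_free.
- by rewrite !rho_foliation.
Qed.

End Actions.

(** * Actions close to the first one *)

Section SmoothNear.
Context {R : realType}.

Lemma open_preimage_on (X Y : topologicalType) (V : set X) (A : set Y) (f : X -> Y) :
  open V -> open A -> (forall x, V x -> {for x, continuous f}) -> open (V `&` f @^-1` A).
Proof.
move=> oV oA fc; rewrite openE => x [Vx Ax].
have n1 : nbhs x V by exact: open_nbhs_nbhs.
have n2 : nbhs x (f @^-1` A) by apply: (fc x Vx); exact: open_nbhs_nbhs.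
exact: filterI.
Qed.

Lemma smooth_smooth_near m n (X : chartedType R m) (Y : chartedType R n) (f : X -> Y) x :
  compat_atlas X -> compat_atlas Y -> smooth f -> smooth_near f x.
Proof.
move=> [cX _] [cY _] [fc fs]; have [c ac cx] := cX x; have [d ad dx] := cY (f x).
exists c, d, (local_rep_dom c d f); split => //.
- exact: local_rep_dom_open.
- by split; [exact: chart_funS|rewrite chart_funK].
- exact: fs.
Qed.

(** A pointwise version of composition, with a transition inserted between the two middle charts. It
    serves the inverse conjugacy, whose smoothness is first available at the base point alone. *)
Lemma smooth_near_comp m n p (X : chartedType R m) (Y : chartedType R n)
    (Z : chartedType R p) (f : X -> Y) (g : Y -> Z) x : compat_atlas Y ->
  smooth_near f x -> smooth_near g (f x) -> smooth_near (g \o f) x.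
Proof.
move=> [_ tY] [c [d [V [[ac ad cx] oV Vx Vdom fC]]]] [d' [e [W [[ad' ae dx] oW Wfx Wdom gC]]]].
pose T := local_rep_dom d d' (@idfun Y).
have ci : continuous (@idfun Y) by move=> z; exact: cvg_id.
have oT : open T by exact: local_rep_dom_open.
have tC : Cinfty_on T (local_rep d d' idfun) by exact: tY.
pose T' := T `&` (local_rep d d' idfun) @^-1` W.
have oT' : open T' by apply: open_preimage_on => // y Ty; have [] := tC [::] y Ty.
pose V' := V `&` (local_rep c d f) @^-1` T'.
have oV' : open V' by apply: open_preimage_on => // y Vy; have [] := fC [::] y Vy.
have dfx : chart_dom d (f x) by have [_] := Vdom _ Vx; rewrite chart_funK.
have E1 y : V y -> chart_inv d (local_rep c d f y) = f (chart_inv c y).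
  by move=> /Vdom[_ dy]; rewrite /local_rep chart_funK.
have E2 y : T y -> chart_inv d' (local_rep d d' idfun y) = chart_inv d y.
  by move=> [_ dy]; rewrite /local_rep chart_funK.
exists c, e, V'; split => //.
- have r0 : local_rep c d f (c x) = d (f x) by rewrite /local_rep chart_funK.
  split; rewrite // /preimage/= r0; split.
    by split; [exact: chart_funS|rewrite chart_funK].
  by rewrite /preimage/= /local_rep/= chart_funK.
- move=> y [Vy [Ty Wy]]; have [cy _] := Vdom _ Vy; split => //=.
  by have [_] := Wdom _ Wy; rewrite E2// E1.
have C1 : Cinfty_on V' (fun y => local_rep d d' idfun (local_rep c d f y)).
  apply: (Cinfty_comp (V := T) oV' oT).
  - by apply: Cinfty_on_sub fC => y [].
  - exact: tC.
  - by move=> y [_ []].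
have C2 : Cinfty_on V' (fun y => local_rep d' e g (local_rep d d' idfun (local_rep c d f y))).
  by apply: (Cinfty_comp (V := W) oV' oW) => // y [_ []].
apply: (Cinfty_on_eq oV' _ C2) => y; rewrite inE => -[Vy [Ty Wy]].
by rewrite {1}/local_rep E2// E1.
Qed.

Lemma smooth_near_eq m n (X : chartedType R m) (Y : chartedType R n) (f g : X -> Y) x :
  f =1 g -> smooth_near f x -> smooth_near g x.
Proof. by move=> /funext ->. Qed.

Lemma Cinfty_subbase_open m n (X : chartedType R m) (Y : chartedType R n)
    (B : set (smoothMap X Y)) : Cinfty_subbase B -> open B.
Proof.
move=> SB; exists [set B]; last by rewrite bigcup_set1.
by move=> _ ->; exact: (@finI_from1 _ _ (@Cinfty_subbase R m n X Y) idfun).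
Qed.

Lemma derive_row_mx m n (W : normedModType R) (g : 'rV[R]_(m + n) -> W)
    (a : 'rV[R]_m) (s v : 'rV[R]_n) :
  'D_(row_mx 0 v) g (row_mx a s) = 'D_v (fun s => g (row_mx a s)) s.
Proof.
have E : (fun h : R => h^-1 *: ((g \o shift (row_mx a s)) (h *: row_mx 0 v) - g (row_mx a s))) =
    (fun h : R => h^-1 *: (((fun s => g (row_mx a s)) \o shift s) (h *: v) - g (row_mx a s))).
  by apply/funext => h /=; rewrite scale_row_mx scaler0 add_row_mx add0r.
by rewrite /derive E.
Qed.

Lemma delta_row_mx m n (i : 'I_n) :
  delta_mx 0 (rshift m i) = row_mx 0 (delta_mx 0 i) :> 'rV[R]_(m + n).
Proof.
apply/rowP => j; case: (split_ordP j) => l ->; rewrite ?row_mxEl ?row_mxEr !mxE eqxx/=.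
  by rewrite eq_lrshift.
by rewrite (inj_eq (@rshift_inj _ _)).
Qed.

End SmoothNear.

(** * Orbit maps of nearby actions, lifted to the cover *)

Section NearLift.
Variable R : realType.
Local Notation E := (e2cover R).
Local Notation M := (flat3 R).
Local Notation rho0 := (rho (turn1 R)).
Local Notation x0 := (fproj (0 : 'rV[R]_3)).

Lemma rho0E p w : rho0 (fproj p, w) = fproj (e2mul p w).
Proof. by rewrite rhoE ract1E. Qed.

Lemma rho0_base w : rho0 (x0, w) = fproj w.
Proof. by rewrite rho0E e2mul1l. Qed.

Lemma closed_ball_compact (p : 'rV[R]_3) (r : R) : compact [set s | `|s - p| <= r].
Proof.
apply: bounded_closed_compact.
  exists (`|p| + r); split; first exact: num_real.
  move=> N rN x /= xr; rewrite -(subrK p x); apply: le_trans (ler_normD _ _) _.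
  by rewrite addrC; apply: le_trans (ltW rN); rewrite lerD2l.
apply: (closed_comp (f := fun x : 'rV[R]_3 => `|x - p|) (D := [set t | t <= r])); last exact: closed_le.
move=> x _; apply/continuous_distP => e e0; exists e => // y yx.
by apply: le_lt_trans yx; apply: le_trans (ler_dist_dist _ _) _; rewrite opprB addrA subrK.
Qed.

(** A single subbasic neighborhood of order 1 suffices, over the compact set of pairs [(x0, s)] with
    [s] within 1/8 of [p]. In the chart at [p], of radius 1/4, the orbit map of [rho0] is the
    identity, so its partial derivatives along the group are the standard basis vectors. *)
Lemma near_lift (p : 'rV[R]_3) (e : R) : 0 < e ->
  nbhs rho0 (fun rho' : smoothMap (M * E)%type M => forall s : 'rV[R]_3, `|s - p| <= 8^-1 ->
    [/\ fchart_dom p (rho' (x0, s)), `|fchart_fun p (rho' (x0, s)) - s| < e &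
     forall i, `|pd i (fun s => fchart_fun p (rho' (x0, s))) s - delta_mx 0 i| < e]).
Proof.
move=> e0.
pose cc := prod_chart (fchart (0 : 'rV[R]_3)) (e2chart R).
pose K : set (M * E) := (fun s : 'rV[R]_3 => (x0, s : E)) @` [set s | `|s - p| <= 8^-1].
have cM : compat_atlas M by exact: manifold_compat.
have cE : compat_atlas E by exact: manifold_compat.
have cME : compat_atlas (M * E)%type by exact: compat_prod.
have acc : atlas cc by exists (fchart 0); [exact: fchart_atlas|exists (e2chart R)].
have qb s : `|s - p| <= 8^-1 -> qball p s by move=> h; apply/qballE; lra.
pose B := Cr_neighborhood rho0 cc (fchart p) K 1 e.
have SB : Cinfty_subbase B.
  exists rho0, cc, (fchart p), K, 1%N, e; split => //.
    split.
    - exact: atlas_smooth_chart.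
    - apply: continuous_compact; last exact: closed_ball_compact.
      by apply: continuous_subspaceT; exact: (@continuous_pairl M E x0).
    - move=> _ [s _ <-]; split => //=; apply: fchart_domE; exact: qball_center.
  split; first by apply: atlas_smooth_chart => //; exact: fchart_atlas.
  by move=> _ [_ [s sp <-] <-]; rewrite rho0_base; apply: fchart_domE; exact: qb.
have nB : nbhs rho0 B.
  apply: open_nbhs_nbhs; split; first exact: Cinfty_subbase_open.
  split=> [_ [_ [s sp <-] <-]|s _ x _]; last by rewrite subrr normr0.
  by rewrite rho0_base; apply: fchart_domE; exact: qb.
apply: filterS nB => rho' [dom close] s sp.
have Ks : K (x0, s : E) by exists s.
have domS : fchart_dom p (rho' (x0, s)) by apply: dom; exists (x0, s : E).
have ccE : cc (x0, s : E) = row_mx 0 s.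
  by rewrite /= /prod_chart_fun/= fchart_funE//; exact: qball_center.
have repE (r : smoothMap (M * E)%type M) (t : 'rV[R]_3) :
    local_rep cc (fchart p) r (row_mx 0 t) = fchart_fun p (r (x0, t)).
  by rewrite /local_rep/= /prod_chart_inv row_mxKl row_mxKr.
have rep0 (t : 'rV[R]_3) : qball p t -> fchart_fun p (rho0 (x0, t)) = t.
  by move=> qt; rewrite rho0_base fchart_funE.
split => //.
  have : `|local_rep cc (fchart p) rho0 (row_mx 0 s) -
      local_rep cc (fchart p) rho' (row_mx 0 s)| < e.
    by rewrite -ccE; exact: (close [::] isT _ Ks).
  by rewrite !repE rep0; [rewrite distrC|exact: qb].
move=> i; have : `|'D_(delta_mx 0 (rshift 3 i)) (local_rep cc (fchart p) rho0) (row_mx 0 s) -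
      'D_(delta_mx 0 (rshift 3 i)) (local_rep cc (fchart p) rho') (row_mx 0 s)| < e.
  by rewrite -ccE; exact: (close [:: rshift 3 i] isT _ Ks).
rewrite delta_row_mx !derive_row_mx.
have fE (r : smoothMap (M * E)%type M) : (fun t : 'rV[R]_3 => local_rep cc (fchart p) r (row_mx 0 t)) =
    (fun t : 'rV[R]_3 => fchart_fun p (r (x0, t))) by apply/funext => t; exact: repE.
rewrite !fE.
have -> : 'D_(delta_mx 0 i) (fun t : 'rV[R]_3 => fchart_fun p (rho0 (x0, t))) s = delta_mx 0 i.
  rewrite -[RHS](derive_id s (delta_mx 0 i)); apply: near_eq_derive.
  have nq : nbhs s (qball p) by apply: open_nbhs_nbhs; split; [exact: qball_open|exact: qb].
  by apply: filterS nq => t; exact: rep0.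
by rewrite distrC.
Qed.

(** No single chart covers [D]; compactness merges the neighborhoods of [rho0] obtained around each
    of its points. *)
Lemma near_lift_compact (D : set 'rV[R]_3) (e : R) : compact D -> 0 < e ->
  nbhs rho0 (fun rho' : smoothMap (M * E)%type M => forall s : 'rV[R]_3, D s ->
    exists2 y : 'rV[R]_3, `|y - s| < e & rho' (x0, s) = fproj y).
Proof.
move=> cD e0; have /compact_near_coveringP h := cD.
apply: (h _ (nbhs rho0) (fun (rho' : smoothMap (M * E)%type M) (s : 'rV[R]_3) => exists2 y : 'rV[R]_3, `|y - s| < e & rho' (x0, s) = fproj y)).
move=> s Ds.
exists ([set t | `|t - s| <= 8^-1], [set rho' : smoothMap (M * E)%type M |
   forall t : 'rV[R]_3, `|t - s| <= 8^-1 ->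
    [/\ fchart_dom s (rho' (x0, t)), `|fchart_fun s (rho' (x0, t)) - t| < e &
     forall i, `|pd i (fun t => fchart_fun s (rho' (x0, t))) t - delta_mx 0 i| < e]]) => /=.
  split; last exact: near_lift.
  by apply/nbhs_distP; exists 8^-1; [rewrite invr_gt0|move=> y /ltW].
move=> [t rho'] /= [ts hr]; have [dt ct _] := hr t ts.
exists (fchart_fun s (rho' (x0, t))) => //.
by have := chart_funK (c := fchart s) dt.
Qed.

End NearLift.

(** * Automorphisms from similarities of the plane *)

Section Automorphism.
Variable R : realType.
Local Notation E := (e2cover R).
Variables v0 v1 c0 c1 : R.
Hypothesis vn0 : v0 ^+ 2 + v1 ^+ 2 != 0.
Implicit Types p q : 'rV[R]_3.

(* Multiplication of the plane by v0 + i v1, composed with conjugation by the translation (c0, c1). *)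
Definition sim p := vec3
  (v0 * p 0 i0 - v1 * p 0 i1 + (c0 - (cosq (p 0 i2) * c0 - sinq (p 0 i2) * c1)))
  (v1 * p 0 i0 + v0 * p 0 i1 + (c1 - (sinq (p 0 i2) * c0 + cosq (p 0 i2) * c1)))
  (p 0 i2).

(** The conjugation is undone first, then division by [v0 + i v1] is multiplication by the conjugate
    over the squared modulus. *)
Definition sim_inv p :=
  let x := p 0 i0 - (c0 - (cosq (p 0 i2) * c0 - sinq (p 0 i2) * c1)) in
  let y := p 0 i1 - (c1 - (sinq (p 0 i2) * c0 + cosq (p 0 i2) * c1)) in
  vec3 ((v0 ^+ 2 + v1 ^+ 2)^-1 * (v0 * x + v1 * y))
       ((v0 ^+ 2 + v1 ^+ 2)^-1 * (v0 * y - v1 * x)) (p 0 i2).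

Lemma simM p q : sim (e2mul p q) = e2mul (sim p) (sim q).
Proof. by apply: rV3P; rewrite !vec3E ?cosqD ?sinqD; ring. Qed.

Lemma simK : cancel sim sim_inv.
Proof. by move=> p; apply: rV3P; rewrite !vec3E//; field. Qed.

Lemma sim_invK : cancel sim_inv sim.
Proof. by move=> p; apply: rV3P; rewrite !vec3E//; field. Qed.

Lemma sim0 : sim 0 = 0.
Proof. by apply: rV3P; rewrite !vec3E !mxE ?cosq0 ?sinq0; ring. Qed.

Lemma sim_inv0 : sim_inv 0 = 0.
Proof. by rewrite -{1}sim0 simK. Qed.

Lemma sim_invM p q : sim_inv (e2mul p q) = e2mul (sim_inv p) (sim_inv q).
Proof. by apply: (can_inj simK); rewrite simM !sim_invK. Qed.

Lemma Cinfty_sim : Cinfty_on setT sim.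
Proof.
have oU := @openT 'rV[R]_3.
have x j k : Ck k setT (fun p : 'rV[R]_3 => p 0 j) by exact: Ck_proj.
have cst (a : R) k : Ck k (@setT 'rV[R]_3) (fun=> a) by exact: Ck_cst.
have c k : Ck k setT (fun p : 'rV[R]_3 => cosq (p 0 i2)) by exact: Ck_cosq.
have s k : Ck k setT (fun p : 'rV[R]_3 => sinq (p 0 i2)) by exact: Ck_sinq.
apply: Cinfty_vec3 => // k.
- apply: CkD => //; first by apply: CkB => //; exact: CkM.
  by apply: CkB => //; apply: CkB => //; exact: CkM.
- apply: CkD => //; first by apply: CkD => //; exact: CkM.
  by apply: CkB => //; apply: CkD => //; exact: CkM.
Qed.

Lemma Cinfty_sim_inv : Cinfty_on setT sim_inv.
Proof.
have oU := @openT 'rV[R]_3.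
have x j k : Ck k setT (fun p : 'rV[R]_3 => p 0 j) by exact: Ck_proj.
have cst (a : R) k : Ck k (@setT 'rV[R]_3) (fun=> a) by exact: Ck_cst.
have c k : Ck k setT (fun p : 'rV[R]_3 => cosq (p 0 i2)) by exact: Ck_cosq.
have s k : Ck k setT (fun p : 'rV[R]_3 => sinq (p 0 i2)) by exact: Ck_sinq.
have h0 k : Ck k setT (fun p : 'rV[R]_3 => p 0 i0 - (c0 - (cosq (p 0 i2) * c0 - sinq (p 0 i2) * c1))).
  by apply: CkB => //; apply: CkB => //; apply: CkB => //; exact: CkM.
have h1 k : Ck k setT (fun p : 'rV[R]_3 => p 0 i1 - (c1 - (sinq (p 0 i2) * c0 + cosq (p 0 i2) * c1))).
  by apply: CkB => //; apply: CkB => //; apply: CkD => //; exact: CkM.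
apply: Cinfty_vec3 => // k.
- by apply: CkM => //; apply: CkD => //; exact: CkM.
- by apply: CkM => //; apply: CkB => //; exact: CkM.
Qed.

Lemma sim_automorphism : lie_automorphism (sim : E -> E).
Proof.
split; last by move=> p q; exact: simM.
split; first by apply: smooth_e2; exact: Cinfty_sim.
exists sim_inv; split; last 2 first.
- exact: simK.
- exact: sim_invK.
by apply: smooth_e2; exact: Cinfty_sim_inv.
Qed.

Lemma cosq_norm (t : R) : `|cosq t| <= 1.
Proof. by rewrite ler_norml cos_le1 cos_geN1. Qed.
Lemma sinq_norm (t : R) : `|sinq t| <= 1.
Proof. by rewrite ler_norml sin_le1 sin_geN1. Qed.

Let norm_mul_le (a b c d : R) : `|a| <= c -> `|b| <= d -> `|a * b| <= c * d.
Proof. by move=> h1 h2; rewrite normrM; apply: ler_pM. Qed.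

(** Each planar coordinate of [sim p - p] is a sum of five terms of size at most [e]: two from
    [v - 1] applied to [p], and three from [c - E(t) c]. *)
Lemma sim_near p (e : R) : `|v0 - 1| <= e -> `|v1| <= e -> `|c0| <= e -> `|c1| <= e ->
  `|p| <= 1 -> `|sim p - p| <= 5 * e.
Proof.
move=> hv0 hv1 hc0 hc1 p1.
have e0 : 0 <= e by exact: le_trans (normr_ge0 _) hv1.
have x1 := le_trans (rV_norm_coord p i0) p1; have y1 := le_trans (rV_norm_coord p i1) p1.
apply: rV_norm_le; first by rewrite mulr_ge0.
have a1 := norm_mul_le hv0 x1; have a2 := norm_mul_le hv1 y1.
have a3 := norm_mul_le hv1 x1; have a4 := norm_mul_le hv0 y1.
have b1 := norm_mul_le (cosq_norm (p 0 i2)) hc0; have b2 := norm_mul_le (sinq_norm (p 0 i2)) hc1.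
have b3 := norm_mul_le (sinq_norm (p 0 i2)) hc0; have b4 := norm_mul_le (cosq_norm (p 0 i2)) hc1.
apply: ord3P; rewrite [X in `|X|]mxE [X in _ + X]mxE !vec3E.
- move: a1 a2 b1 b2 hc0; rewrite !ler_norml; lra.
- move: a3 a4 b3 b4 hc1; rewrite !ler_norml; lra.
- by rewrite subrr normr0 mulr_ge0.
Qed.

End Automorphism.

Lemma continuous_pairing (X Y Z : topologicalType) (f : X -> Y) (g : X -> Z) x :
  {for x, continuous f} -> {for x, continuous g} -> {for x, continuous (fun x => (f x, g x))}.
Proof. by move=> fc gc; apply: cvg_pair; [exact: fc|exact: gc]. Qed.

Lemma continuous_op2 (X Y Z W : topologicalType) (op : Y * Z -> W) (f : X -> Y) (g : X -> Z) :
  continuous op -> continuous f -> continuous g -> continuous (fun x => op (f x, g x)).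
Proof.
move=> oc fc gc x.
by apply: (continuous_comp (continuous_pairing (fc x) (gc x))); exact: oc.
Qed.

(** * The relation that fixes the angles of the generators *)

Section Relator.
Variable R : realType.
Local Notation E := (e2cover R).
Implicit Types a b u : 'rV[R]_3.

Lemma e2inv_norm u : `|e2inv u| <= 2 * `|u|.
Proof.
apply: rV_norm_le; first by rewrite mulr_ge0.
have n (x t : R) : `|x| <= `|u| -> `|t| <= 1 -> `|t * x| <= `|u|.
  by move=> h1 h2; rewrite normrM -[leRHS]mul1r; exact: ler_pM.
have h0 := rV_norm_coord u i0; have h1 := rV_norm_coord u i1; have h2 := rV_norm_coord u i2.
have n1 := n _ _ h0 (cosq_norm (u 0 i2)); have n2 := n _ _ h1 (sinq_norm (u 0 i2)).
have n3 := n _ _ h0 (sinq_norm (u 0 i2)); have n4 := n _ _ h1 (cosq_norm (u 0 i2)).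
have u0 := normr_ge0 u; move: n1 n2 n3 n4 h2 u0; set N := `|u| => n1 n2 n3 n4 h2 u0.
apply: ord3P; rewrite !vec3E.
- by move: n1 n2; rewrite !ler_norml; lra.
- by move: n3 n4; rewrite !ler_norml; lra.
- by move: h2; rewrite !ler_norml; lra.
Qed.

(* Trivial for a = (1, 0) and b = (0, 1), a quarter turn. *)
Definition relator a b := e2mul (e2mul (e2mul b b) a) (e2mul (e2inv (e2mul b b)) a).

(** In complex notation the planar part is [(E(2T) + 1) z], with [z] the planar part of [a] and [T]
    the angle of [b]. *)
Lemma relatorE a b : a 0 i2 = 0 -> relator a b = vec3
  (cosq (b 0 i2 + b 0 i2) * a 0 i0 - sinq (b 0 i2 + b 0 i2) * a 0 i1 + a 0 i0)
  (sinq (b 0 i2 + b 0 i2) * a 0 i0 + cosq (b 0 i2 + b 0 i2) * a 0 i1 + a 0 i1) 0.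
Proof.
move=> a2; have h t : cosq t ^+ 2 = 1 - sinq t ^+ 2 :> R by rewrite -(cosq2Dsinq2 t) addrK.
apply: rV3P; rewrite !vec3E a2 ?addr0 ?cosqN ?sinqN; last by ring.
- by ring: (h (b 0 i2 + b 0 i2)).
- by ring: (h (b 0 i2 + b 0 i2)).
Qed.

Lemma relator_base : relator (vec3 1 0 0) (vec3 0 0 1) = 0.
Proof.
rewrite relatorE ?vec3E// cosqD sinqD cosq1 sinq1.
by apply: rV3P; rewrite !vec3E mxE; ring.
Qed.

Lemma relator_eq0 a b : relator a b = 0 -> `|a - vec3 1 0 0| <= 4^-1 ->
  `|b - vec3 0 0 1| <= 4^-1 -> a 0 i2 = 0 /\ b 0 i2 = 1.
Proof.
move=> r0 ha hb.
have a2 : a 0 i2 = 0 by have /matrixP/(_ 0 i2) := r0; rewrite !vec3E mxE; lra.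
split => //; move: r0; rewrite relatorE// => /matrixP r0.
have := r0 0 i0; have := r0 0 i1; rewrite !vec3E !mxE.
have := le_trans (rV_norm_coord _ i0) ha; rewrite !mxE/= ler_norml.
have := le_trans (rV_norm_coord _ i2) hb; rewrite !mxE/= ler_norml.
set T := b 0 i2; set x := a 0 i0; set y := a 0 i1 => hT hx e1 e0.
have h2 := cosq2Dsinq2 (T + T); set c := cosq (T + T) in e0 e1 h2; set s := sinq (T + T) in e0 e1 h2.
(* The real part of [(E(2T) + 1) z] times the conjugate of [z]; here [z] is nonzero because
   [x >= 3/4]. *)
have xy : (c + 1) * (x ^+ 2 + y ^+ 2) = 0.
  have -> : (c + 1) * (x ^+ 2 + y ^+ 2) = (c * x - s * y + x) * x + (s * x + c * y + y) * y by ring.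
  by rewrite e0 e1 !mul0r addr0.
have xy0 : x ^+ 2 + y ^+ 2 != 0.
  rewrite gt_eqF//; apply: ltr_wpDr; first exact: sqr_ge0.
  by rewrite exprn_gt0//; lra.
have cm : c = -1.
  by move/eqP: xy; rewrite mulf_eq0 (negbTE xy0) orbF addr_eq0 => /eqP.
have sm : s = 0.
  by move: h2; rewrite cm sqrrN expr1n => h2; apply/eqP; rewrite -sqrf_eq0; apply/eqP; lra.
(* [E(phi) = 1] makes [phi] a multiple of 4, and [T] within 1/4 of 1 leaves only 0. *)
pose phi := (T + T) - (1 + 1).
have : cosq phi = 1.
  rewrite /phi cosqD cosqN sinqN !(cosqD 1) !(sinqD 1) cosq1 sinq1 -/c -/s cm sm; ring.
move=> /cosq_eq1[k kint kE].
have k0 : k = 0 by apply: int_small => //; rewrite ltr_norml; move: kE hT; rewrite /phi; lra.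
by move: kE; rewrite k0 /phi; lra.
Qed.

Lemma relator_near : exists2 d : R, 0 < d & forall a b,
  `|a - vec3 1 0 0| < d -> `|b - vec3 0 0 1| < d -> `|relator a b| < 8^-1.
Proof.
pose F := fun p : E * E => relator p.1 p.2 : E.
have mc : continuous (fun p : E * E => (p.1 * p.2)%g : E) by have [] := e2_smooth_mul R.
have ic : continuous (fun p : E => (p^-1)%g : E) by have [] := e2_smooth_inv R.
have mulc (f g : E * E -> E) : continuous f -> continuous g -> continuous (fun p => (f p * g p)%g).
  by move=> fc gc; exact: (continuous_op2 mc fc gc).
have c1 : continuous (fun p : E * E => p.1) by move=> p; exact: cvg_fst.
have c2 : continuous (fun p : E * E => p.2) by move=> p; exact: cvg_snd.
have bb := mulc _ _ c2 c2.
have bbi : continuous (fun p : E * E => ((p.2 * p.2)^-1)%g : E).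
  by move=> p; apply: (continuous_comp (bb p)); exact: ic.
have Fc : continuous F by exact: (mulc _ _ (mulc _ _ bb c1) (mulc _ _ bbi c1)).
have : nbhs (F (vec3 1 0 0, vec3 0 0 1)) (fun z : 'rV[R]_3 => `|z| < 8^-1).
  rewrite /F/= relator_base; apply/nbhs_distP; exists 8^-1; first by rewrite invr_gt0.
  by move=> y; rewrite subr0.
move=> /Fc [[A B] /= [/nbhs_distP[d1 d10 h1] /nbhs_distP[d2 d20 h2]] AB].
exists (Num.min d1 d2) => [|a b]; first by rewrite lt_min d10.
rewrite !lt_min => /andP[a1 _] /andP[_ b2].
by apply: (AB (a, b)); split => /=; [exact: h1|exact: h2].
Qed.

End Relator.

(** * Local rigidity *)

Section LocalRigidity.
Variable R : realType.
Local Notation E := (e2cover R).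
Local Notation M := (flat3 R).
Local Notation rho0 := (rho (turn1 R)).
Local Notation x0 := (fproj (0 : 'rV[R]_3)).
Implicit Types p q s t u y z g : 'rV[R]_3.

Let cM : compat_atlas M. Proof. exact: manifold_compat. Qed.
Let cE : compat_atlas E. Proof. exact: manifold_compat. Qed.

Variable act : smoothMap (M * E)%type M.
Hypothesis act_action : right_action act.
Hypothesis act_trans : forall x y : M, exists w : E, act (x, w) = y.

Definition orb (w : 'rV[R]_3) : M := act (x0, w : E).

Lemma orb0 : orb 0 = x0.
Proof. exact: act_action.1. Qed.

Lemma act_orb s t : act (orb s, t) = orb (e2mul s t).
Proof. exact: act_action.2. Qed.

Lemma orb_surj x : exists w, orb w = x.
Proof. exact: act_trans. Qed.

Lemma orb_cancel s t : orb s = orb t -> orb (e2mul s (e2inv t)) = x0.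
Proof. by move=> h; rewrite -act_orb h act_orb e2mulV orb0. Qed.

Lemma smooth_act_r (w : E) : smooth (fun x : M => act (x, w)).
Proof.
apply: (smooth_comp (f := fun x : M => (x, w)) (g := act)) => //; first exact: compat_prod.
  by apply: smooth_pair => //; [exact: smooth_id|exact: smooth_cst].
exact: smoothMapP.
Qed.

Lemma smooth_orb : smooth (orb : E -> M).
Proof.
apply: (smooth_comp (f := fun w : E => (x0, w)) (g := act)) => //; first exact: compat_prod.
  by apply: smooth_pair => //; [exact: smooth_cst|exact: smooth_id].
exact: smoothMapP.
Qed.

Hypothesis orb_chart : forall s, `|s| <= 8^-1 -> fchart_dom 0 (orb s) /\
  forall i, `|pd i (fun s => fchart_fun 0 (orb s)) s - delta_mx 0 i| <= 8^-1.

Definition orb_rep s := fchart_fun 0 (orb s).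

Let r8 : 0 < 8^-1 :> R. Proof. by rewrite invr_gt0. Qed.

Lemma fproj_orb_rep s : `|s| <= 8^-1 -> fproj (orb_rep s) = orb s.
Proof. by move=> /orb_chart[h _]; exact: (chart_funK (c := fchart 0) h). Qed.

Lemma orb_rep0 : orb_rep 0 = 0.
Proof. by rewrite /orb_rep orb0 fchart_funE//; exact: qball_center. Qed.

Lemma orb_rep_Cinfty : Cinfty_on (ball (0 : 'rV[R]_3) 8^-1) orb_rep.
Proof.
have [_ h] := smooth_orb.
have := h (e2chart R) (fchart 0) erefl (fchart_atlas 0).
apply: Cinfty_on_sub => s; rewrite -ball_normE/= sub0r normrN => /ltW/orb_chart[d _].
by split.
Qed.

(** The bound 1/8 is written as [1/(2(n+1))] with [n = 3], as the inversion results require. *)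
Lemma orb_rep_near_id s : ball (0 : 'rV[R]_3) 8^-1 s -> forall i,
  `|pd i orb_rep s - delta_mx 0 i| <= (2 * 4%:R)^-1.
Proof.
rewrite -ball_normE/= sub0r normrN => /ltW/orb_chart[_ h] i.
by have := h i; rewrite -natrM.
Qed.

Lemma orb_inj s t : `|s| < 8^-1 -> `|t| < 8^-1 -> orb s = orb t -> s = t.
Proof.
move=> s8 t8 st; apply: (near_id_inj orb_rep_Cinfty orb_rep_near_id s8 t8).
by rewrite /orb_rep st.
Qed.

Lemma iso_small s : `|s| < 8^-1 -> orb s = x0 -> s = 0.
Proof. by move=> s8 h; apply: orb_inj; rewrite ?normr0// h orb0. Qed.

Lemma orb_onto z : `|z| < 16^-1 -> exists2 u, `|u| <= 2 * `|z| & orb u = fproj z.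
Proof.
move=> z16; have z0 : `|z - orb_rep 0| = `|z| by rewrite orb_rep0 subr0.
have [|u] := near_id_surj r8 orb_rep_Cinfty orb_rep_near_id (z := z).
  by rewrite z0; lra.
rewrite z0 => uz uE; exists u => //; rewrite -uE fproj_orb_rep//.
by apply: le_trans uz _; lra.
Qed.

Variable eps : R.
Hypothesis eps_small : 20 * (20 * eps) <= 1.
Hypothesis orb_near : forall s, `|s| <= 3 -> exists2 y, `|y - s| < eps & orb s = fproj y.

(** The point [orb g] is the image of some [z = g^-1 y] of norm below [eps], which the orbit map
    also reaches from some [u] of norm at most [2 eps]; then [g u^-1] fixes the base point. The
    second factor 2 in [4 * eps] is the cost of inverting [u]. *)
Lemma iso_approx g : lat g -> `|g| <= 3 ->
  exists2 g', `|g' - g| <= 4 * eps & orb g' = x0.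
Proof.
move=> lg g3; have [y yg gy] := orb_near g3.
pose z := e2mul (e2inv g) y.
have zn : `|z| < eps.
  have -> : z = e2mul (e2inv g) y - e2mul (e2inv g) g by rewrite e2mulVl subr0.
  by rewrite lat_isometry//; exact: latV.
have z16 : `|z| < 16^-1 by move: zn eps_small; lra.
have [u uz uE] := orb_onto z16.
exists (e2mul g (e2inv u)); last first.
  by apply: orb_cancel; rewrite uE gy /z fproj_lat//; exact: latV.
rewrite -{2}(e2mul1 g) lat_isometry// subr0.
by apply: le_trans (e2inv_norm u) _; lra.
Qed.

Hypothesis relator_small : forall a b, `|a - vec3 1 0 0| <= 4 * eps ->
  `|b - vec3 0 0 1| <= 4 * eps -> `|relator a b| < 8^-1.

Lemma vec3_norm_le (a b c d : R) : 0 <= d -> `|a| <= d -> `|b| <= d -> `|c| <= d ->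
  `|vec3 a b c| <= d.
Proof. by move=> d0 ha hb hc; apply: rV_norm_le => //; apply: ord3P; rewrite vec3E. Qed.

(** One relation is enough. Once [a] has angle 0 and [b] has angle 1, the conjugate of [a] by [b] is
    again a translation and commutes with [a], as in the lattice. *)
Lemma iso_generators : exists v0 v1 w0 w1 : R,
  [/\ `|v0 - 1| <= 4 * eps /\ `|v1| <= 4 * eps, `|w0| <= 4 * eps /\ `|w1| <= 4 * eps,
   orb (vec3 v0 v1 0) = x0 & orb (vec3 w0 w1 1) = x0].
Proof.
have g1 : `|vec3 1 0 0 : 'rV[R]_3| <= 3 by apply: vec3_norm_le; rewrite ?normr1 ?normr0; lra.
have g3 : `|vec3 0 0 1 : 'rV[R]_3| <= 3 by apply: vec3_norm_le; rewrite ?normr1 ?normr0; lra.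
have l1 : lat (vec3 1 0 0 : 'rV[R]_3) by rewrite /lat !vec3E rpred1 rpred0.
have l3 : lat (vec3 0 0 1 : 'rV[R]_3) by rewrite /lat !vec3E rpred1 rpred0.
have [a ha aI] := iso_approx l1 g1; have [b hb bI] := iso_approx l3 g3.
have isoM s t : orb s = x0 -> orb t = x0 -> orb (e2mul s t) = x0.
  by move=> hs ht; rewrite -act_orb hs; exact: ht.
have isoV s : orb s = x0 -> orb (e2inv s) = x0.
  by move=> hs; rewrite -(e2mul1l (e2inv s)); apply: orb_cancel; rewrite orb0.
have rI : orb (relator a b) = x0.
  by apply: (isoM); apply: (isoM) => //; [exact: isoM|apply: isoV; exact: isoM].
have r0 : relator a b = 0 by apply: iso_small => //; exact: relator_small.
have [||a2 b2] := relator_eq0 r0.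
- by apply: le_trans ha _; move: eps_small; lra.
- by apply: le_trans hb _; move: eps_small; lra.
exists (a 0 i0), (a 0 i1), (b 0 i0), (b 0 i1); split.
- have := le_trans (rV_norm_coord _ i0) ha; have := le_trans (rV_norm_coord _ i1) ha.
  by rewrite !mxE/= subr0.
- have := le_trans (rV_norm_coord _ i0) hb; have := le_trans (rV_norm_coord _ i1) hb.
  by rewrite !mxE/= !subr0.
- by rewrite -aI; congr orb; apply: rV3P; rewrite !vec3E.
- by rewrite -bI; congr orb; apply: rV3P; rewrite !vec3E.
Qed.

(** * The conjugacy and its homotopy to the identity *)

Section Conjugacy.
Variables v0 v1 w0 w1 : R.
Hypothesis v0_near : `|v0 - 1| <= 4 * eps.
Hypothesis v1_near : `|v1| <= 4 * eps.
Hypothesis w0_near : `|w0| <= 4 * eps.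
Hypothesis w1_near : `|w1| <= 4 * eps.
Hypothesis isoa : orb (vec3 v0 v1 0) = x0.
Hypothesis isob : orb (vec3 w0 w1 1) = x0.

(* Solution of (1 - i) c = w, so that the automorphism maps the quarter turn (0, 1) to (w, 1). *)
Let c0 := (w0 - w1) / 2.
Let c1 := (w0 + w1) / 2.

Definition aut : 'rV[R]_3 -> 'rV[R]_3 := sim v0 v1 c0 c1.
Definition aut_inv : 'rV[R]_3 -> 'rV[R]_3 := sim_inv v0 v1 c0 c1.

Let vn0 : v0 ^+ 2 + v1 ^+ 2 != 0.
Proof.
rewrite gt_eqF//; apply: ltr_wpDr; first exact: sqr_ge0.
by rewrite exprn_gt0//; move: v0_near eps_small; rewrite ler_norml; lra.
Qed.

Lemma autM s t : aut (e2mul s t) = e2mul (aut s) (aut t). Proof. exact: simM. Qed.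
Lemma autK : cancel aut aut_inv. Proof. exact: simK. Qed.
Lemma aut_invK : cancel aut_inv aut. Proof. exact: sim_invK. Qed.
Lemma aut0 : aut 0 = 0. Proof. exact: sim0. Qed.
Lemma aut_inv0 : aut_inv 0 = 0. Proof. exact: sim_inv0. Qed.
Lemma aut_invM s t : aut_inv (e2mul s t) = e2mul (aut_inv s) (aut_inv t).
Proof. exact: sim_invM. Qed.

Lemma aut_near s : `|s| <= 1 -> `|aut s - s| <= 20 * eps.
Proof.
have h0 : `|c0| <= 4 * eps.
  by rewrite /c0; move: w0_near w1_near; rewrite !ler_norml; lra.
have h1 : `|c1| <= 4 * eps.
  by rewrite /c1; move: w0_near w1_near; rewrite !ler_norml; lra.
by move=> s1; apply: le_trans (sim_near v0_near v1_near h0 h1 s1) _; lra.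
Qed.

(** The isotropy group at the base point, pulled back by the automorphism. The next lemmas show that
    it is exactly the lattice. *)
Definition iso_aut s := orb (aut s) = x0.

Lemma iso_autM s t : iso_aut s -> iso_aut t -> iso_aut (e2mul s t).
Proof. by rewrite /iso_aut => hs ht; rewrite autM -act_orb hs; exact: ht. Qed.

Lemma iso_aut_div s t : iso_aut s -> iso_aut (e2mul s t) -> iso_aut t.
Proof. by rewrite /iso_aut autM -act_orb => ->; exact. Qed.

Lemma iso_autV s : iso_aut s -> iso_aut (e2inv s).
Proof.
by move=> hs; apply: (iso_aut_div hs); rewrite /iso_aut e2mulV aut0 orb0.
Qed.

Lemma iso_aut_int (h : R -> 'rV[R]_3) : h 0 = 0 ->
  (forall a b, h (a + b) = e2mul (h a) (h b)) -> iso_aut (h 1) ->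
  forall k, k \is a Num.int -> iso_aut (h k).
Proof.
move=> h0 hD h1 _ /intrP[k ->].
have hn (n : nat) : iso_aut (h n%:R).
  elim: n => [|n IH]; first by rewrite h0 /iso_aut aut0 orb0.
  by rewrite -natr1 hD; exact: iso_autM.
case: k => n; first exact: hn.
rewrite NegzE mulrNz; apply: (iso_aut_div (hn n.+1)).
by rewrite -hD subrr h0 /iso_aut aut0 orb0.
Qed.

(** The two hypotheses on isotropy give the generators [(1, 0, 0)] and [(0, 0, 1)]; conjugating one
    by the other gives [(0, 1, 0)], and every lattice element is a product of integer powers of
    these three. *)
Lemma iso_aut_lat g : lat g -> iso_aut g.
Proof.
have h1 : iso_aut (vec3 1 0 0).
  by rewrite /iso_aut -isoa; congr orb; apply: rV3P; rewrite !vec3E ?cosq0 ?sinq0; ring.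
have h3 : iso_aut (vec3 0 0 1).
  by rewrite /iso_aut -isob; congr orb; apply: rV3P; rewrite !vec3E ?cosq1 ?sinq1 /c0 /c1//; field.
have h2 : iso_aut (vec3 0 1 0).
  have -> : vec3 0 1 0 = e2mul (e2mul (vec3 0 0 1) (vec3 1 0 0)) (e2inv (vec3 0 0 1)) :> 'rV[R]_3.
    by apply: rV3P; rewrite !vec3E ?cosqN ?sinqN ?addr0 ?cosq1 ?sinq1; ring.
  by apply: iso_autM; [exact: iso_autM|exact: iso_autV].
move=> /and3P[g0 g1 g2].
have -> : g = e2mul (e2mul (vec3 (g 0 i0) 0 0) (vec3 0 (g 0 i1) 0)) (vec3 0 0 (g 0 i2)).
  by apply: rV3P; rewrite !vec3E ?addr0 ?cosq0 ?sinq0; ring.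
apply: iso_autM; [apply: iso_autM|].
- apply: (iso_aut_int (h := fun x => vec3 x 0 0)) => //.
    by apply: rV3P; rewrite !vec3E mxE.
  by move=> a b; apply: rV3P; rewrite !vec3E ?cosq0 ?sinq0; ring.
- apply: (iso_aut_int (h := fun x => vec3 0 x 0)) => //.
    by apply: rV3P; rewrite !vec3E mxE.
  by move=> a b; apply: rV3P; rewrite !vec3E ?cosq0 ?sinq0; ring.
- apply: (iso_aut_int (h := fun x => vec3 0 0 x)) => //.
    by apply: rV3P; rewrite !vec3E mxE.
  by move=> a b; apply: rV3P; rewrite !vec3E; ring.
Qed.

Lemma cube_norm s : cube s -> `|s| <= 1.
Proof.
move=> cs; apply: rV_norm_le => // j; have := cs j; rewrite ler_norml; lra.
Qed.

(** No isotropy is gained. After reduction to the cube, the element [s] is within [21 eps] of a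
    lattice point [k], since [aut s] is within [eps] of a lift of the base point. Then [k^-1 s]
    belongs to the pulled-back isotropy and its image has norm at most [41 eps < 1/8], so it is
    trivial. *)
Lemma lat_iso_aut h : iso_aut h -> lat h.
Proof.
move=> hI; have [g lg cg] := cube_cover h; set s := e2mul g h in cg.
have sI : iso_aut s by apply: iso_autM => //; exact: iso_aut_lat.
have s1 := cube_norm cg; have Ps := aut_near s1.
have Ps3 : `|aut s| <= 3.
  rewrite -(subrK s (aut s)); apply: le_trans (ler_normD _ _) _.
  by move: Ps s1 eps_small; lra.
have [y yPs yE] := orb_near Ps3.
have [k lk kE] : exists2 k, lat k & y = e2mul k 0.
  by apply/fprojP; rewrite -yE.
rewrite e2mul1 in kE; subst y.
pose u := e2mul (e2inv k) s.
have us : `|u| <= 21 * eps.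
  have -> : u = e2mul (e2inv k) s - e2mul (e2inv k) k by rewrite e2mulVl subr0.
  rewrite lat_isometry; last exact: latV.
  rewrite -(subrKA (aut s)); apply: le_trans (ler_normD _ _) _.
  by rewrite [`|s - _|]distrC [`|_ - k|]distrC; move: Ps yPs; lra.
have uI : iso_aut u by apply: iso_autM => //; apply: iso_aut_lat; exact: latV.
have Pu : `|aut u| < 8^-1.
  rewrite -(subrK u (aut u)); apply: le_lt_trans (ler_normD _ _) _.
  have u1 : `|u| <= 1 by move: us eps_small; lra.
  by have := aut_near u1; move: us eps_small; lra.
have u0 : u = 0 by apply: (can_inj autK); rewrite aut0; exact: iso_small.
have sk : s = k by rewrite -(e2mul1l s) -(e2mulV k) -e2mulA -/u u0 e2mul1.
have -> : h = e2mul (e2inv g) k by rewrite -sk /s e2mulA e2mulVl e2mul1l.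
by apply: latM => //; exact: latV.
Qed.

Definition conj_map (x : M) : M := orb (aut (repr x)).

Lemma conj_mapE p : conj_map (fproj p) = orb (aut p).
Proof.
have : fproj (repr (fproj p)) = fproj p by rewrite /fproj reprK.
rewrite /conj_map => /esym/fprojP[g lg ->].
by rewrite autM -act_orb (iso_aut_lat lg).
Qed.

(** Here the exclusion of extra isotropy is used; the opposite inclusion [iso_aut_lat] made the map
    well defined. *)
Lemma conj_map_inj p q : orb (aut p) = orb (aut q) -> fproj p = fproj q.
Proof.
move=> h; have pq : lat (e2mul q (e2inv p)).
  by apply: lat_iso_aut; rewrite /iso_aut autM -act_orb -h act_orb -autM e2mulV aut0 orb0.
by apply/fprojP; exists (e2mul q (e2inv p)) => //; rewrite -e2mulA e2mulVl e2mul1.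
Qed.

Lemma smooth_conj_map : smooth conj_map.
Proof.
apply: (smooth_descent (F := fun p : E => orb (aut p))) => //; first exact: conj_mapE.
apply: (smooth_comp (f := fun p : E => aut p : E)) => //; last exact: smooth_orb.
by apply: smooth_e2; exact: Cinfty_sim.
Qed.

Lemma conj_map_equivariant (x : M) (s : E) : conj_map (rho0 (x, s)) = act (conj_map x, aut s).
Proof.
have [p <-] := fproj_surj x.
by rewrite rho0E !conj_mapE autM act_orb.
Qed.

Definition conj_inv (y : M) : M := fproj (aut_inv (xget 0 [set w | orb w = y])).

Lemma conj_invE w : conj_inv (orb w) = fproj (aut_inv w).
Proof.
rewrite /conj_inv; case: xgetP => [v _ /= vw|hn]; last by case: (hn w).
by apply: conj_map_inj; rewrite !aut_invK.
Qed.

Lemma conj_mapK : cancel conj_map conj_inv.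
Proof. by move=> x; have [p <-] := fproj_surj x; rewrite conj_mapE conj_invE autK. Qed.

Lemma conj_invK : cancel conj_inv conj_map.
Proof. by move=> y; have [w <-] := orb_surj y; rewrite conj_invE conj_mapE aut_invK. Qed.

Definition orb_sol z := xget 0 [set u | `|u| < 8^-1 /\ orb_rep u = z].

Lemma orb_solP z : `|z| < 32^-1 -> `|orb_sol z| < 8^-1 /\ orb_rep (orb_sol z) = z.
Proof.
move=> z32; rewrite /orb_sol; case: xgetP => [u -> []//|hn].
have z16 : `|z| < 16^-1 by move: z32; lra.
have [u uz uE] := orb_onto z16.
have u8 : `|u| < 8^-1 by move: uz z32; lra.
case: (hn u); split => //; rewrite /orb_rep uE fchart_funE//.
by apply/qballE; rewrite subr0; move: z32; lra.
Qed.

Lemma orb_sol_orb z : `|z| < 32^-1 -> orb (orb_sol z) = fproj z.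
Proof. by move=> /orb_solP[u8 uE]; rewrite -fproj_orb_rep ?uE// ltW. Qed.

Lemma orb_sol0 : orb_sol 0 = 0.
Proof.
have z0 : `|0 : 'rV[R]_3| < 32^-1 by rewrite normr0 invr_gt0.
have [u8 _] := orb_solP z0; apply: orb_inj; rewrite ?normr0//.
by rewrite orb_sol_orb// orb0.
Qed.

Lemma orb_sol_Cinfty : Cinfty_on (ball (0 : 'rV[R]_3) 32^-1) orb_sol.
Proof.
apply: (near_id_inverse_Cinfty orb_rep_Cinfty orb_rep_near_id).
- exact: ball_open.
- by move=> z; rewrite -ball_normE/= sub0r normrN => /orb_solP[].
- by move=> z; rewrite -ball_normE/= sub0r normrN => /orb_solP[].
Qed.

(** In the chart at the base point, the inverse is [aut_inv] after the local inverse [orb_sol] of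
    the orbit map, which is smooth by the inversion result for maps near the identity. *)
Lemma smooth_near_conj_inv0 : smooth_near conj_inv x0.
Proof.
pose B := ball (0 : 'rV[R]_3) 32^-1.
have oB : open B by exact: ball_open.
pose f := fun z => aut_inv (orb_sol z).
have fC : Cinfty_on B f.
  apply: (Cinfty_comp (V := setT) oB) => //; first exact: openT.
    exact: orb_sol_Cinfty.
  exact: Cinfty_sim_inv.
have oV : open (B `&` f @^-1` qball 0).
  by apply: open_preimage_on => //; [exact: qball_open|move=> z Bz; have [] := fC [::] z Bz].
have fE z : B z -> conj_inv (fproj z) = fproj (f z).
  by rewrite /B -ball_normE/= sub0r normrN => z32; rewrite -orb_sol_orb// conj_invE.
have c0E : fchart_fun 0 x0 = 0 by rewrite fchart_funE//; exact: qball_center.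
exists (fchart 0), (fchart 0), (B `&` f @^-1` qball 0); split => //.
- by split; [exact: fchart_atlas|exact: fchart_atlas|apply: fchart_domE; exact: qball_center].
- rewrite /= c0E; split; first by apply: ballxx; rewrite invr_gt0.
  by rewrite /preimage/= /f orb_sol0 aut_inv0; exact: qball_center.
- move=> z [Bz qz]; split; last by rewrite /= fE//; exact: fchart_domE.
  by apply/qballE; move: Bz; rewrite /B -ball_normE/= sub0r normrN subr0; lra.
apply: (@Cinfty_on_eq _ _ _ _ f) => //.
  by move=> z; rewrite inE => -[Bz qz]; rewrite /local_rep/= fE// fchart_funE.
by apply: Cinfty_on_sub fC => z [].
Qed.

(* By equivariance the inverse is smooth everywhere once it is smooth at one point. *)
Lemma smooth_conj_inv : smooth conj_inv.
Proof.
apply: smooth_local => // y; have [w0' wy] := orb_surj y.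
pose T := fun x : M => act (x, e2inv w0' : E).
pose A := fun x : M => rho0 (x, aut_inv w0' : E).
have E0 : A \o (conj_inv \o T) =1 conj_inv.
  move=> x /=; have [w <-] := orb_surj x.
  rewrite /T act_orb !conj_invE /A rho0E -aut_invM -e2mulA e2mulVl e2mul1//.
have sT : smooth_near T y by apply: smooth_smooth_near => //; exact: smooth_act_r.
have Ty : T y = x0 by rewrite -wy /T act_orb e2mulV orb0.
have sA : smooth A.
  apply: (smooth_comp (f := fun x : M => (x, aut_inv w0' : E)) (g := rho0)) => //; first exact: compat_prod.
    by apply: smooth_pair => //; [exact: smooth_id|exact: smooth_cst].
  exact: smoothMapP.
have n0 : smooth_near conj_inv (T y) by rewrite Ty; exact: smooth_near_conj_inv0.
have n1 := smooth_near_comp cM sT n0.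
have n2 := smooth_smooth_near ((conj_inv \o T) y) cM cM sA.
exact: (smooth_near_eq E0 (smooth_near_comp cM n1 n2)).
Qed.

(** The lift of [conj_map] to the cover that stays close to the identity. [aut] itself need not be a
    lift, since [conj_map] follows it by the orbit map of the perturbed action instead of
    [fproj]. *)
Definition lift p := xget 0 [set y : 'rV[R]_3 | `|y - p| < 8^-1 /\ fproj y = conj_map (fproj p)].

Lemma liftP p : `|lift p - p| < 8^-1 /\ fproj (lift p) = conj_map (fproj p).
Proof.
rewrite /lift; case: xgetP => [y -> []//|hn].
have [g lg cg] := cube_cover p; set s := e2mul g p in cg.
have s1 := cube_norm cg; have Ps := aut_near s1.
have Ps3 : `|aut s| <= 3.
  rewrite -(subrK s (aut s)); apply: le_trans (ler_normD _ _) _.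
  by move: Ps s1 eps_small; lra.
have [y yPs yE] := orb_near Ps3.
(* The estimates hold on the cube only; the point found there is carried back by the lattice
   isometry. *)
case: (hn (e2mul (e2inv g) y)); split; last first.
  rewrite fproj_lat; last exact: latV.
  by rewrite -yE -conj_mapE /s fproj_lat.
have -> : p = e2mul (e2inv g) s by rewrite /s e2mulA e2mulVl e2mul1l.
rewrite lat_isometry; last exact: latV.
rewrite -(subrKA (aut s)); apply: le_lt_trans (ler_normD _ _) _.
by move: Ps yPs eps_small; lra.
Qed.

Lemma lift_uniq p y : `|y - p| < 8^-1 -> fproj y = conj_map (fproj p) -> lift p = y.
Proof.
move=> yp yE; have [lp lE] := liftP p; apply: (qball_inj (p := p)).
- by apply/qballE; move: lp; lra.
- by apply/qballE; move: yp; lra.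
- by rewrite lE yE.
Qed.

Lemma lift_lat g p : lat g -> lift (e2mul g p) = e2mul g (lift p).
Proof.
move=> lg; have [lp lE] := liftP p; apply: lift_uniq; first by rewrite lat_isometry.
by rewrite !fproj_lat.
Qed.

(** Near [p0] the lift is the chart [fchart p0] applied to [conj_map]: points within 1/8 of [p0]
    move by less than 1/8, so their lifts stay in the ball of radius 1/4. *)
Lemma Cinfty_lift : Cinfty_on setT lift.
Proof.
apply: Cinfty_on_local => p0 _; exists (ball p0 8^-1).
have oB : open (ball p0 (8^-1 : R)) by exact: ball_open.
have lq p : ball p0 8^-1 p -> qball p0 (lift p).
  rewrite -ball_normE/= => pp0; apply/qballE; have [lp _] := liftP p.
  rewrite -(subrKA p); apply: le_lt_trans (ler_normD _ _) _.
  by rewrite [`|p - p0|]distrC; move: pp0 lp; lra.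
split => //; first by apply: ballxx; rewrite invr_gt0.
have [_ h] : smooth (fun p : E => conj_map (fproj p)).
  apply: (smooth_comp (f := fun p : E => fproj p)) => //; first exact: smooth_fproj.
  exact: smooth_conj_map.
have := h (e2chart R) (fchart p0) erefl (fchart_atlas p0).
move=> h1; apply: (Cinfty_on_eq oB _ (Cinfty_on_sub _ h1)).
  move=> p; rewrite inE => Bp; rewrite /local_rep/=.
  by have [_ <-] := liftP p; rewrite fchart_funE//; exact: lq.
move=> p Bp; split => //=; have [_ <-] := liftP p.
by apply: fchart_domE; exact: lq.
Qed.

Definition slide (tau : R) p : 'rV[R]_3 := p + tau *: (lift p - p).

(** Left translation by a lattice element is affine in the coordinates and therefore maps segments
    to segments. *)
Lemma slide_lat tau g p : lat g -> slide tau (e2mul g p) = e2mul g (slide tau p).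
Proof.
move=> lg; rewrite /slide lift_lat//; set q := lift p.
by apply: rV3P; rewrite !(vec3E, mxE)/=; ring.
Qed.

Definition homotopy (x : R * M) : M := fproj (slide x.1 (repr x.2)).

Lemma homotopyE tau p : homotopy (tau, fproj p) = fproj (slide tau p).
Proof.
have : fproj (repr (fproj p)) = fproj p by rewrite /fproj reprK.
by rewrite /homotopy/= => /esym/fprojP[g lg ->]; rewrite slide_lat// fproj_lat.
Qed.

Lemma lift_continuous : continuous lift.
Proof. by move=> p; have [] := Cinfty_lift [::] (x := p) I. Qed.

Lemma slide_continuous : continuous (fun x : R * 'rV[R]_3 => slide x.1 x.2).
Proof.
move=> x; apply: (@cvgD _ 'rV[R]_3); first exact: cvg_snd.
apply: (@cvgZ _ 'rV[R]_3); first exact: cvg_fst.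
apply: (@cvgB _ 'rV[R]_3); last exact: cvg_snd.
by apply: (continuous_comp (g := lift)); [exact: cvg_snd|exact: lift_continuous].
Qed.

(** The representative chosen by [repr] need not vary continuously, so near each point it is
    replaced by the lift given by a chart, which yields the same value. *)
Lemma homotopy_continuous : continuous homotopy.
Proof.
move=> [tau x]; have [p <-] := fproj_surj x.
have dp : fchart_dom p (fproj p) by apply: fchart_domE; exact: qball_center.
pose h := fun z : R * M => fproj (slide z.1 (fchart_fun p z.2)).
have hE : {near (tau, fproj p), h =1 homotopy}.
  exists (setT, fchart_dom p) => /=.
    split; first exact: filterT.
    by apply: open_nbhs_nbhs; split => //; exact: (chart_dom_open (fchart p)).
  move=> [t y] [_ /= dy]; rewrite /h/=.
  have yE : y = fproj (fchart_fun p y) by exact: (esym (chart_funK (c := fchart p) dy)).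
  by rewrite [in RHS]yE homotopyE.
rewrite /continuous_at -(nbhs_singleton hE).
apply: cvg_trans (near_eq_cvg hE) _; rewrite /h.
apply: (continuous_comp (f := fun z : R * M => slide z.1 (fchart_fun p z.2)) (g := @fproj R)); last exact: fproj_continuous.
apply: (continuous_comp (f := fun z : R * M => (z.1, fchart_fun p z.2)) (g := fun x : R * 'rV[R]_3 => slide x.1 x.2)); last exact: slide_continuous.
apply: continuous_pairing; first exact: cvg_fst.
apply: (continuous_comp (f := snd) (g := fchart_fun p)); first exact: cvg_snd.
exact: (chart_fun_cont (c := fchart p) dp).
Qed.

Lemma homotopy_smooth tau : smooth (fun x : M => homotopy (tau, x)).
Proof.
apply: (smooth_descent (F := fun p : E => fproj (slide tau p))) => //; first exact: homotopyE.
apply: (smooth_comp (f := fun p : E => slide tau p : E)) => //; last exact: smooth_fproj.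
apply: smooth_e2; apply: Cinfty_coords; first exact: openT.
have oT := @openT 'rV[R]_3; have lC := Cinfty_lift.
move=> j k; have /Cinfty_onP/(_ k)/(Ck_coord _ _ oT)/(_ j) lk := lC.
apply: (Ck_eq (f := fun p : 'rV[R]_3 => p 0 j + tau * (lift p 0 j - p 0 j)) oT).
  by move=> p _; rewrite /slide !mxE.
apply: CkD => //; first exact: Ck_proj.
apply: CkM => //; first exact: Ck_cst.
by apply: CkB => //; exact: Ck_proj.
Qed.

(** All of [M] is the only leaf, so preserving leaves imposes no restriction on the conjugacy or on
    the homotopy. *)
Lemma conj_equivalent : parameter_equivalent act rho0.
Proof.
exists aut, conj_map; split.
- exact: sim_automorphism.
- split; first exact: smooth_conj_map.
  by exists conj_inv; split; [exact: smooth_conj_inv|exact: conj_mapK|exact: conj_invK].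
- exact: conj_map_equivariant.
- by move=> L; rewrite rho_foliation => ->.
exists homotopy; split.
- by apply: continuous_subspaceT; exact: homotopy_continuous.
- by move=> x; have [p <-] := fproj_surj x; rewrite homotopyE /slide scale0r addr0.
- move=> x; have [p <-] := fproj_surj x; rewrite homotopyE /slide scale1r addrC subrK.
  by have [_] := liftP p.
- move=> tau _; split; first exact: homotopy_smooth.
  by move=> L; rewrite rho_foliation => ->.
Qed.

End Conjugacy.

Lemma near_action_equivalent : parameter_equivalent act rho0.
Proof.
have [v0 [v1 [w0 [w1 [[h1 h2] [h3 h4] h5 h6]]]]] := iso_generators.
exact: (conj_equivalent h1 h2 h3 h4 h5 h6).
Qed.

End LocalRigidity.

(** Two neighborhoods are intersected: C^1-closeness on the ball of radius 1/8 makes the orbit map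
    locally invertible, and C^0-closeness on the ball of radius 3 locates the isotropy near the
    lattice generators and controls the conjugacy on the cube. *)
Lemma rho1_locally_rigid (R : realType) : locally_parameter_rigid (rho (turn1 R)).
Proof.
have [d d0 hd] := relator_near R.
(* [1/400] keeps the accumulated errors below 1/8, and [d / 8] puts the approximate generators, at
   distance at most [4 eps], inside the neighborhood where the relator is small. *)
pose eps : R := Num.min (20^-1 * 20^-1) (d / 8).
have eps0 : 0 < eps by rewrite lt_min mulr_gt0 ?invr_gt0 ?divr_gt0 ?ltr0n.
have eps1 : 20 * (20 * eps) <= 1.
  have : eps <= 20^-1 * 20^-1 by rewrite /eps ge_min lexx.
  lra.
have eps2 : 4 * eps < d.
  have : eps <= d / 8 by rewrite /eps ge_min lexx orbT.
  lra.
have r8 : 0 < 8^-1 :> R by rewrite invr_gt0.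
have n1 := @near_lift R 0 _ r8.
have n2 := near_lift_compact (@closed_ball_compact R 0 3) eps0.
rewrite /locally_parameter_rigid /within/=.
apply: filterS2 n1 n2 => act h1 h2 [ra _ fol].
(* Transitivity is read off the orbit foliation, which is that of [rho0]. *)
have tr (x y : flat3 R) : exists w : e2cover R, act (x, w) = y.
  have : orbit_foliation act (action_orbit act x) by exists x.
  rewrite fol rho_foliation => E0.
  have : action_orbit act x y by rewrite E0.
  by move=> [w _ wE]; exists w.
apply: (near_action_equivalent ra tr _ eps1).
- move=> s s8; have s8' : `|s - 0| <= 8^-1 by rewrite subr0.
  by have [hs _ hp] := h1 s s8'; split => // i; apply: ltW; exact: hp.
- by move=> s s3; apply: h2; rewrite /= subr0.
- by move=> a b ha hb; apply: hd; [exact: le_lt_trans ha eps2|exact: le_lt_trans hb eps2].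
Qed.

Theorem mainTheorem7 (R : realType) :
  exists (k n : nat) (S : lieGroupType R k) (M : smoothManifoldType R n)
         (rho0 : smoothMap (M * S)%type M),
    [/\ [/\ connected [set: S], simply_connected R S, solvable_group S &
            contractible R S],
        compact [set: M],
        right_action rho0 /\ locally_free rho0,
        locally_parameter_rigid rho0 &
        ~ parameter_rigid rho0].
Proof.
exists 3%N, 3%N, (e2cover R), (flat3 R), (rho (turn1 R)); split.
- split; [exact: e2_connected|exact: e2_simply_connected|exact: e2_solvable|exact: e2_contractible].
- exact: flat3_compact.
- by split; [exact: rho_right_action|exact: rho_locally_free].
- exact: rho1_locally_rigid.
- exact: rho_not_rigid.
Qed.
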